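(* Let $X=(X_t)_{t\ge0}$ be a time-homogeneous strong Markov process on $(E,\mathcal{B}(E))$ with associated Markov semigroup $(P^t)_{t\ge0}$. Suppose there exist a measurable function $V:E\to[0,\infty)$ and a metric $d$ on $E$ such that the following conditions hold: (1) There exist a concave differentiable function $\varphi:\mathbb{R}_+\to\mathbb{R}_+$ increasing to infinity with $\varphi(0)=0$ and a constant $K\ge0$ such that for all $t\ge0$, $x\in E$, $$\mathbb{E}_xV(X_t)\le V(x)-\mathbb{E}_x\int_0^t\varphi(V(X_u))\,du+Kt .$$ (2) $(E,d)$ is a complete separable metric space. (3) There is $t_0\ge0$ such that for all $t\ge t_0$ and all $x,y\in E$, $W_d(P^t(x,\cdot),P^t(y,\cdot))\le d(x,y)\le1$. (4) For all $R>0$ and all $t\ge t_0$ there exists $\rho=\rho(R,t)>0$ such that $W_d(P^t(x,\cdot),P^t(y,\cdot))\le(1-\rho)\,d(x,y)$ for all $x,y\in E$ with $V(x)+V(y)\le R$. Then $X$ has a unique stationary probability measure $\pi$, and $\int_E\varphi(V(u))\,\pi(du)\le K$. Moreover, for any $\varepsilon>0$ there exist positive constants $C_1$ and $C_2$ such that for all $x\in E$, $$W_d(P^t(x,\cdot),\pi)\le\frac{C_1(1+V(x))}{\varphi\big(H_\varphi^{-1}(C_2t)\big)^{1-\varepsilon}},\qquad t\ge0 .$$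
   Context: $\mathcal{B}(E)$ is the Borel $\sigma$-algebra of $(E,d)$; $\mathcal{P}(E)$ is the set of probability measures on $(E,\mathcal{B}(E))$. $P^t(x,A)=\mathbb{P}_x(X_t\in A)$, and $P^t\mu(dx)=\int_E P^t(u,dx)\,\mu(du)$ for $\mu\in\mathcal{P}(E)$. A measure $\pi\in\mathcal{P}(E)$ is stationary if $P^t\pi=\pi$ for all $t\ge0$. Wasserstein (semi)distance: for $\mu,\nu\in\mathcal{P}(E)$, $$W_d(\mu,\nu)=\inf_{\lambda\in\mathcal{C}(\mu,\nu)}\int_{E\times E}d(x,y)\,\lambda(dx,dy),$$ where $\mathcal{C}(\mu,\nu)$ is the set of probability measures on $E\times E$ with marginals $\mu$ and $\nu$. $H_\varphi(x)=\int_1^x\frac{du}{\varphi(u)}$ for $x\ge1$, and $H_\varphi^{-1}$ is its inverse function. *)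

(* Defs.v *)
From HB Require Import structures.
From mathcomp Require Import all_boot all_order all_algebra.
From mathcomp Require Import all_classical all_reals all_analysis.

Set Implicit Arguments.
Unset Strict Implicit.
Unset Printing Implicit Defensive.

Import Order.TTheory GRing.Theory Num.Theory.
Import numFieldNormedType.Exports.

Local Open Scope classical_set_scope.
Local Open Scope ring_scope.

(* A complete metric space that also carries a sigma-algebra. The structure
   does not tie the two together: see [is_borel]. *)
#[short(type="measurableCompleteMetricType")]
HB.structure Definition MeasurableCompleteMetric (d : measure_display)
    (R : numDomainType) :=
  { T of Metric R T & CompletePseudoMetric R T & Measurable d T }.

Definition is_borel (d : measure_display) (R : numDomainType)
    (E : measurableCompleteMetricType d R) : Prop :=
  @measurable d E = <<s @open E >>.

Definition separable (T : topologicalType) : Prop :=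
  exists2 S : set T, countable S & dense S.

(* Processes are indexed by [t : R]; only the times [0 <= t] are ever used. *)

Definition filtration (d : measure_display) (Omega : measurableType d)
    (R : realType) (F : R -> set (set Omega)) : Prop :=
  [/\ forall t : R, 0 <= t -> sigma_algebra setT (F t),
      forall t : R, 0 <= t -> F t `<=` measurable &
      forall s t : R, 0 <= s -> s <= t -> F s `<=` F t].

(* For every t, (u, w) |-> X_u(w) is measurable on [0,t] x Omega for the
   sigma-algebra B([0,t]) (x) F_t. In particular X is adapted, X is jointly
   measurable, and X_tau is F_tau-measurable for every stopping time tau. *)
Definition progressively_measurable (d d' : measure_display)
    (Omega : measurableType d) (E : measurableType d') (R : realType)
    (F : R -> set (set Omega)) (X : R -> Omega -> E) : Prop :=
  forall t : R, 0 <= t ->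
    measurable_fun
      (`[0, t]%classic `*` setT :
         set (measurableTypeR R * g_sigma_algebraType (F t)))
      (fun z => X z.1 z.2).

Definition stopping_time (Omega : Type) (R : realType)
    (F : R -> set (set Omega)) (tau : Omega -> \bar R) : Prop :=
  (forall w, (0 <= tau w)%E) /\
  (forall t : R, 0 <= t -> F t [set w | (tau w <= t%:E)%E]).

(* The sigma-algebra F_tau. *)
Definition stopped (d : measure_display) (Omega : measurableType d)
    (R : realType) (F : R -> set (set Omega)) (tau : Omega -> \bar R) :
    set (set Omega) :=
  [set G | measurable G /\
     forall t : R, 0 <= t -> F t (G `&` [set w | (tau w <= t%:E)%E])].

(* Time-homogeneous strong Markov process X with transition kernels P^t, under
   the laws (P_x)_{x in E}. The last field is the strong Markov property
     P_x(X_{tau+s} \in A | F_tau) = P^s(X_tau, A)   P_x-a.s. on {tau < oo},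
   with the conditional expectation unfolded; the F_tau-measurability of the
   right-hand side is automatic from progressive measurability. *)
Record strong_markov_process (d d' : measure_display)
    (Omega : measurableType d) (E : measurableType d') (R : realType)
    (F : R -> set (set Omega)) (P_ : E -> probability Omega R)
    (X : R -> Omega -> E) (Pt : R -> R.-pker E ~> E) : Prop := {
  smp_filtration : filtration F ;
  smp_progressive : progressively_measurable F X ;
  smp_start : forall x, P_ x [set w | X 0 w = x] = 1%E ;
  smp_law : forall (t : R) x (A : set E), 0 <= t -> measurable A ->
    Pt t x A = P_ x (X t @^-1` A) ;
  smp_strong_markov : forall (tau : Omega -> \bar R), stopping_time F tau ->
    forall x (s : R) (A : set E) (G : set Omega),
      0 <= s -> measurable A -> stopped F tau G ->
      P_ x (G `&` [set w | (tau w < +oo)%E /\ A (X (fine (tau w) + s) w)]) =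
      (\int[P_ x]_(w in G `&` [set w | (tau w < +oo)%E])
         Pt s (X (fine (tau w)) w) A)%E }.

(* The measure P^t mu, as a set function. *)
Definition kernel_act (d : measure_display) (E : measurableType d)
    (R : realType) (k : R.-pker E ~> E) (mu : probability E R) (A : set E) :
    \bar R :=
  (\int[mu]_u k u A)%E.

(* Measures are compared on measurable sets only, since a library measure is a
   function on all sets. *)
Definition stationary (d : measure_display) (E : measurableType d)
    (R : realType) (Pt : R -> R.-pker E ~> E) (mu : probability E R) : Prop :=
  forall t : R, 0 <= t -> forall A, measurable A -> kernel_act (Pt t) mu A = mu A.

Definition couplings (d : measure_display) (E : measurableType d)
    (R : realType) (mu nu : {measure set E -> \bar R}) :
    set (probability (E * E)%type R) :=
  [set lambda | forall A : set E, measurable A ->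
     lambda (A `*` setT) = mu A /\ lambda (setT `*` A) = nu A].

Definition wasserstein (d : measure_display) (R : realType)
    (E : measurableCompleteMetricType d R) (mu nu : {measure set E -> \bar R}) :
    \bar R :=
  ereal_inf [set (\int[lambda]_z (mdist z.1 z.2)%:E)%E
            | lambda in couplings mu nu].

(* phi : R_+ -> R_+ is concave, differentiable, increasing to infinity, and
   phi(0) = 0. Values of phi on the negative half-line are irrelevant. The
   derivative is required on ]0, +oo[, with right-continuity at 0, so that
   powers x^a with 0 < a < 1 are included. *)
Record rate_function (R : realType) (phi : R -> R) : Prop := {
  rate_ge0 : forall x, 0 <= x -> 0 <= phi x ;
  rate_concave :
    convex_function (`[0, +oo[%classic : set R^o) (fun x => - phi x) ;
  rate_derivable : derivable_oy_Rcontinuous phi 0 ;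
  rate_increasing : {in `[0, +oo[ &, {homo phi : x y / x <= y}} ;
  rate_cvgy : phi x @[x --> +oo] --> +oo ;
  rate0 : phi 0 = 0 }.

Definition Hphi (R : realType) (phi : R -> R) (x : R) : R :=
  \int[@lebesgue_measure R]_(u in `[1, x]) (phi u)^-1.

(* The inverse of H_phi : [1, +oo[ -> [0, +oo[. *)
Definition Hphi_inv (R : realType) (phi : R -> R) : R -> R :=
  'pinv_(fun=> 1) `[1, +oo[%classic (Hphi phi).

(* Main.v *)
Require Import Defs.
From HB Require Import structures.
From mathcomp Require Import all_boot all_order all_algebra.
From mathcomp Require Import all_classical all_reals all_analysis.
From mathcomp Require Import measurable_realfun giry lra ring.

Set Implicit Arguments.
Unset Strict Implicit.
Unset Printing Implicit Defensive.

Import Order.TTheory GRing.Theory Num.Theory.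
Import numFieldNormedType.Exports.

Local Open Scope classical_set_scope.
Local Open Scope ring_scope.

(** As d <= 1, the Wasserstein distance can be handled through the 1-Lipschitz
functions f : E -> [0, 1]. By Kantorovich duality ([wasserstein_le_dual]) a bound
on the difference of the integrals of all such f is a bound on the distance;
these functions separate laws ([lip01_separate]); and a sequence of laws whose
integrals are Cauchy, uniformly in f and at a geometric rate, has a limit
([laws_complete]). It remains to study how the dual semigroup acts on them.

Take a period h > t0 and let P be the transition over h. Integrating the
Lyapunov condition in time ([lyapunov_drift]) shows that W = V + h phi(V) has a
drift P W <= W - a phi(W) + K' ([skeleton_drift]). Where W(x) + W(y) is small,
the local contraction shortens the distance; where it is large, the drift is negative.
Both effects are seen by one weighted distance, a geometric mean
  d(x,y)^al * G(A + W(x) + W(y))^(1-al),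
in which G is an iterate T^k of the Euler step T s = s + c phi(s) divided by a
constant. If f has increments bounded by this expression with T^(k+1), then P f
has increments bounded by it with T^k ([mixing_step]): at high levels the drift
exceeds one Euler step, and at low levels the contraction of d pays for the
additive constants. The iterates T^k are concave, which makes the weight
compatible with expectations ([coupling_cost_le]). After N periods
  P^N f(x) - P^N f(y) <= ((A + W(x) + W(y)) / T^N(A))^(1-al)
([mixing]). The iterates T^N(A) overtake the flow of s' = c' phi(s), that is
H_phi^-1(c' N) ([Hphi_iter_euler]), and concavity replaces the quotient of the
arguments by the quotient of their images under phi ([rate_mixing]). The latter
step leaves phi(V) instead of V in the numerator, and phi(V) can be integrated
against an invariant law: its integral is at most K ([invariant_moment]), which is
obtained from the drift by truncating V.

Uniqueness and the rate follow by integrating the mixing bound. For existence,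
averages of the laws of the process started from one point, over the times
N h, ..., 2 N h, have bounded phi(V)-moments and are Cauchy by mixing
([invariant_exists]). *)

(** * Duality for finite transport problems *)

Section finite_transport.
Context (R : realType) (I J : finType).
Variables (p : I -> R) (q : J -> R) (c : I -> J -> R).
Hypotheses (p_ge0 : forall i, 0 <= p i) (p_sum : \sum_i p i = 1).
Hypotheses (q_ge0 : forall j, 0 <= q j) (q_sum : \sum_j q j = 1).
Hypotheses (c_ge0 : forall i j, 0 <= c i j) (c_le1 : forall i j, c i j <= 1).

(** The first marginal is prescribed exactly and the second one only
  penalized, so that every row of a plan can be moved independently of the
  others. *)
Definition row_plan (g : I -> J -> R) : Prop :=
  (forall i j, 0 <= g i j) /\ (forall i, \sum_j g i j = p i).

Definition excess (g : I -> J -> R) (j : J) : R := \sum_i g i j - q j.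

Definition cost (g : I -> J -> R) : R := \sum_i \sum_j g i j * c i j.

Definition penalized (k : R) (g : I -> J -> R) : R :=
  cost g + k / 2 * \sum_j excess g j ^+ 2.

Lemma row_plan_prod : row_plan (fun i j => p i * q j).
Proof.
split=> [i j|i]; first exact: mulr_ge0.
by rewrite -mulr_sumr q_sum mulr1.
Qed.

Lemma penalized_ge0 k g : 0 <= k -> row_plan g -> 0 <= penalized k g.
Proof.
move=> k0 [g0 _]; apply: addr_ge0.
  by apply: sumr_ge0 => i _; apply: sumr_ge0 => j _; exact: mulr_ge0.
by apply: mulr_ge0; [lra|apply: sumr_ge0 => j _; exact: sqr_ge0].
Qed.

Lemma penalized_near_min k eta : 0 <= k -> 0 < eta ->
  exists2 g, row_plan g & forall g', row_plan g' ->
    penalized k g <= penalized k g' + eta.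
Proof.
move=> k0 eta0.
set A := [set penalized k g | g in row_plan].
have hA : has_inf A.
  split; first by exists (penalized k (fun i j => p i * q j)), (fun i j => p i * q j) => //; exact: row_plan_prod.
  by exists 0 => _ [g /penalized_ge0 + <-]; exact.
have [_ [g rg <-] gA] := inf_adherent eta0 hA.
exists g => // g' rg'; rewrite (le_trans (ltW gA))// lerD2r.
by apply: ge_inf; [exact: hA.2|exists g'].
Qed.

Definition move_mass (s : R) (t : I -> J) (g : I -> J -> R) i j : R :=
  (1 - s) * g i j + s * (p i * (j == t i)%:R).

Lemma sum_pt i (t : I -> J) (F : J -> R) :
  \sum_j (p i * (j == t i)%:R) * F j = p i * F (t i).
Proof.
rewrite (bigD1 (t i))//= eqxx mulr1 big1 ?addr0// => j /negbTE ->.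
by rewrite mulr0 mul0r.
Qed.

Lemma row_plan_move s t g : 0 <= s <= 1 -> row_plan g ->
  row_plan (move_mass s t g).
Proof.
move=> /andP[s0 s1] [g0 gp]; split=> [i j|i].
  apply: addr_ge0; first by rewrite mulr_ge0// subr_ge0.
  by rewrite !mulr_ge0.
rewrite big_split/= -!mulr_sumr gp.
have := sum_pt i t (fun=> 1); under eq_bigr do rewrite mulr1.
by rewrite -mulr_sumr mulr1 => ->; ring.
Qed.

Lemma excess_le1 g j : row_plan g -> `|\sum_i g i j| <= 1.
Proof.
move=> [g0 gp]; rewrite ger0_norm ?sumr_ge0// -p_sum.
apply: ler_sum => i _; rewrite -gp (bigD1 j)//= lerDl.
exact: sumr_ge0.
Qed.

(** First-order expansion of the penalized cost when a fraction s of each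
  row i is moved to the column t i. The linear coefficient only sees the
  corrected cost c i j + k * excess g j. *)
Lemma penalized_move k s t g : row_plan g -> 0 <= k ->
  penalized k (move_mass s t g) <= penalized k g
    + s * (\sum_i p i * (c i (t i) + k * excess g (t i))
           - \sum_i \sum_j g i j * (c i j + k * excess g j))
    + s ^+ 2 * (k / 2 * (4 * #|J|%:R)).
Proof.
move=> rg k0.
pose b i j : R := p i * (j == t i)%:R.
pose dl j := \sum_i b i j - \sum_i g i j.
have exE j : excess (move_mass s t g) j = excess g j + s * dl j.
  rewrite /excess /move_mass big_split/= -!mulr_sumr /dl.
  by rewrite -/(b _ _); ring.
have costE : cost (move_mass s t g) = cost g + s * (\sum_i p i * c i (t i) - cost g).
  have -> : \sum_i p i * c i (t i) = \sum_i \sum_j b i j * c i j.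
    by apply: eq_bigr => i _; rewrite -(sum_pt i t (c i)).
  rewrite /cost -sumrB mulr_sumr -big_split/=; apply: eq_bigr => i _.
  rewrite -sumrB mulr_sumr -big_split/=; apply: eq_bigr => j _.
  by rewrite /move_mass -/(b i j); ring.
have dl4 j : dl j ^+ 2 <= 4.
  have rb : row_plan b.
    have := @row_plan_move 1 t g _ rg; rewrite lexx ler01 => /(_ isT).
    congr row_plan; apply/funext => i; apply/funext => j'.
    by rewrite /move_mass subrr mul0r add0r mul1r.
  have : `|dl j| <= 2.
    rewrite (le_trans (ler_normB _ _))//.
    by have := excess_le1 j rb; have := excess_le1 j rg; lra.
  by rewrite -real_normK ?num_real//; move: (`|dl j|) (normr_ge0 (dl j)) => x; nra.
have sumE : \sum_j dl j * (k * excess g j) =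
    \sum_i p i * (k * excess g (t i)) - \sum_i \sum_j g i j * (k * excess g j).
  have -> : \sum_i p i * (k * excess g (t i)) = \sum_i \sum_j b i j * (k * excess g j).
    by apply: eq_bigr => i _; rewrite -(sum_pt i t (fun j => k * excess g j)).
  rewrite exchange_big [in X in _ - X]exchange_big/= -sumrB.
  by apply: eq_bigr => j _; rewrite /dl mulrBl !mulr_suml.
have -> : penalized k (move_mass s t g) =
    penalized k g + s * (\sum_i p i * (c i (t i) + k * excess g (t i))
           - \sum_i \sum_j g i j * (c i j + k * excess g j))
    + s ^+ 2 * (k / 2 * \sum_j dl j ^+ 2).
  rewrite /penalized costE.
  have -> : \sum_i p i * (c i (t i) + k * excess g (t i)) =
      \sum_i p i * c i (t i) + \sum_i p i * (k * excess g (t i)).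
    by rewrite -big_split; apply: eq_bigr => i _; rewrite mulrDr.
  have -> : \sum_i \sum_j g i j * (c i j + k * excess g j) =
      cost g + \sum_i \sum_j g i j * (k * excess g j).
    rewrite -big_split; apply: eq_bigr => i _; rewrite -big_split.
    by apply: eq_bigr => j _; rewrite mulrDr.
  have -> : \sum_j excess (move_mass s t g) j ^+ 2 =
    \sum_j excess g j ^+ 2 + 2 * s * (\sum_j dl j * excess g j)
    + s ^+ 2 * \sum_j dl j ^+ 2.
    rewrite !mulr_sumr -!big_split; apply: eq_bigr => j _.
    by rewrite exE/=; ring.
  have -> : \sum_i p i * (k * excess g (t i)) =
     k * (\sum_j dl j * excess g j) + \sum_i \sum_j g i j * (k * excess g j).
    apply/eqP; rewrite -subr_eq -sumE mulr_sumr; apply/eqP.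
    by apply: eq_bigr => j _; ring.
  by field.
rewrite lerD2l ler_wpM2l ?sqr_ge0// ler_wpM2l//; first lra.
rewrite (le_trans (ler_sum _ (fun j _ => dl4 j)))//.
by rewrite sumr_const mulr_natr.
Qed.

Lemma exists_argmin (F : J -> R) : exists j0, forall j, F j0 <= F j.
Proof.
have [j1 _|J0] := pickP (@predT J); last first.
  exfalso; move: q_sum; rewrite (eq_bigl xpred0)// big_pred0_eq => /eqP.
  by rewrite eq_sym oner_eq0.
have [j _ H] := @arg_minP _ R J j1 predT F isT.
by exists j => k; exact: H.
Qed.

Variable D : R.
Hypothesis dualD : forall (u : I -> R) (v : J -> R),
  (forall i j, u i + v j <= c i j) ->
  \sum_i p i * u i + \sum_j q j * v j <= D.

(** At a near-minimizer of the penalized cost, moving every row to the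
  column of least corrected cost c i j + k * excess g j gains almost nothing.
  The least corrected costs of the rows and the numbers - k * excess g j are
  admissible potentials, and so the dual bound passes to the primal cost. *)
Lemma approx_plan k e : 0 <= k -> 0 < e ->
  exists2 g, row_plan g & cost g + k * \sum_j excess g j ^+ 2 <= D + e.
Proof.
move=> k0 e0.
set C : R := k / 2 * (4 * #|J|%:R).
have C0 : 0 <= C by rewrite /C !mulr_ge0 ?invr_ge0.
(* The expansion has the error s ^ 2 * C and near-minimality the tolerance
   s ^ 2; divided by s they sum up to less than e. *)
pose s := Num.min 1 (e / (1 + C)).
have s0 : 0 < s by rewrite lt_min ltr01/= divr_gt0//; lra.
have s1 : s <= 1 by rewrite ge_min lexx.
have sC : s * (1 + C) <= e.
  by rewrite -ler_pdivlMr; [rewrite ge_min lexx orbT|lra].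
have [g rg gmin] := @penalized_near_min k (s ^+ 2) k0 (exprn_gt0 2 s0).
exists g => //.
have /choice[t tP] : forall i, exists j0, forall j,
    c i j0 + k * excess g j0 <= c i j + k * excess g j.
  by move=> i; exact: (exists_argmin (fun j => c i j + k * excess g j)).
have := gmin _ (@row_plan_move s t g _ rg); rewrite ltW//= s1 => /(_ isT) gm.
have := penalized_move s t rg k0; rewrite -/C => mv.
have dl := dualD (u := fun i => c i (t i) + k * excess g (t i))
  (v := fun j => - (k * excess g j)).
have {dl}/dl dl : forall i j, c i (t i) + k * excess g (t i) + - (k * excess g j) <= c i j.
  by move=> i j; rewrite lerBlDr.
set A := \sum_i p i * _ in mv dl.
set B := \sum_i \sum_j _ in mv.
have BE : B + \sum_j q j * - (k * excess g j) = cost g + k * \sum_j excess g j ^+ 2.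
  rewrite /B; have -> : \sum_i \sum_j g i j * (c i j + k * excess g j) =
      cost g + \sum_i \sum_j g i j * (k * excess g j).
    rewrite -big_split; apply: eq_bigr => i _; rewrite -big_split.
    by apply: eq_bigr => j _; rewrite mulrDr.
  rewrite -addrA; congr (_ + _); rewrite exchange_big/= -big_split mulr_sumr/=.
  by apply: eq_bigr => j _; rewrite -mulr_suml /excess; ring.
have : 0 <= s * (A - B) + s ^+ 2 * C + s ^+ 2 by lra.
rewrite (_ : _ + _ = s * (A - B + s * (1 + C))); last by ring.
by rewrite pmulr_rge0// -BE; lra.
Qed.

(** Rounding: columns that carry too much mass are scaled down, and the mass
    thus freed is redistributed as a product, at cost at most its amount. *)
Lemma round_plan g : row_plan g ->
  exists g', [/\ row_plan g', forall j, \sum_i g' i j = q j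
    & cost g' <= cost g + \sum_j `|excess g j|].
Proof.
move=> [g0 gp].
pose w j := Num.min 1 (q j / \sum_i g i j).
have G0 j : 0 <= \sum_i g i j by exact: sumr_ge0.
have w0 j : 0 <= w j by rewrite le_min ler01/= divr_ge0.
have w1 j : w j <= 1 by rewrite ge_min lexx.
pose h i j := g i j * w j.
have h0 i j : 0 <= h i j by exact: mulr_ge0.
have hg i j : h i j <= g i j by rewrite ler_piMr.
have hq j : \sum_i h i j <= q j.
  rewrite -mulr_suml; have [->|n0] := eqVneq (\sum_i g i j) 0; first by rewrite mul0r.
  rewrite mulrC -ler_pdivlMr; last by rewrite lt_neqAle eq_sym n0 G0.
  by rewrite ge_min lexx orbT.
have hex j : q j - \sum_i h i j <= `|excess g j|.
  rewrite -mulr_suml /w; have [w1'|w1'] := leP 1 (q j / \sum_i g i j).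
    by rewrite mulr1 /excess distrC ler_norm.
  have [z|n0] := eqVneq (\sum_i g i j) 0; last by rewrite mulrC divfK// subrr.
  by rewrite /excess z mul0r subr0 sub0r normrN ger0_norm.
pose a i := p i - \sum_j h i j.
pose b j := q j - \sum_i h i j.
have a0 i : 0 <= a i by rewrite subr_ge0 -gp; apply: ler_sum => j _; exact: hg.
have b0 j : 0 <= b j by rewrite subr_ge0.
have ab : \sum_i a i = \sum_j b j by rewrite !sumrB p_sum q_sum exchange_big.
set m := \sum_j b j in ab.
have m0 : 0 <= m by exact: sumr_ge0.
have b_le i : b i <= m by rewrite /m (bigD1 i)//= lerDl sumr_ge0.
have a_le i : a i <= m by rewrite -ab (bigD1 i)//= lerDl sumr_ge0.
have mK x : 0 <= x -> x <= m -> x * (m / m) = x.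
  move=> x0 xm; have [mz|mn] := eqVneq m 0; last by rewrite divff// mulr1.
  by have -> : x = 0 by [lra]; rewrite mul0r.
pose g' i j := h i j + a i * b j / m.
exists g'; split=> [|j|].
- split=> [i j|i]; first by rewrite addr_ge0// !mulr_ge0// invr_ge0.
  rewrite big_split/= -mulr_suml -mulr_sumr -mulrA mK//.
  by rewrite /a addrCA subrr addr0.
- have -> : \sum_i g' i j = \sum_i h i j + b j * (m / m).
    rewrite big_split/=; congr (_ + _).
    by rewrite -!mulr_suml ab; ring.
  by rewrite mK// /b addrCA subrr addr0.
- rewrite (le_trans (_ : _ <= cost g + m))//; last first.
    by rewrite lerD2l; apply: ler_sum => j _; exact: hex.
  have <- : \sum_i \sum_j a i * b j / m = m.
    under eq_bigr do rewrite -mulr_suml -mulr_sumr -mulrA -/m mK//.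
    exact: ab.
  rewrite /cost -big_split; apply: ler_sum => i _ /=.
  rewrite -big_split; apply: ler_sum => j _ /=.
  rewrite mulrDl lerD//; first by rewrite ler_wpM2r.
  by rewrite ler_piMr// !mulr_ge0// invr_ge0.
Qed.

(** The penalty k is so large that the defect of the second marginal, hence
  the cost of repairing it, is at most e / 2. *)
Theorem finite_transport_duality e : 0 < e ->
  exists g, [/\ row_plan g, forall j, \sum_i g i j = q j & cost g <= D + e].
Proof.
move=> e0.
have cost0 g : row_plan g -> 0 <= cost g.
  by move=> [g0 _]; apply: sumr_ge0 => i _; apply: sumr_ge0 => j _; exact: mulr_ge0.
pose N : R := #|J|%:R + 1.
have N0 : 0 < N by rewrite ltr_wpDl.
pose tau := e / (4 * N).
have tau0 : 0 < tau by rewrite divr_gt0// mulr_gt0.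
have D0 : 0 <= D.
  have h (i : I) (j : J) : 0 + 0 <= c i j by rewrite addr0.
  have := dualD (u := fun=> 0) (v := fun=> 0) h.
  by under eq_bigr do rewrite mulr0; rewrite -mulr_suml mulr0 big1_eq addr0.
have eD : 0 < D + e by lra.
have et : 0 < e * tau by exact: mulr_gt0.
pose k := 4 * (D + e) / (e * tau).
have k0 : 0 < k by rewrite /k divr_gt0// mulr_gt0.
have e2 : 0 < e / 2 by lra.
have [g rg gD] := approx_plan (ltW k0) e2.
have [g' [rg' g'q g'c]] := round_plan rg.
exists g'; split=> //; rewrite (le_trans g'c)//.
set S := \sum_j excess g j ^+ 2 in gD.
have S0 : 0 <= S by apply: sumr_ge0 => j _; exact: sqr_ge0.
(* |x| <= tau + x ^ 2 / tau, where tau makes the first terms sum up to e / 4. *)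
have : \sum_j `|excess g j| <= N * tau + S / tau.
  rewrite (le_trans (_ : _ <= \sum_(j : J) (tau + excess g j ^+ 2 / tau)))//.
    apply: ler_sum => j _; rewrite -real_normK ?num_real//.
    move: (`|excess g j|) (normr_ge0 (excess g j)) => x x0.
    have [xt|xt] := leP x tau; first by rewrite ler_wpDr// divr_ge0 ?sqr_ge0// ltW.
    by rewrite ler_wpDl ?ltW// ltr_pdivlMr// expr2 ltr_pM2l//; lra.
  rewrite big_split/=; apply: lerD; last by rewrite -mulr_suml.
  by rewrite sumr_const -mulr_natl ler_wpM2r ?ltW// ltrDl.
have -> : N * tau = e / 4 by rewrite /tau; field; lra.
have St : S / tau <= e / 4.
  rewrite ler_pdivrMr//.
  have : k * S <= D + e / 2 by have := cost0 _ rg; lra.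
  move=> h1; have : k * S <= D + e by lra.
  rewrite -ler_pdivlMl//; congr (_ <= _).
  by rewrite /k; field; rewrite !gt_eqF.
have : 0 <= k * S by rewrite mulr_ge0// ltW.
lra.
Qed.

End finite_transport.

(** * Integration against probabilities and couplings *)

Section integration.
Context d (T : measurableType d) (R : realType).
Implicit Types (P : probability T R) (f g : T -> R).

(** The mass of a probability, in the form in which integrals against the
  underlying measure produce it. *)
Lemma measure_prob_setT P : (P : {measure set T -> \bar R}) setT = 1%E.
Proof. exact: probability_setT. Qed.

Lemma measurable_fun_gt f :
  (forall r, measurable [set x | r < f x]) -> measurable_fun setT f.
Proof.
move=> H; have := @measurability _ _ _ _ setT f _ (RGenOInfty.measurableE R).
apply => _ [_ [a ->] <-]; rewrite setTI (_ : _ @^-1` _ = [set x | a < f x])//.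
by apply/seteqP; split=> x/=; rewrite in_itv/= andbT.
Qed.

Lemma integrable_bounded P f M : measurable_fun setT f ->
  (forall x, `|f x| <= M) -> P.-integrable setT (EFin \o f).
Proof.
move=> mf fM; apply: measurable_bounded_integrable => //.
  by rewrite (le_lt_trans (probability_le1 _ _))// ltry.
exists M; split; first exact: num_real.
by move=> x Mx y _; rewrite /= (le_trans (fM y))// ltW.
Qed.

Lemma Rintegral_cst1 P r : \int[P]_x r = r.
Proof.
by rewrite Rintegral_cst// measure_prob_setT mulr1.
Qed.

Lemma Rintegral_bounded P f a b : measurable_fun setT f ->
  (forall x, a <= f x <= b) -> a <= \int[P]_x f x <= b.
Proof.
move=> mf fab.
have fi : P.-integrable setT (EFin \o f).
  apply: (@integrable_bounded P f (`|a| + `|b|)) => // x.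
  have /andP[fa fb] := fab x; rewrite ler_norml; apply/andP; split.
    have := ler_norm (- a); rewrite normrN; have := normr_ge0 b; lra.
  by have := ler_norm b; have := normr_ge0 a; lra.
have ci r : P.-integrable setT (EFin \o cst r).
  exact: (@integrable_bounded P (cst r) `|r|).
rewrite -{1}(Rintegral_cst1 P a) -[X in _ && (_ <= X)](Rintegral_cst1 P b); apply/andP.
by split; [apply: (le_Rintegral _ (ci a) fi)|apply: (le_Rintegral _ fi (ci b))] => // x _;
  have /andP[] := fab x.
Qed.

Lemma EFin_Rintegral P f : P.-integrable setT (EFin \o f) ->
  (\int[P]_x f x)%:E = (\int[P]_x (f x)%:E)%E.
Proof. by move=> fi; rewrite /Rintegral fineK//; exact: integrable_fin_num. Qed.

Lemma sum_measure (I : Type) (r : seq I) (w : I -> R)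
    (P : I -> {measure set T -> \bar R}) : (forall i, 0 <= w i) ->
  exists m : {measure set T -> \bar R},
    (forall A, m A = \sum_(i <- r) (w i)%:E * P i A)%E /\
    (forall f : T -> \bar R, measurable_fun setT f -> (forall x, 0 <= f x)%E ->
       \int[m]_x f x = \sum_(i <- r) (w i)%:E * \int[P i]_x f x)%E.
Proof.
move=> w0; elim: r => [|i r [m [mA mf]]].
  exists mzero; split=> [A|f mf f0]; first by rewrite big_nil.
  by rewrite big_nil integral_measure_zero.
exists (measure_add (mscale (NngNum (w0 i)) (P i)) m); split=> [A|f f_m f0].
  by rewrite big_cons [LHS]measure_addE mA.
by rewrite big_cons ge0_integral_measure_add// ge0_integral_mscale// mf.
Qed.

Lemma measure1_probability (m : {measure set T -> \bar R}) : m setT = 1%E ->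
  exists Q : probability T R, forall A, Q A = m A.
Proof.
move=> mT; pose D : probability T R := dirac point.
exists (mnormalize m D) => A.
transitivity (m A * (fine (m setT))^-1%:E)%E.
  by change (mnormalize m D A = m A * (fine (m setT))^-1%:E)%E; rewrite /mnormalize mT onee_eq0.
by rewrite mT invr1 mule1.
Qed.

Lemma finite_mixture (I : finType) (w : I -> R) (P : I -> probability T R) :
  (forall i, 0 <= w i) -> \sum_i w i = 1 ->
  exists Q : probability T R,
    (forall A, Q A = \sum_i (w i)%:E * P i A)%E /\
    (forall f : T -> \bar R, measurable_fun setT f -> (forall x, 0 <= f x)%E ->
       \int[Q]_x f x = \sum_i (w i)%:E * \int[P i]_x f x)%E.
Proof.
move=> w0 w1; have [m [mA mf]] := sum_measure (index_enum I) P w0.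
have mT : m setT = 1%E.
  rewrite mA; under eq_bigr do rewrite measure_prob_setT mule1.
  by rewrite sumEFin w1.
have [Q QE] := measure1_probability mT.
exists Q; split => [A|f f_m f0]; first by rewrite QE mA.
by rewrite -mf//; apply: eq_measure_integral => A _ _; exact: QE.
Qed.

(** If P A = 0 then both sides vanish whatever Q is. *)
Lemma conditional_probability P (A : set T) : measurable A ->
  exists Q : probability T R, forall B, measurable B ->
    (P A * Q B = P (A `&` B))%E.
Proof.
move=> mA; have PA : P A \is a fin_num by exact: fin_num_measure.
have [A0|A0] := eqVneq (P A) 0%E.
  exists P => B mB; rewrite A0 mul0e; apply/esym/(subset_measure0 _ _ _ A0) => //.
  exact: measurableI.
exists (mnormalize (mrestr P mA) P) => B mB.
change (P A * mnormalize (mrestr P mA) P B = P (A `&` B))%E.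
rewrite /mnormalize/= /mrestr setTI (negbTE A0)/= ifF; last first.
  by apply/negbTE; move: PA; rewrite fin_numE => /andP[].
rewrite muleCA -[X in (_ * (X * _))%E](fineK PA) -EFinM divff ?mule1 1?setIC//.
by rewrite fine_eq0.
Qed.

End integration.

Section couplings.
Context d (E : measurableType d) (R : realType).
Implicit Types (mu nu : probability E R).

Lemma coupling_fst mu nu la (f : E -> \bar R) : couplings mu nu la ->
  measurable_fun setT f -> (forall x, 0 <= f x)%E ->
  (\int[la]_z f z.1 = \int[mu]_x f x)%E.
Proof.
move=> cl mf f0.
have := @ge0_integral_pushforward _ _ _ _ R fst measurable_fst la setT f measurableT mf.
rewrite preimage_setT => <-; last by move=> *; exact: f0.
apply: eq_measure_integral => A mA _; rewrite /pushforward.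
by rewrite -(cl A mA).1; congr (la _); apply/seteqP; split=> -[x y]//= [].
Qed.

Lemma coupling_snd mu nu la (f : E -> \bar R) : couplings mu nu la ->
  measurable_fun setT f -> (forall x, 0 <= f x)%E ->
  (\int[la]_z f z.2 = \int[nu]_x f x)%E.
Proof.
move=> cl mf f0.
have := @ge0_integral_pushforward _ _ _ _ R snd measurable_snd la setT f measurableT mf.
rewrite preimage_setT => <-; last by move=> *; exact: f0.
apply: eq_measure_integral => A mA _; rewrite /pushforward.
by rewrite -(cl A mA).2; congr (la _); apply/seteqP; split=> -[x y]//= [].
Qed.

Lemma Rcoupling_fst mu nu la (f : E -> R) : couplings mu nu la ->
  measurable_fun setT f -> (forall x, 0 <= f x) ->
  \int[la]_z f z.1 = \int[mu]_x f x.
Proof.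
move=> cl mf f0; congr fine.
by apply: (@coupling_fst _ _ _ (EFin \o f) cl) => //; exact/measurable_EFinP.
Qed.

Lemma Rcoupling_snd mu nu la (f : E -> R) : couplings mu nu la ->
  measurable_fun setT f -> (forall x, 0 <= f x) ->
  \int[la]_z f z.2 = \int[nu]_x f x.
Proof.
move=> cl mf f0; congr fine.
by apply: (@coupling_snd _ _ _ (EFin \o f) cl) => //; exact/measurable_EFinP.
Qed.

End couplings.

(** * Lipschitz test functions on a separable metric space *)

Section integral_sequences.
Context d (T : measurableType d) (R : realType) (P : probability T R).

Lemma Rintegral_cvg_bounded (f_ : nat -> T -> R) (f : T -> R) (M : R) :
  (forall n, measurable_fun setT (f_ n)) ->
  (forall x, f_ ^~ x @ \oo --> f x) ->
  (forall n x, `|f_ n x| <= M) ->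
  (fun n => \int[P]_x f_ n x) @ \oo --> \int[P]_x f x.
Proof.
move=> mf_ f_f f_M.
have mf : measurable_fun setT f by apply: (measurable_fun_cvg (h := f_)).
have fM x : `|f x| <= M.
  have h : `|f_ n x| @[n --> \oo] --> `|f x| by apply: cvg_norm; exact: f_f.
  rewrite -(cvg_lim _ h)//; apply: limr_le; first by apply/cvg_ex; exists `|f x|.
  exact: nearW.
have ifM : P.-integrable setT (EFin \o f) by exact: (integrable_bounded _ mf fM).
have ci : P.-integrable setT (EFin \o cst M).
  by apply: (@integrable_bounded _ _ _ P _ `|M|) => // x.
apply: fine_cvg; rewrite fineK; last exact: integrable_fin_num.
apply: (@dominated_cvg _ _ _ P _ measurableT _ _ (EFin \o cst M)) => //.
- by move=> n; exact/measurable_EFinP.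
- by move=> x _; apply: cvg_EFin; [exact: nearW|exact: f_f].
- by move=> n x _; rewrite lee_fin; exact: f_M.
Qed.

Lemma Rintegral_sum (I : Type) (s : seq I) (f : I -> T -> R) :
  (forall i, P.-integrable setT (EFin \o f i)) ->
  \int[P]_x (\sum_(i <- s) f i x) = \sum_(i <- s) \int[P]_x f i x.
Proof.
move=> fi; apply: EFin_inj; rewrite EFin_Rintegral; last first.
  have -> : EFin \o (fun x => \sum_(i <- s) f i x) = (fun x => \sum_(i <- s) (f i x)%:E)%E.
    by apply/funext => x /=; rewrite sumEFin.
  by apply: integrable_sum => // i _; exact: fi.
under eq_integral do rewrite -sumEFin.
rewrite integral_sum//.
by rewrite -sumEFin; apply: eq_bigr => i _; rewrite EFin_Rintegral//; exact: fi.
Qed.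

Lemma Rintegral_finite_range (I : finType) (k : T -> I) (F : I -> R) :
  (forall i, measurable (k @^-1` [set i])) ->
  \int[P]_x F (k x) = \sum_i fine (P (k @^-1` [set i])) * F i.
Proof.
move=> mki.
have -> : (fun x => F (k x)) = (fun x => \sum_i F i * \1_(k @^-1` [set i]) x).
  apply/funext => x; rewrite (bigD1 (k x))//=.
  rewrite indicE mem_set// mulr1 big1 ?addr0// => i ik.
  by rewrite indicE memNset ?mulr0// => /= kxi; rewrite kxi eqxx in ik.
have ii i : P.-integrable setT (EFin \o \1_(k @^-1` [set i])).
  by apply: (@integrable_bounded _ _ _ P _ 1) => // x; rewrite indicE; case: (_ \in _); rewrite ?normr0 ?normr1.
rewrite Rintegral_sum => [|i]; last first.
  apply: (@integrable_bounded _ _ _ P _ `|F i|); first exact: measurable_funM.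
  by move=> x; rewrite indicE; case: (_ \in _); rewrite ?mulr0 ?normr0 ?mulr1.
apply: eq_bigr => i _; rewrite RintegralZl// mulrC; congr (_ * _).
by rewrite /Rintegral integral_indic// setIT.
Qed.

End integral_sequences.

Section borel_metric.
Context (R : realType) (dE : measure_display) (E : measurableCompleteMetricType dE R).
Hypotheses (hborel : is_borel E) (hsep : separable E).
Hypothesis mdist_le1 : forall x y : E, mdist x y <= 1.

(** One-sided, since x and y can be exchanged. *)
Definition lip1 (f : E -> R) := forall x y, f x - f y <= mdist x y.

(** On a space of diameter at most 1 these test functions determine the
  Wasserstein distance. *)
Definition lip01 (f : E -> R) := lip1 f /\ forall x, 0 <= f x <= 1.

Lemma open_dist (U : set E) :
  (forall x, U x -> exists2 r, 0 < r & forall y, mdist x y < r -> U y) -> open U.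
Proof.
move=> H; rewrite openE => x /H[r r0 rU]; apply/nbhs_ballP; exists r => //.
by move=> y; rewrite ballEmdist; exact: rU.
Qed.

Lemma measurable_open (U : set E) : open U -> measurable U.
Proof. by rewrite hborel => oU; exact: sub_sigma_algebra. Qed.

Lemma lip1_measurable f : lip1 f -> measurable_fun setT f.
Proof.
move=> fl; apply: measurable_fun_gt => r; apply: measurable_open.
apply: open_dist => x /= rx; exists (f x - r); first by rewrite subr_gt0.
by move=> y xy; have := fl x y; lra.
Qed.

Lemma lip1_norm f x y : lip1 f -> `|f x - f y| <= mdist x y.
Proof.
move=> fl; rewrite ler_norml fl andbT.
by have := fl y x; rewrite metric_sym; lra.
Qed.

Lemma lip1_dist (a : E) : lip1 (mdist a).
Proof. by move=> x y; have := metric_triangle a y x; rewrite (metric_sym y x); lra. Qed.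

Lemma lip01_measurable f : lip01 f -> measurable_fun setT f.
Proof. by move=> [fl _]; exact: lip1_measurable. Qed.

Lemma lip01_integrable (P : probability E R) f : lip01 f ->
  P.-integrable setT (EFin \o f).
Proof.
move=> [fl f01]; apply: (@integrable_bounded _ _ _ P f 1) => //; first exact: lip1_measurable.
by move=> x; have /andP[? ?] := f01 x; rewrite ger0_norm.
Qed.

Lemma dense_sequence : exists a : nat -> E,
  forall x r, 0 < r -> exists n, mdist (a n) x < r.
Proof.
have [S cS dS] := hsep.
have H x r : 0 < r -> exists2 y, S y & mdist y x < r.
  move=> r0; have [||y [/= yx Sy]] := dS [set y | mdist y x < r].
  - by exists x => /=; rewrite mdistxx.
  - apply: open_dist => y /= yx; exists (r - mdist y x); first by rewrite subr_gt0.
    by move=> z yz; have := metric_triangle z y x; rewrite (metric_sym z y); lra.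
  by exists y.
have [S0|[a]] := pfcard_geP cS.
  by have [y] := H point 1 ltr01; rewrite S0.
exists a => x r /(H x)[y Sy yx].
by have [n _ an] := surj (f := a) Sy; exists n; rewrite an.
Qed.

(** If d(x, y) > r, then a point a_n close to x and a rational q witness
  d(a_n, x) < q and d(a_n, y) > r + q. So {d > r} is a countable union of
  rectangles, which the product sigma-algebra contains although it is generated
  without reference to the product topology. *)
Lemma measurable_mdist : measurable_fun setT (fun z : E * E => mdist z.1 z.2).
Proof.
have [a ad] := dense_sequence.
have m1 n (c : R) : measurable [set x : E | mdist (a n) x < c].
  apply/measurable_open/open_dist => x /= xc; exists (c - mdist (a n) x).
    by rewrite subr_gt0.
  by move=> y xy; have := metric_triangle (a n) x y; lra.
have m2 n (c : R) : measurable [set x : E | c < mdist (a n) x].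
  apply/measurable_open/open_dist => x /= xc; exists (mdist (a n) x - c).
    by rewrite subr_gt0.
  move=> y xy; have := metric_triangle (a n) y x; rewrite (metric_sym y x); lra.
apply: measurable_fun_gt => r.
rewrite (_ : [set _ | _] = \bigcup_n \bigcup_(q : rat)
   ([set x | mdist (a n) x < ratr q] `*` [set x | r + ratr q < mdist (a n) x])).
  apply: bigcupT_measurable => n; apply: bigcupT_measurable_rat => q.
  by apply: measurableX; [exact: m1|exact: m2].
apply/seteqP; split=> [[x y]/= rxy|[x y] [n _ [q _]]]; last first.
  move=> [/= aq qa]; have := metric_triangle (a n) x y.
  by move: (ratr q : R) aq qa => s; lra.
have e0 : 0 < (mdist x y - r) / 2 by lra.
have [n an] := ad x _ e0.
have [q /andP[q1 q2]] := rat_in_itvoo an.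
have {}q1 : mdist (a n) x < ratr q := q1.
have {}q2 : ratr q < (mdist x y - r) / 2 := q2.
exists n => //; exists q => //; split => //=.
move: (ratr q : R) q1 q2 => s q1 q2.
by have := metric_triangle x (a n) y; rewrite (metric_sym x (a n)); lra.
Qed.

Section quantization.
Variable a : nat -> E.
Hypothesis a_dense : forall x r, 0 < r -> exists n, mdist (a n) x < r.

(** Ties are broken in favour of the earlier point, so that the fibres are the
  disjoint cells of a quantization. *)
Fixpoint nearest (n : nat) (x : E) : nat :=
  if n is m.+1 then
    if mdist (a m.+1) x < mdist (a (nearest m x)) x then m.+1 else nearest m x
  else 0%N.

Lemma nearest_le n x : (nearest n x <= n)%N.
Proof. by elim: n => //= n ih; case: ifP => // _; exact: leqW. Qed.

Definition nearest_ord n x : 'I_n.+1 :=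
  Ordinal (nearest_le n x : (nearest n x < n.+1)%N).

Lemma nearest_ord_fiber n (i : 'I_n.+1) :
  nearest_ord n @^-1` [set i] = nearest n @^-1` [set (i : nat)].
Proof. by apply/seteqP; split => x /= => [<-//|xi]; apply/val_inj. Qed.

Lemma nearest_min n m x : (m <= n)%N ->
  mdist (a (nearest n x)) x <= mdist (a m) x.
Proof.
elim: n => [|n ih]/=; first by rewrite leqn0 => /eqP ->.
rewrite leq_eqVlt => /predU1P[->|]; first by case: ltP.
by rewrite ltnS => /ih h; case: ltP => // h2; exact: le_trans (ltW h2) h.
Qed.

Lemma measurable_nearest n : measurable_fun setT (nearest n) /\
  measurable_fun setT (fun x => mdist (a (nearest n x)) x).
Proof.
have md m := lip1_measurable (lip1_dist (a m)).
elim: n => [|n [ih1 ih2]]/=; first by split; [exact: measurable_cst|exact: md].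
have mb : measurable_fun setT (fun x => mdist (a n.+1) x < mdist (a (nearest n x)) x).
  exact: measurable_fun_ltr.
split; first exact: measurable_fun_ifT.
rewrite (_ : (fun x => _) = (fun x => if mdist (a n.+1) x < mdist (a (nearest n x)) x
   then mdist (a n.+1) x else mdist (a (nearest n x)) x)).
  exact: measurable_fun_ifT.
by apply/funext => x; case: ifP.
Qed.

(** The distance to the nearest of a_0, ..., a_n is bounded and decreases to
  0 everywhere as n grows. *)
Lemma quantize (P : probability E R) (e : R) : 0 < e ->
  exists n, \int[P]_x mdist (a (nearest n x)) x <= e.
Proof.
move=> e0.
have h : \int[P]_x mdist (a (nearest n x)) x @[n --> \oo] --> \int[P]_x (cst 0 x).
  apply: (@Rintegral_cvg_bounded _ _ _ P _ _ 1).
  - by move=> n; have [] := measurable_nearest n.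
  - move=> x; apply/cvgrPdist_le => r r0.
    have [N aN] := a_dense x r0.
    near=> n; rewrite sub0r normrN ger0_norm ?mdist_ge0//.
    by rewrite (le_trans _ (ltW aN))// nearest_min//; near: n; exact: nbhs_infty_ge.
  - by move=> n x; rewrite ger0_norm ?mdist_ge0.
rewrite Rintegral_cst1 in h.
have /cvgrPdist_le/(_ _ e0)[N _ /(_ N (leqnn N))] := h.
by rewrite sub0r normrN => hN; exists N; exact: le_trans (ler_norm _) hN.
Unshelve. all: by end_near. Qed.

Lemma quantize_lip01 (P : probability E R) n f : lip01 f ->
  `|\int[P]_x f x - \int[P]_x f (a (nearest n x))| <=
    \int[P]_x mdist (a (nearest n x)) x.
Proof.
move=> fl; have [fl1 f01] := fl.
have [mn mdn] := measurable_nearest n.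
have mfa : measurable_fun setT (fun x => f (a (nearest n x))).
  exact: (measurableT_comp (f := fun i : nat => f (a i))).
have i1 : P.-integrable setT (EFin \o (fun x => f (a (nearest n x)))).
  apply: (@integrable_bounded _ _ _ P _ 1) => // x.
  by have /andP[? ?] := f01 (a (nearest n x)); rewrite ger0_norm.
have i2 := lip01_integrable P fl.
have i3 : P.-integrable setT (EFin \o (fun x => f x - f (a (nearest n x)))).
  by have := integrableB measurableT i2 i1.
rewrite -RintegralB// (le_trans (le_normr_Rintegral _ _))//.
apply: le_Rintegral => //.
- by have := integrable_abse i3.
- apply: (@integrable_bounded _ _ _ P _ 1) => // x.
  by rewrite ger0_norm ?mdist_ge0.
- by move=> x _; rewrite metric_sym; exact: lip1_norm.
Qed.

End quantization.

End borel_metric.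

(** The indicator of an open set U is the limit of the functions
  min(1, n d(x, E \ U)), which are multiples of test functions, and the open
  sets are a generating pi-system. *)
Section lip01_separate.
Context (R : realType) (dE : measure_display) (E : measurableCompleteMetricType dE R).
Hypothesis hborel : is_borel E.
Implicit Types (P Q : probability E R) (U : set E).

Definition dist_to (C : set E) (x : E) : R := inf [set (mdist x y : R) | y in C].

Lemma dist_to_le C x y : C y -> dist_to C x <= mdist x y.
Proof.
move=> Cy; apply: ge_inf; last by exists y.
by exists 0 => _ [z _ <-]; exact: mdist_ge0.
Qed.

Lemma le_dist_to C x (r : R) : C !=set0 -> (forall y, C y -> r <= mdist x y) ->
  r <= dist_to C x.
Proof.
move=> [c Cc] rC; apply: lb_le_inf; first by exists (mdist x c), c.
by move=> _ [z Cz <-]; exact: rC.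
Qed.

Lemma lip1_dist_to C : C !=set0 -> lip1 (dist_to C).
Proof.
move=> C0 x y; rewrite lerBlDr -lerBlDl; apply: le_dist_to => // z Cz.
rewrite lerBlDl (le_trans (dist_to_le x Cz))//.
exact: metric_triangle.
Qed.

Lemma lip01_separate P Q :
  (forall f : E -> R, lip01 f -> \int[P]_x f x = \int[Q]_x f x) ->
  forall A, measurable A -> P A = Q A.
Proof.
move=> PQ.
have PQo U : open U -> P U = Q U.
  (* The distance to the complement of U makes sense if U is not the space. *)
  move=> oU; have [UT|/eqP UT] := eqVneq U setT.
    by rewrite UT !measure_prob_setT.
  have C0 : (~` U) !=set0 by apply/set0P; apply/eqP => /(congr1 setC); rewrite setCK setC0.
  pose D := dist_to (~` U).
  have D0 x : 0 <= D x by apply: le_dist_to => // y _; exact: mdist_ge0.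
  have DU x : U x -> 0 < D x.
    move=> Ux; move: oU; rewrite openE => /(_ _ Ux)/nbhs_ballP[r /= r0 rU].
    apply: (lt_le_trans r0); apply: le_dist_to => // y; apply: contra_notT.
    rewrite -ltNge => xy; apply: rU; rewrite ballEmdist; exact: xy.
  have DnU x : ~ U x -> D x = 0.
    by move=> Ux; apply/eqP; rewrite eq_le D0 andbT -(mdistxx x) dist_to_le.
  pose h n x := Num.min (n.+1%:R^-1) (D x).
  have hl n : lip01 (h n).
    split=> [x y|x]; rewrite /h.
      have e1 : D x - D y <= mdist x y by exact: lip1_dist_to.
      have e2 : 0 <= mdist x y by exact: mdist_ge0.
      move: (mdist x y : R) (D x) (D y) (n.+1%:R^-1 : R) e1 e2 => m a b c e1 e2.
      by case: (leP c a); case: (leP c b); lra.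
    have : (n.+1%:R^-1 : R) <= 1 by rewrite invf_le1// ler1n.
    have : 0 <= (n.+1%:R^-1 : R) by [].
    move: (D x) (n.+1%:R^-1 : R) (D0 x) => a c a0 c0 c1.
    by apply/andP; case: (leP c a); lra.
  pose g n x := n.+1%:R * h n x.
  have gint n : \int[P]_x g n x = \int[Q]_x g n x.
    by rewrite !RintegralZl ?PQ//; exact: lip01_integrable.
  have g01 n x : 0 <= g n x <= 1.
    rewrite /g /h; have n0 : 0 < n.+1%:R :> R by [].
    have D0x := D0 x; case: (leP _ (D x)) => Dn.
      by rewrite mulfV ?gt_eqF// lexx ler01.
    by rewrite mulr_ge0//= -ler_pdivlMl// mulr1; exact: ltW.
  have gU x : g ^~ x @ \oo --> (\1_U x : R).
    have [Ux|Ux] := pselect (U x); last first.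
      rewrite indicE memNset// (_ : g ^~ x = cst 0); first exact: cvg_cst.
      by apply/funext => n; rewrite /g /h (DnU _ Ux) min_r ?mulr0.
    rewrite indicE mem_set//.
    apply: cvg_near_cst; have [N hN] : exists N : nat, (D x)^-1 < N%:R.
      by exists (Num.truncn (D x)^-1).+1; exact: truncnS_gt.
    exists N => // n /= Nn; rewrite /g /h min_l ?mulfV ?gt_eqF//.
    rewrite -[leRHS]invrK lef_pV2 ?posrE ?invr_gt0 ?DU//.
    by rewrite (le_trans (ltW hN))// ler_nat leqW.
  have gm n : measurable_fun setT (g n).
    by apply: measurable_funM => //; exact: lip01_measurable.
  have gn n x : `|g n x| <= 1 by have /andP[? ?] := g01 n x; rewrite ger0_norm.
  have cP := Rintegral_cvg_bounded (P := P) gm gU gn.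
  have cQ := Rintegral_cvg_bounded (P := Q) gm gU gn.
  have mU := measurable_open hborel oU.
  have IE (S : probability E R) : (\int[S]_x \1_U x)%:E = S U.
    rewrite /Rintegral integral_indic// setIT fineK//; exact: fin_num_measure.
  rewrite -!IE; congr EFin; apply: (cvg_unique _ cP) => //.
  rewrite (_ : (fun n => _) = (fun n => \int[Q]_x g n x))//.
  by apply/funext => n; exact: gint.
move=> A mA; apply: (measure_unique (@open E) (fun=> setT)) => //.
- by move=> B C; exact: openI.
- by move=> _; exact: openT.
- by apply/seteqP; split => // x _; exists 0%N.
- by move=> _; rewrite measure_prob_setT ltry.
Qed.

End lip01_separate.

(** * Kantorovich duality *)

Section discrete_transport.
Context (R : realType) (dE : measure_display) (E : measurableCompleteMetricType dE R).
Hypotheses (mdist_le1 : forall x y : E, mdist x y <= 1).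
Context (I J : finType) (x : I -> E) (y : J -> E) (p : I -> R) (q : J -> R).
Hypotheses (p_ge0 : forall i, 0 <= p i) (p_sum : \sum_i p i = 1).
Hypotheses (q_ge0 : forall j, 0 <= q j) (q_sum : \sum_j q j = 1).

(** Replacing v by its c-transform z |-> min_j (d(z, y_j) - v_j) turns a pair
  of admissible potentials into one Lipschitz function. As d <= 1, its
  oscillation is at most 1, and a shift by the least of the - v_j puts it into
  [0, 1]. *)
Lemma potentials_lip01 (u : I -> R) (v : J -> R) :
  (forall i j, u i + v j <= mdist (x i) (y j)) ->
  exists2 f : E -> R, lip01 f &
    \sum_i p i * u i + \sum_j q j * v j <=
    \sum_i p i * f (x i) - \sum_j q j * f (y j).
Proof.
move=> uv.
have /choice[t tP] : forall z : E, exists j0, forall j,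
    (mdist z (y j0) : R) - v j0 <= mdist z (y j) - v j.
  by move=> z; exact: (exists_argmin q_sum (fun j => (mdist z (y j) : R) - v j)).
have [j0 j0P] := exists_argmin q_sum (fun j => - v j).
pose F z : R := mdist z (y (t z)) - v (t z).
have FP z j : F z <= mdist z (y j) - v j by exact: tP.
exists (fun z => F z - (- v j0)).
  split=> [z w|z].
    have h1 := FP z (t w).
    have h2 : (mdist z (y (t w)) : R) <= mdist z w + mdist w (y (t w)).
      exact: metric_triangle.
    rewrite /F in h1 *; lra.
  have h1 := j0P (t z); have h2 := FP z j0.
  have h3 : (mdist z (y j0) : R) <= 1 by exact: mdist_le1.
  have h4 : 0 <= (mdist z (y (t z)) : R) by exact: mdist_ge0.
  by rewrite /F in h2 *; apply/andP; split; lra.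
rewrite -sumrN.
have -> : \sum_i p i * (F (x i) - - v j0) = \sum_i p i * F (x i) + v j0.
  under eq_bigr do rewrite opprK mulrDr.
  by rewrite big_split/= -mulr_suml p_sum mul1r.
have -> : \sum_j - (q j * (F (y j) - - v j0)) = \sum_j q j * - F (y j) - v j0.
  under eq_bigr do rewrite opprK -mulrN opprD mulrDr.
  by rewrite big_split/= -mulr_suml q_sum mul1r.
rewrite addrACA subrr addr0; apply: lerD; apply: ler_sum => i _.
  by apply: ler_wpM2l => //; have := uv i (t (x i)); rewrite /F; lra.
apply: ler_wpM2l => //; have := FP (y i) i.
have h : (mdist (y i) (y i) : R) = 0 by exact: mdistxx.
by rewrite h; lra.
Qed.

Lemma discrete_transport (D e : R) : 0 < e ->
  (forall f : E -> R, lip01 f ->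
     \sum_i p i * f (x i) - \sum_j q j * f (y j) <= D) ->
  exists g : I -> J -> R, [/\ forall i j, 0 <= g i j,
    forall i, \sum_j g i j = p i, forall j, \sum_i g i j = q j &
    \sum_i \sum_j g i j * mdist (x i) (y j) <= D + e].
Proof.
move=> e0 fD.
have [||u v uv|g [[g0 gp] gq gD]] := @finite_transport_duality R I J p q
  (fun i j => mdist (x i) (y j)) p_ge0 p_sum q_ge0 q_sum _ _ D _ e e0.
- by move=> i j; exact: mdist_ge0.
- by move=> i j; exact: mdist_le1.
- by have [f fl] := potentials_lip01 uv; move/le_trans; apply; exact: fD.
- by exists g.
Qed.

End discrete_transport.

Section kantorovich.
Context (R : realType) (dE : measure_display) (E : measurableCompleteMetricType dE R).
Hypotheses (hborel : is_borel E) (hsep : separable E).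
Hypothesis mdist_le1 : forall x y : E, mdist x y <= 1.
Implicit Types (P Q : probability E R).

Section atoms.
Variable a : nat -> E.

Definition atom_weight P n (i : 'I_n.+1) : R :=
  fine (P (nearest a n @^-1` [set (i : nat)])).

Lemma measurable_nearest_fiber n (i : nat) : measurable (nearest a n @^-1` [set i]).
Proof.
rewrite -[X in measurable X]setTI; have [h _] := measurable_nearest hborel a n.
exact: h.
Qed.

Lemma atom_weight_ge0 P n i : 0 <= @atom_weight P n i.
Proof. by rewrite fine_ge0. Qed.

Lemma EFin_atom_weight P n i :
  (@atom_weight P n i)%:E = P (nearest a n @^-1` [set (i : nat)]).
Proof. by rewrite /atom_weight fineK// fin_num_measure//; exact: measurable_nearest_fiber. Qed.

Lemma Rintegral_atoms P n (f : nat -> R) :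
  \int[P]_x f (nearest a n x) = \sum_i @atom_weight P n i * f i.
Proof.
rewrite (Rintegral_finite_range P (k := nearest_ord a n) (fun i => f i)).
  by apply: eq_bigr => i _; rewrite nearest_ord_fiber.
by move=> i; rewrite nearest_ord_fiber; exact: measurable_nearest_fiber.
Qed.

Lemma atom_weight_sum P n : \sum_i @atom_weight P n i = 1.
Proof.
have := Rintegral_atoms P n (fun=> 1); rewrite Rintegral_cst1 => ->.
by apply: eq_bigr => i _; rewrite mulr1.
Qed.

End atoms.

Lemma measure_fibers P (k : E -> nat) (n : nat) (A : set E) :
  measurable_fun setT k -> (forall x, (k x <= n)%N) -> measurable A ->
  (\sum_(i < n.+1) P (k @^-1` [set (i : nat)] `&` A) = P A)%E.
Proof.
move=> mk kn mA; pose F i := k @^-1` [set i] `&` A.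
have mF i : measurable (F i).
  by apply: measurableI => //; rewrite -[X in measurable X]setTI; exact: mk.
have tF : trivIset setT F by move=> i j _ _ [x [[/= <- _] [<- _]]].
rewrite -(measure_bigsetU P mF tF) -bigcup_mkord; congr (P _).
apply/seteqP; split => [x [i _ []]//|x Ax].
by exists (k x); [rewrite /= ltnS; exact: kn|].
Qed.

(** Quantize both laws, transport the weights of the cells by the finite
  duality, and inside each pair of cells take the product of the conditional
  laws. Both quantization errors enter twice, in the dual bound and in the
  cost, and the finite duality gap once: hence e / 5. *)
Lemma wasserstein_le_dual P Q (b : R) :
  (forall f : E -> R, lip01 f -> \int[P]_x f x - \int[Q]_x f x <= b) ->
  (wasserstein P Q <= b%:E)%E.
Proof.
move=> fb; apply/lee_addgt0Pr => e e0; rewrite -EFinD.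
have [a ad] := dense_sequence hsep.
have e5 : 0 < e / 5 by lra.
have [n nP] := quantize hborel mdist_le1 ad P e5.
have [m mQ] := quantize hborel mdist_le1 ad Q e5.
pose p := @atom_weight a P n; pose q := @atom_weight a Q m.
have p0 : forall i, 0 <= p i by exact: atom_weight_ge0.
have q0 : forall i, 0 <= q i by exact: atom_weight_ge0.
have [f fl|g [g0 gp gq gD]] := @discrete_transport R dE E mdist_le1 _ _
  (fun i : 'I_n.+1 => a i) (fun j : 'I_m.+1 => a j) p q p0
  (atom_weight_sum a P n) q0 (atom_weight_sum a Q m) (b + 2 * (e / 5)) (e / 5) e5.
  have := fb f fl.
  have := quantize_lip01 hborel mdist_le1 a P n fl.
  have := quantize_lip01 hborel mdist_le1 a Q m fl.
  rewrite !(Rintegral_atoms a _ _ (fun i => f (a i))) -/p -/q !ler_norml.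
  move=> /andP[h1 h2] /andP[h3 h4]; lra.
have /choice[Pc PcE] : forall i : 'I_n.+1, exists S : probability E R,
    forall B, measurable B -> (P (nearest a n @^-1` [set (i : nat)]) * S B =
      P (nearest a n @^-1` [set (i : nat)] `&` B))%E.
  by move=> i; apply: conditional_probability; exact: measurable_nearest_fiber.
have /choice[Qc QcE] : forall j : 'I_m.+1, exists S : probability E R,
    forall B, measurable B -> (Q (nearest a m @^-1` [set (j : nat)]) * S B =
      Q (nearest a m @^-1` [set (j : nat)] `&` B))%E.
  by move=> i; apply: conditional_probability; exact: measurable_nearest_fiber.
have gs : \sum_(ij : 'I_n.+1 * 'I_m.+1) g ij.1 ij.2 = 1.
  rewrite -(pair_bigA _ g)/= -(atom_weight_sum a P n); exact: eq_bigr.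
have [la [laE _]] := @finite_mixture _ _ R _ (fun ij => g ij.1 ij.2)
  (fun ij => (Pc ij.1 \x Qc ij.2)%E : probability (E * E)%type R)
  (fun ij => g0 _ _) gs.
have laX (A B : set E) : measurable A -> measurable B ->
    (la (A `*` B) = \sum_i \sum_j (g i j)%:E * (Pc i A * Qc j B))%E.
  move=> mA mB; rewrite laE (pair_bigA _ (fun i j => (g i j)%:E * (Pc i A * Qc j B))%E)/=.
  by apply: eq_bigr => -[i j] _ /=; rewrite product_measure1E.
have fin_sum (I : finType) (w : I -> R) (X : \bar R) : (forall i, 0 <= w i) ->
    (\sum_i (w i)%:E * X = (\sum_i w i)%:E * X)%E.
  by move=> w0; rewrite -sumEFin ge0_sume_distrl// => i _; rewrite lee_fin.
have [mn _] := measurable_nearest hborel a n.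
have [mm _] := measurable_nearest hborel a m.
have cl : couplings P Q la.
  move=> A mA; split; rewrite laX//.
    rewrite -[RHS](measure_fibers P mn (nearest_le a n) mA); apply: eq_bigr => i _.
    under eq_bigr do rewrite measure_prob_setT mule1.
    by rewrite fin_sum// gp EFin_atom_weight PcE.
  rewrite exchange_big/= -[RHS](measure_fibers Q mm (nearest_le a m) mA).
  apply: eq_bigr => j _.
  under eq_bigr do rewrite measure_prob_setT mul1e.
  by rewrite fin_sum// gq EFin_atom_weight QcE.
apply: (@le_trans _ _ (\int[la]_z (mdist z.1 z.2)%:E)%E).
  by apply: ereal_inf_lbound; exists la.
rewrite -EFin_Rintegral; last first.
  apply: (@integrable_bounded _ _ _ la _ 1); first exact: measurable_mdist.
  by move=> z; rewrite ger0_norm ?mdist_ge0.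
rewrite lee_fin.
pose k1 (z : E * E) := nearest_ord a n z.1.
pose k2 (z : E * E) := nearest_ord a m z.2.
have k12E i j : (fun z => (k1 z, k2 z)) @^-1` [set (i, j)] =
    (nearest a n @^-1` [set (i : nat)]) `*` (nearest a m @^-1` [set (j : nat)]).
  rewrite -!nearest_ord_fiber; apply/seteqP; split => -[x y] /=; first by case.
  by move=> [xi yj]; congr pair.
have mfib := measurable_nearest_fiber.
have mk12 ij : measurable ((fun z => (k1 z, k2 z)) @^-1` [set ij]).
  by case: ij => i j; rewrite k12E; apply: measurableX.
(* The law conditioned on one cell does not charge another one. *)
have off (S : probability E R) (Sc : probability E R) (l i j : nat) :
  (forall B, measurable B -> (S (nearest a l @^-1` [set i]) * Sc B =
      S (nearest a l @^-1` [set i] `&` B))%E) -> i != j ->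
  (S (nearest a l @^-1` [set i]) * Sc (nearest a l @^-1` [set j]) = 0)%E.
  move=> ScE ij; rewrite ScE// (_ : _ `&` _ = set0) ?measure0//.
  by apply/seteqP; split => // x [/= xi xj]; move: ij; rewrite -xi -xj eqxx.
have la_fib (i : 'I_n.+1) (j : 'I_m.+1) : (la ((nearest a n @^-1` [set (i : nat)]) `*` (nearest a m @^-1` [set (j : nat)]))
    <= (g i j)%:E)%E.
  rewrite laX// (bigD1 i)//= (bigD1 j)//= [X in (_ + X + _)%E]big1 => [|j' j'j].
    rewrite adde0 [X in (_ + X)%E]big1 => [|i' i'i].
      rewrite adde0 -[leRHS]mule1 lee_wpmul2l ?lee_fin//.
      by rewrite -[leRHS]mule1 lee_pmul// probability_le1.
    apply: big1 => j' _; apply/eqP; rewrite eq_le; apply/andP; split; last first.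
      by rewrite mule_ge0 ?lee_fin// mule_ge0.
    rewrite muleA (@le_trans _ _ ((p i')%:E * Pc i' (nearest a n @^-1` [set (i : nat)]) * 1)%E)//.
      apply: lee_pmul => //; rewrite ?mule_ge0 ?lee_fin ?probability_le1//.
      apply: lee_wpmul2r => //.
      by rewrite lee_fin -gp (bigD1 j')//= lerDl sumr_ge0.
    by rewrite mule1 EFin_atom_weight (off P (Pc i') n i' i (PcE i') i'i).
  apply/eqP; rewrite eq_le; apply/andP; split; last first.
    by rewrite mule_ge0 ?lee_fin// mule_ge0.
  rewrite muleCA (@le_trans _ _ (1 * ((q j')%:E * Qc j' (nearest a m @^-1` [set (j : nat)])))%E)//.
    apply: lee_pmul => //; rewrite ?mule_ge0 ?lee_fin ?probability_le1//.
    apply: lee_wpmul2r => //.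
    by rewrite lee_fin -gq (bigD1 i)//= lerDl sumr_ge0.
  by rewrite mul1e EFin_atom_weight (off Q (Qc j') m j' j (QcE j') j'j).
pose c (ij : 'I_n.+1 * 'I_m.+1) : R := mdist (a ij.1) (a ij.2).
have [mn1 mn2] := measurable_nearest hborel a n.
have [mm1 mm2] := measurable_nearest hborel a m.
pose f1 x : R := mdist (a (nearest a n x)) x.
pose f2 x : R := mdist (a (nearest a m x)) x.
have i1 : la.-integrable setT (EFin \o (fun z => f1 z.1)).
  apply: (@integrable_bounded _ _ _ la _ 1); first exact: (measurableT_comp (f := f1)).
  by move=> z; rewrite ger0_norm; [exact: mdist_le1|exact: mdist_ge0].
have i2 : la.-integrable setT (EFin \o (fun z => f2 z.2)).
  apply: (@integrable_bounded _ _ _ la _ 1); first exact: (measurableT_comp (f := f2)).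
  by move=> z; rewrite ger0_norm; [exact: mdist_le1|exact: mdist_ge0].
have i3 : la.-integrable setT (EFin \o (fun z => c (k1 z, k2 z))).
  apply: (@integrable_bounded _ _ _ la _ 1).
    apply: (measurable_fun_gt (R := R)) => r.
    rewrite (_ : [set _ | _] = \bigcup_(ij in [set ij | r < c ij])
       ((fun z => (k1 z, k2 z)) @^-1` [set ij])).
      by apply: fin_bigcup_measurable => // ij _; exact: mk12.
    apply/seteqP; split=> [z rz|z [ij rij]]; first by exists (k1 z, k2 z).
    by move=> /= zij; move: rij; rewrite /= -zij.
  by move=> z; rewrite ger0_norm; [exact: mdist_le1|exact: mdist_ge0].
have i0 : la.-integrable setT (EFin \o (fun z => mdist z.1 z.2)).
  apply: (@integrable_bounded _ _ _ la _ 1); first exact: measurable_mdist.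
  by move=> z; rewrite ger0_norm ?mdist_ge0.
have i12 : la.-integrable setT (EFin \o (fun z => f1 z.1 + f2 z.2)).
  exact: (integrableD measurableT i1 i2).
have i123 : la.-integrable setT (EFin \o (fun z => (f1 z.1 + f2 z.2) + c (k1 z, k2 z))).
  exact: (integrableD measurableT i12 i3).
apply: (@le_trans _ _ (\int[la]_z (f1 z.1 + f2 z.2 + c (k1 z, k2 z)))).
  apply: le_Rintegral => // z _.
  have h1 := metric_triangle z.1 (a (k1 z)) z.2.
  have h2 := metric_triangle (a (k1 z)) (a (k2 z)) z.2.
  rewrite (metric_sym z.1 (a (k1 z))) in h1.
  rewrite /f1 /f2 /c /k1 /k2 /= in h1 h2 *; lra.
rewrite RintegralD// RintegralD// (Rcoupling_fst cl)//; last by move=> x; exact: mdist_ge0.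
rewrite (Rcoupling_snd cl)//; last by move=> x; exact: mdist_ge0.
rewrite (Rintegral_finite_range la (k := fun z => (k1 z, k2 z)) c mk12).
have : \sum_ij fine (la ((fun z => (k1 z, k2 z)) @^-1` [set ij])) * c ij <=
   b + 2 * (e / 5) + e / 5.
  apply: le_trans gD; rewrite (pair_bigA _ (fun i j => g i j * (mdist (a i) (a j) : R)))/=.
  apply: ler_sum => -[i j] _; apply: ler_wpM2r; first exact: mdist_ge0.
  rewrite -lee_fin fineK; last exact: fin_num_measure.
  by rewrite k12E; exact: la_fib.
move: nP mQ; rewrite -/f1 -/f2; lra.
Qed.

End kantorovich.

(** * Completeness of the space of laws *)

Section atomless.
Context (R : realType).

(** For the uniform law on [0, 1], the mass of A below t is Lipschitz in t,
  and therefore takes every value between 0 and the mass of A. *)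
Lemma uniform01 : exists L : probability (measurableTypeR R) R,
  forall (A : set (measurableTypeR R)) (s : R), measurable A -> 0 <= s -> (s%:E <= L A)%E ->
    exists B : set (measurableTypeR R), [/\ measurable B, B `<=` A & L B = s%:E].
Proof.
have m01 : measurable (`[0, 1]%classic : set R) by exact: measurable_itv.
pose m : {measure set (measurableTypeR R) -> \bar R} := mrestr lebesgue_measure m01.
have mE A : m A = lebesgue_measure (A `&` `[0, 1]%classic) by [].
have m1 : m setT = 1%E.
  by rewrite mE setTI lebesgue_measure_itv/= lte_fin ltr01 oppr0 adde0.
have [L LE] := @measure1_probability _ (measurableTypeR R) R m m1.
exists L => A s mA s0 sA.
have mAt (t : R) : measurable (A `&` `]-oo, t]) by apply: measurableI => //; exact: measurable_itv.
pose F (t : R) : R := fine (L (A `&` `]-oo, t])).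
have FE t : (F t)%:E = L (A `&` `]-oo, t]).
  by rewrite /F fineK//; exact: (fin_num_measure L _ (mAt t)).
have Flip t u : t <= u -> F t <= F u <= F t + (u - t).
  move=> tu; rewrite -!lee_fin EFinD !FE; apply/andP; split.
    apply: le_measure; rewrite ?inE; [exact: mAt|exact: mAt|apply: setIS => x/=].
    by rewrite !in_itv/= => /le_trans; apply.
  have mtu : measurable (A `&` `]t, u]%classic) by apply: measurableI => //; exact: measurable_itv.
  have -> : A `&` `]-oo, u] = (A `&` `]-oo, t]) `|` (A `&` `]t, u]%classic).
    rewrite -setIUr; congr (_ `&` _); apply/seteqP; split => x/=; rewrite !in_itv/=.
      by move=> xu; case: (leP x t) => xt; [left|right].
    by case=> [/le_trans|/andP[]//]; apply.
  have /le_trans := measureU2 L (mAt t) mtu; apply; apply: leeD2l.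
  apply: (@le_trans _ _ (lebesgue_measure (A `&` `]t, u]%classic `&` `[0, 1]%classic))).
    by rewrite -mE -LE.
  apply: (@le_trans _ _ (lebesgue_measure (`]t, u]%classic : set R))).
    apply: le_measure; rewrite ?inE; [exact: measurableI|exact: measurable_itv|].
    by move=> x [[_ ?] _].
  rewrite lebesgue_measure_itv/=; case: ifP => // _.
  by rewrite lee_fin subr_ge0.
have F0 : F 0 = 0.
  have : (F 0)%:E = 0%E; last by case.
  rewrite FE LE mE; apply/eqP; rewrite eq_le measure_ge0 andbT.
  rewrite -(lebesgue_measure_set1 (0 : R)); apply: le_measure; rewrite ?inE.
  - by apply: measurableI => //; exact: mAt.
  - exact: measurable_set1.
  - move=> x [[_ /=]]; rewrite !in_itv/= => x0 /andP[x1 _].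
    by apply/eqP; rewrite eq_le x0 x1.
have F1 : (F 1)%:E = L A.
  rewrite FE; apply: (etrans (LE _)); apply/esym; apply: (etrans (LE _)).
  rewrite !mE; suff -> : A `&` `]-oo, 1%R]%classic `&` `[0, 1]%classic = A `&` `[0, 1]%classic by [].
  apply/seteqP; split => x/=; rewrite !in_itv/=; first by case=> -[].
  by move=> [Ax /andP[x0 x1]]; rewrite x0 x1.
have cF : continuous F.
  move=> t; apply/cvgrPdist_le => e e0; near=> u.
  have tu : `|t - u| <= e by near: u; exact: cvgr_dist_le.
  have [h|/ltW h] := leP t u; have /andP[h1 h2] := Flip _ _ h;
    by move: tu; rewrite !ler_norml => /andP[? ?]; apply/andP; split; lra.
have [t _ Ft] : exists2 t, t \in `[0, 1] & F t = s.
  apply: IVT => //; first exact: continuous_subspaceT.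
  have : (s%:E <= (F 1)%:E)%E by rewrite F1.
  by rewrite F0 lee_fin => sF; rewrite min_l ?max_r ?s0//; exact: le_trans sF.
exists (A `&` `]-oo, t]); split; [exact: mAt|exact: subIsetl|].
by rewrite -FE Ft.
Unshelve. all: by end_near. Qed.

End atomless.

Section splitting.
Context (R : realType) d (T : measurableType d) (L : probability T R).
Hypothesis L_atomless : forall (A : set T) (s : R), measurable A -> 0 <= s ->
  (s%:E <= L A)%E -> exists B, [/\ measurable B, B `<=` A & L B = s%:E].

(** The pieces are cut off one at a time; the last one is what is left. *)
Lemma split_set (J : finType) (w : J -> R) (s : seq J) (A : set T) :
  (forall j, 0 <= w j) -> uniq s -> s != [::] -> measurable A ->
  L A = (\sum_(j <- s) w j)%:E ->
  exists k : T -> J, [/\ forall x, k x \in s,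
    forall j, measurable (k @^-1` [set j]) &
    forall j, j \in s -> L (A `&` (k @^-1` [set j])) = (w j)%:E].
Proof.
move=> w0; elim: s A => // j s IH A /= /andP[js us] _ mA LA.
have [s0|s0] := eqVneq s [::].
  exists (fun=> j); split=> [x|i|i]; first by rewrite inE eqxx.
    have [->|/eqP ij] := eqVneq i j.
      by rewrite (_ : _ @^-1` _ = setT)//; apply/seteqP; split.
    by rewrite (_ : _ @^-1` _ = set0)//; apply/seteqP; split => // x /= ji; apply: ij.
  rewrite s0 inE => /eqP ->.
  rewrite (_ : _ `&` _ = A); first by rewrite LA s0 big_seq1.
  by apply/seteqP; split => x //= [].
rewrite big_cons in LA.
have Sw0 : 0 <= \sum_(j <- s) w j by apply: sumr_ge0.
have [|B [mB BA LB]] := L_atomless mA (w0 j).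
  by rewrite LA lee_fin lerDl.
have mAB : measurable (A `\` B) by exact: measurableD.
have [|k [ks mk Lk]] := IH (A `\` B) us s0 mAB.
  rewrite measureD//; last by apply: (@le_lt_trans _ _ 1%E); [exact: probability_le1|rewrite ltry].
  by rewrite setIidr// -[X in (X - _)%E]/(L A) -[X in (_ - X)%E]/(L B) LA LB -EFinB addrAC subrr add0r.
have mBk i : measurable (B `&` k @^-1` [set i]) by exact: measurableI.
exists (fun x => if x \in B then j else k x); split.
- by move=> x; case: ifP => _; rewrite inE ?eqxx// ks orbT.
- move=> i.
  rewrite (_ : _ @^-1` _ = (B `&` [set x | j = i]) `|` (k @^-1` [set i] `\` B)).
    apply: measurableU; last exact: measurableD.
    apply: measurableI => //; have [->|/eqP ij] := eqVneq j i.
      by rewrite (_ : [set x | _] = setT)//; apply/seteqP; split.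
    by rewrite (_ : [set x | _] = set0)//; apply/seteqP; split => // x.
  apply/seteqP; split => x /=; first by case: ifPn => [/set_mem|/negP]; rewrite ?inE; tauto.
  by case=> [[Bx ji]|[ki Bx]]; [rewrite mem_set|rewrite memNset].
- move=> i; rewrite inE; have [-> _|ij /= si] := eqVneq i j.
    rewrite -LB; congr (L _); apply/seteqP; split => x /=.
      case: ifPn => [/set_mem//|_ [_ kj]].
      by move: js; rewrite -kj ks.
    by move=> Bx; rewrite mem_set//; split => //; exact: BA.
  rewrite -(Lk i si); congr (L _); apply/seteqP; split => x /=.
    by case: ifPn => [_ [_ ji]|/negP]; [rewrite ji eqxx in ij|rewrite inE; tauto].
  by move=> [[Ax Bx] ki]; rewrite memNset.
Qed.

(** A coupling g of two finite laws is realized without touching the variable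
  k that carries the first one: only the fibres of k are split. Hence couplings
  can be chained on one probability space. *)
Lemma couple_step (I J : finType) (k : T -> I) (g : I -> J -> R) :
  (forall i j, 0 <= g i j) -> (0 < #|J|)%N ->
  (forall i, measurable (k @^-1` [set i])) ->
  (forall i, L (k @^-1` [set i]) = (\sum_j g i j)%:E) ->
  exists l : T -> J, (forall j, measurable (l @^-1` [set j])) /\
    forall i j, L (k @^-1` [set i] `&` l @^-1` [set j]) = (g i j)%:E.
Proof.
move=> g0 J0 mk Lk.
have ne : index_enum J != [::].
  have /card_gt0P[j _] := J0.
  by apply/eqP => e; have := mem_index_enum j; rewrite e.
have /choice[h hP] : forall i, exists l : T -> J,
    (forall j, measurable (l @^-1` [set j])) /\
    forall j, L (k @^-1` [set i] `&` l @^-1` [set j]) = (g i j)%:E.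
  move=> i; have [l [_ ml Ll]] := split_set (g0 i) (index_enum_uniq J) ne (mk i) (Lk i).
  by exists l; split=> // j; apply: Ll; exact: mem_index_enum.
have hk i j : k @^-1` [set i] `&` (fun x => h (k x) x) @^-1` [set j] =
    k @^-1` [set i] `&` h i @^-1` [set j].
  by apply/seteqP; split => x /= [ki hj]; rewrite ki in hj *.
exists (fun x => h (k x) x); split=> [j|i j]; last by rewrite hk; exact: (hP i).2.
rewrite (_ : _ @^-1` _ = \bigcup_(i in [set: I]) (k @^-1` [set i] `&` h i @^-1` [set j])).
  apply: fin_bigcup_measurable => // i _; apply: measurableI => //; exact: (hP i).1.
apply/seteqP; split=> [x hx|x [i _]]; last by rewrite -hk => -[].
by exists (k x) => //; rewrite -hk.
Qed.

End splitting.

Section almost_sure_limit.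
Context (R : realType) (dE : measure_display) (E : measurableCompleteMetricType dE R).
Hypotheses (hborel : is_borel E) (mdist_le1 : forall x y : E, mdist x y <= 1).

(** A proper open subset is the positivity set of a test function, the distance
  to its complement. *)
Lemma measurable_fun_lip01 d (T : measurableType d) (Z : T -> E) :
  (forall f : E -> R, lip01 f -> measurable_fun setT (f \o Z)) ->
  measurable_fun setT Z.
Proof.
move=> H; apply: (measurability (@open E)); first exact: hborel.
move=> _ [U oU <-]; rewrite setTI.
have [UT|/eqP UT] := eqVneq U setT; first by rewrite UT preimage_setT.
have C0 : (~` U) !=set0.
  by apply/set0P; apply/eqP => /(congr1 setC); rewrite setCK setC0.
have l01 : lip01 (dist_to (~` U) : E -> R).
  split=> [|x]; first exact: lip1_dist_to.
  apply/andP; split; first by apply: le_dist_to => // y _; exact: mdist_ge0.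
  by case: C0 => y Cy; rewrite (le_trans (dist_to_le x Cy)).
have -> : Z @^-1` U = setT `&` (dist_to (~` U) \o Z) @^-1` [set r : R | 0 < r].
  rewrite setTI; apply/seteqP; split => x /=.
    move=> Ux; move: oU; rewrite openE => /(_ _ Ux)/nbhs_ballP[r /= r0 rU].
    apply: (lt_le_trans r0); apply: le_dist_to => // y; apply: contra_notT.
    rewrite -ltNge => xy; apply: rU; rewrite ballEmdist; exact: xy.
  apply: contraPP => Ux; apply/negP; rewrite -leNgt.
  by rewrite -(mdistxx (Z x)) dist_to_le.
apply: H => //.
rewrite [X in measurable X](_ : _ = `]0, +oo[%classic); first exact: measurable_itv.
by apply/seteqP; split => r /=; rewrite in_itv/= andbT.
Qed.

Lemma summable_cauchy (y : nat -> E) (M : R) :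
  (forall n, \sum_(k < n) (mdist (y k) (y k.+1) : R) <= M) ->
  exists z : E, y @ \oo --> z.
Proof.
move=> yM; pose s n : R := \sum_(k < n) (mdist (y k) (y k.+1) : R).
have sS n : s n.+1 = s n + mdist (y n) (y n.+1) by rewrite /s big_ord_recr.
have dS n m : (mdist (y n) (y (n + m)%N) : R) <= s (n + m)%N - s n.
  elim: m => [|m IH]; first by rewrite addn0 subrr mdistxx.
  have h := metric_triangle (y n) (y (n + m)%N) (y (n + m.+1)%N).
  by rewrite addnS sS in h *; lra.
have hs : has_sup [set s n | n in setT].
  by split; [exists (s 0%N), 0%N|exists M => _ [n _ <-]; exact: yM].
suff : cauchy (y @ \oo) by move=> /cauchy_cvg/cvg_ex.
apply: cauchy_exP => e e0.
have [_ [n _ <-] sn] := sup_adherent e0 hs.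
exists (y n); exists n => // m /= nm; rewrite ballEmdist /=.
rewrite -(subnKC nm); apply: (le_lt_trans (dS _ _)).
have : s (n + (m - n))%N <= sup [set s n | n in setT].
  by apply: ub_le_sup; [exact: hs.2|exists (n + (m - n))%N].
lra.
Qed.

Lemma sum_half_pow n : \sum_(k < n) (2^-1 : R) ^+ k <= 2.
Proof.
have -> : \sum_(k < n) (2^-1 : R) ^+ k = 2 - 2 * 2^-1 ^+ n.
  elim: n => [|n IH]; first by rewrite big_ord0 expr0 mulr1 subrr.
  by rewrite big_ord_recr/= IH exprS; move: (_ ^+ n) => x; lra.
by have : 0 <= (2^-1 : R) ^+ n by [rewrite exprn_ge0]; lra.
Qed.

(** The expected length of the path (Y_k) is finite, so almost every path
  converges, and the laws converge to the law of the limit by dominated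
  convergence. *)
Lemma limit_law d (T : measurableType d) (L : probability T R) (Y : nat -> T -> E)
    (C : R) :
  (forall k, measurable_fun setT (Y k)) ->
  (forall k, measurable_fun setT (fun x => (mdist (Y k x) (Y k.+1 x) : R))) ->
  (forall k, \int[L]_x mdist (Y k x) (Y k.+1 x) <= C * 2^-1 ^+ k) ->
  exists pi : probability E R, forall f : E -> R, lip01 f ->
    (fun k => \int[L]_x f (Y k x)) @ \oo --> \int[pi]_x f x.
Proof.
move=> mY mD YC.
have D0 k x : 0 <= (mdist (Y k x) (Y k.+1 x) : R) by exact: mdist_ge0.
pose S x : \bar R := (\sum_(k <oo) (mdist (Y k x) (Y k.+1 x))%:E)%E.
have C0 : 0 <= C.
  have := le_trans _ (YC 0%N); rewrite expr0 mulr1; apply.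
  by apply: Rintegral_ge0.
have mS : measurable_fun setT S.
  by apply: ge0_emeasurable_sum => [k x _ _|k _]; [rewrite lee_fin|exact/measurable_EFinP].
have iD k : L.-integrable setT (EFin \o (fun x => (mdist (Y k x) (Y k.+1 x) : R))).
  by apply: (@integrable_bounded _ _ _ L _ 1) => // x; rewrite ger0_norm.
have SC : (\int[L]_x S x <= (2 * C)%:E)%E.
  rewrite integral_nneseries//; last 2 first.
    by move=> n; exact/measurable_EFinP.
    by move=> n x _; rewrite lee_fin.
  apply: lime_le; first by apply: is_cvg_nneseries => n _ _; apply: integral_ge0 => x _; rewrite lee_fin.
  apply: nearW => n; rewrite big_mkord.
  apply: (@le_trans _ _ (\sum_(k < n) (C * 2^-1 ^+ k)%:E)%E).
    by apply: lee_sum => k _; rewrite -EFin_Rintegral// lee_fin.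
  rewrite sumEFin lee_fin -mulr_sumr mulrC ler_wpM2r//; exact: sum_half_pow.
have Sint : L.-integrable setT S.
  apply/integrableP; split => //; apply: (@le_lt_trans _ _ (2 * C)%:E); last by rewrite ltry.
  rewrite (eq_integral S) => [//|x _]; apply: gee0_abs.
  by apply: nneseries_ge0 => k _ _; rewrite lee_fin.
have [N [mN N0 NS]] := integrable_ae measurableT Sint.
(* On the exceptional null set the whole path is reset to one point, so that
   it converges everywhere and its limit is measurable. *)
have /choice[Z ZP] : forall x, exists z : E, (~ N x -> Y ^~ x @ \oo --> z) /\ (N x -> z = point).
  move=> x; have [Nx|Nx] := pselect (N x); first by exists point.
  have Sx : S x \is a fin_num.
    by apply: contrapT => Sx; apply: Nx; apply: NS => /= h; apply: Sx; exact: h.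
  have [z Yz] : exists z : E, Y ^~ x @ \oo --> z.
    apply: (summable_cauchy (y := Y ^~ x) (M := fine (S x))) => n.
    rewrite -lee_fin fineK// -sumEFin -(big_mkord xpredT (fun k => (mdist (Y k x) (Y k.+1 x))%:E)).
    by apply: nneseries_lim_ge => k _ _; rewrite lee_fin.
  by exists z.
pose Y' k x := if x \in N then point else Y k x.
have mN' : measurable_fun setT (fun x => x \in N).
  apply: (measurable_fun_bool true); rewrite setTI (_ : _ @^-1` _ = N)//.
  by apply/seteqP; split => x /=; [move/set_mem|move/mem_set].
have mY' k : measurable_fun setT (Y' k).
  by apply: measurable_fun_ifT.
have fY' (f : E -> R) : lip01 f -> forall x, f (Y' n x) @[n --> \oo] --> f (Z x).
  move=> [fl _] x; rewrite /Y'; have [xN|/negbTE xN] := boolP (x \in N).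
    have Nx : N x by exact: set_mem.
    by rewrite (ZP x).2//; exact: cvg_cst.
  have Nx : ~ N x by move/mem_set; rewrite xN.
  apply/cvgrPdist_le => e e0.
  have h := metricType_numDomainType.cvgr_dist_le ((ZP x).1 Nx) e0.
  case: h => M _ hM; exists M => // n /hM hn.
  by apply: le_trans hn; exact: lip1_norm.
have mZ : measurable_fun setT Z.
  apply: measurable_fun_lip01 => f fl.
  apply: (measurable_fun_cvg (h := fun n => f \o Y' n)) => [n|x _]; last exact: fY'.
  by apply: measurableT_comp => //; exact: lip01_measurable.
pose pi : probability E R := distribution L (mfun_Sub (mem_set mZ)).
exists pi => f fl.
have fm := lip01_measurable hborel fl.
have f01 x : `|f x| <= 1 by have [_ /(_ x)/andP[? ?]] := fl; rewrite ger0_norm.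
have -> : \int[pi]_x f x = \int[L]_x f (Z x).
  congr fine; have := @ge0_integral_pushforward _ _ _ _ R Z mZ L setT (EFin \o f) measurableT.
  rewrite preimage_setT => <-//; first exact/measurable_EFinP.
  by move=> x _; rewrite lee_fin; have [_ /(_ x)/andP[]] := fl.
have -> : (fun k => \int[L]_x f (Y k x)) = (fun k => \int[L]_x f (Y' k x)).
  apply/funext => k; congr fine; apply: ae_eq_integral => //.
  - by apply/measurable_EFinP; exact: measurableT_comp.
  - by apply/measurable_EFinP; exact: measurableT_comp.
  exists N; split => // x /= h; apply: contrapT => Nx; apply: h => _.
  by rewrite /Y' memNset.
apply: (@Rintegral_cvg_bounded _ _ _ L _ _ 1) => //.
- by move=> k; exact: measurableT_comp.
- by move=> x; exact: fY'.
Qed.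

End almost_sure_limit.

Section completeness.
Context (R : realType) (dE : measure_display) (E : measurableCompleteMetricType dE R).
Hypotheses (hborel : is_borel E) (hsep : separable E).
Hypothesis mdist_le1 : forall x y : E, mdist x y <= 1.

Lemma couple_cost d (T : measurableType d) (L : probability T R) (I J : finType)
    (k : T -> I) (l : T -> J) (g : I -> J -> R) (F : I -> J -> R) :
  (forall i, measurable (k @^-1` [set i])) ->
  (forall j, measurable (l @^-1` [set j])) ->
  (forall i j, L (k @^-1` [set i] `&` l @^-1` [set j]) = (g i j)%:E) ->
  \int[L]_x F (k x) (l x) = \sum_i \sum_j g i j * F i j.
Proof.
move=> mk ml Lg.
have pE ij : (fun x => (k x, l x)) @^-1` [set ij] = k @^-1` [set ij.1] `&` l @^-1` [set ij.2].
  by case: ij => i j; apply/seteqP; split => x /= [-> ->].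
rewrite (Rintegral_finite_range L (k := fun x => (k x, l x)) (fun ij => F ij.1 ij.2)).
  rewrite pair_bigA; apply: eq_bigr => -[i j] _ /=; congr (_ * _).
  by rewrite pE/= -[LHS]/(fine (L _)) Lg.
by move=> ij; rewrite pE; exact: measurableI.
Qed.

(** The weight of j is the expected cost for the indicator of j as the cost. *)
Lemma couple_law d (T : measurableType d) (L : probability T R) (I J : finType)
    (k : T -> I) (l : T -> J) (g : I -> J -> R) (j : J) :
  (forall i, measurable (k @^-1` [set i])) ->
  (forall j, measurable (l @^-1` [set j])) ->
  (forall i j, L (k @^-1` [set i] `&` l @^-1` [set j]) = (g i j)%:E) ->
  L (l @^-1` [set j]) = (\sum_i g i j)%:E.
Proof.
move=> mk ml Lg; have := couple_cost (fun _ j' => (j' == j)%:R) mk ml Lg.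
rewrite (Rintegral_finite_range L (fun j' => (j' == j)%:R) ml).
rewrite (bigD1 j)//= eqxx mulr1 big1 ?addr0 => [|j' /negbTE ->]; last by rewrite mulr0.
move=> h; rewrite -[LHS]fineK; last exact: fin_num_measure.
congr EFin; rewrite [LHS]h; apply: eq_bigr => i _.
rewrite (bigD1 j)//= eqxx mulr1 big1 ?addr0// => j' /negbTE ->.
by rewrite mulr0.
Qed.

(** Quantize each law with an error comparable to its distance from the next
  one, couple consecutive quantizations almost optimally, and chain the
  couplings on the unit interval: the variables so obtained have steps of
  summable mean length. *)
Theorem laws_complete (P : nat -> probability E R) :
  (forall k (f : E -> R), lip01 f ->
     `|\int[P k]_x f x - \int[P k.+1]_x f x| <= 2^-1 ^+ k) ->
  exists pi : probability E R, forall f : E -> R, lip01 f ->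
    (fun k => \int[P k]_x f x) @ \oo --> \int[pi]_x f x.
Proof.
move=> PC.
have [a ad] := dense_sequence hsep.
have h0 k : 0 < (2^-1 : R) ^+ k by rewrite exprn_gt0// invr_gt0.
have /choice[n nP] : forall k, exists n, \int[P k]_x mdist (a (nearest a n x)) x <= 2^-1 ^+ k.
  by move=> k; exact: (quantize hborel mdist_le1 ad (P k) (h0 k)).
pose p k : 'I_(n k).+1 -> R := @atom_weight R dE E a (P k) (n k).
have pf k (f : E -> R) : lip01 f ->
    `|\int[P k]_x f x - \sum_i p k i * f (a i)| <= 2^-1 ^+ k.
  move=> fl; rewrite -(Rintegral_atoms hborel a (P k) (n k) (fun i => f (a i))).
  exact: (le_trans (quantize_lip01 hborel mdist_le1 a (P k) (n k) fl)).
have gE : forall k, exists g : 'I_(n k).+1 -> 'I_(n k.+1).+1 -> R,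
  [/\ forall i j, 0 <= g i j, forall i, \sum_j g i j = p k i,
      forall j, \sum_i g i j = p k.+1 j &
      \sum_i \sum_j g i j * mdist (a i) (a j) <= 4 * 2^-1 ^+ k].
  move=> k.
  have [f fl|g [g0 gp gq gD]] := @discrete_transport R dE E mdist_le1 _ _
    (fun i : 'I_(n k).+1 => a i) (fun j : 'I_(n k.+1).+1 => a j) (p k) (p k.+1)
    (atom_weight_ge0 a (P k) (n:=n k)) (atom_weight_sum hborel a (P k) (n k))
    (atom_weight_ge0 a (P k.+1) (n:=n k.+1)) (atom_weight_sum hborel a (P k.+1) (n k.+1))
    (3 * 2^-1 ^+ k) (2^-1 ^+ k) (h0 k).
    have := pf k f fl; have := pf k.+1 f fl; have := PC k f fl; rewrite exprS.
    rewrite !ler_norml => /andP[h1 h2] /andP[h3 h4] /andP[h5 h6].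
    by have := h0 k; lra.
  by exists g; split=> //; apply: le_trans gD _; lra.
pose g k := projT1 (cid (gE k)).
have gP k : [/\ forall i j, 0 <= g k i j, forall i, \sum_j g k i j = p k i,
      forall j, \sum_i g k i j = p k.+1 j &
      \sum_i \sum_j g k i j * mdist (a i) (a j) <= 4 * 2^-1 ^+ k] := projT2 (cid (gE k)).
have [L Latom] := uniform01 R.
pose law k (Z : measurableTypeR R -> 'I_(n k).+1) :=
  (forall i, measurable (Z @^-1` [set i])) /\
  (forall i, L (Z @^-1` [set i]) = (p k i)%:E).
have stepE k : exists S : (measurableTypeR R -> 'I_(n k).+1) -> (measurableTypeR R -> 'I_(n k.+1).+1),
    forall Z, law k Z -> law k.+1 (S Z) /\
      \int[L]_x mdist (a (Z x)) (a (S Z x)) <= 4 * 2^-1 ^+ k.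
  suff /choice[S SP] : forall Z, exists Z' : measurableTypeR R -> 'I_(n k.+1).+1,
      law k Z -> law k.+1 Z' /\
      \int[L]_x mdist (a (Z x)) (a (Z' x)) <= 4 * 2^-1 ^+ k by exists S.
  move=> Z.
  have [lawZ|nlaw] := pselect (law k Z); last by exists (fun=> ord0) => /nlaw.
  have [mZ LZ] := lawZ; have [g0 gp gq gD] := gP k.
  have [||l [ml Ll]] := couple_step Latom g0 _ mZ; first by rewrite card_ord.
    by move=> i; rewrite gp.
  exists l => _; split; last by rewrite (couple_cost (fun (i : 'I_(n k).+1) (j : 'I_(n k.+1).+1) => mdist (a i) (a j)) mZ ml Ll).
  by split => // j; rewrite (couple_law j mZ ml Ll) gq.
pose S k := projT1 (cid (stepE k)).
have SP k : forall Z, law k Z -> law k.+1 (S k Z) /\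
      \int[L]_x mdist (a (Z x)) (a (S k Z x)) <= 4 * 2^-1 ^+ k := projT2 (cid (stepE k)).
have [Z0 [mZ0 LZ0]] : exists Z, law 0%N Z.
  have [||||Z [mZ LZ]] := @couple_step R _ _ L Latom unit 'I_(n 0%N).+1 (fun=> tt) (fun=> p 0%N).
  - by move=> _ i; exact: atom_weight_ge0.
  - by rewrite card_ord.
  - move=> [].
    by rewrite (_ : _ @^-1` _ = setT)//; apply/seteqP; split.
  - move=> []; rewrite (_ : _ @^-1` _ = setT); last by apply/seteqP; split.
    by rewrite probability_setT (atom_weight_sum hborel a (P 0%N) (n 0%N)).
  exists Z; split=> // i; rewrite -(LZ tt i); congr (L _).
  by apply/seteqP; split => x // [].
pose Z := nat_rect (fun k => measurableTypeR R -> 'I_(n k).+1) Z0 S.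
have ZS k : Z k.+1 = S k (Z k) by [].
have Zlaw k : law k (Z k) by elim: k => //= k IH; have [] := SP k _ IH.
have Zcost k : \int[L]_x mdist (a (Z k x)) (a (Z k.+1 x)) <= 4 * 2^-1 ^+ k.
  by rewrite ZS; have [] := SP k _ (Zlaw k).
have mcomp dT (T : measurableType dT) k (F : 'I_(n k).+1 -> T) :
    measurable_fun setT (fun x => F (Z k x)).
  move=> _ A mA; rewrite setTI.
  rewrite (_ : _ @^-1` _ = \bigcup_(i in [set i | A (F i)]) (Z k @^-1` [set i])).
    by apply: fin_bigcup_measurable => // i _; exact: (Zlaw k).1.
  apply/seteqP; split => [x Ax|x [i /= Ai Zi]]; first by exists (Z k x).
  by rewrite /= Zi.
have [|||pi piP] := @limit_law R dE E hborel mdist_le1 _ _ L (fun k x => a (Z k x)) 4.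
- by move=> k; exact: (mcomp _ _ k (fun i : 'I_(n k).+1 => a i)).
- move=> k; have := measurable_mdist hborel hsep.
  move=> /(@measurableT_comp _ _ _ _ _ _ _ _ (fun x => (a (Z k x), a (Z k.+1 x)))); apply.
  by apply: measurable_fun_pair; [exact: (mcomp _ _ k (fun i : 'I_(n k).+1 => a i))|exact: (mcomp _ _ k.+1 (fun i : 'I_(n k.+1).+1 => a i))].
- exact: Zcost.
exists pi => f fl; have := piP f fl.
have ZE k : \int[L]_x f (a (Z k x)) = \sum_i p k i * f (a i).
  rewrite (Rintegral_finite_range L (k := Z k) (fun i => f (a i)) (Zlaw k).1).
  apply: eq_bigr => i _; congr (_ * _).
  by have := (Zlaw k).2 i => /(congr1 fine).
under eq_fun do rewrite ZE.
move=> h; have h2 : (fun k => \int[P k]_x f x - \sum_i p k i * f (a i)) @ \oo --> (0 : R).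
  apply/cvgrPdist_le => e e0.
  have : (2^-1 : R) ^+ k @[k --> \oo] --> (0 : R).
    by apply: cvg_expr; rewrite ger0_norm ?invr_ge0// invf_lt1// ltr1n.
  move=> /cvgrPdist_le/(_ _ e0)[M _ hM]; exists M => // k /hM.
  rewrite /= !sub0r !normrN => h3; apply: (le_trans (pf k f fl)).
  exact: le_trans (ler_norm _) h3.
have h3 := cvgD h2 h; rewrite add0r in h3.
suff -> : (fun k => \int[P k]_x f x) =
  (fun k => \int[P k]_x f x - \sum_i p k i * f (a i)) \+ (fun k => \sum_i p k i * f (a i)) by exact: h3.
by apply/funext => k /=; rewrite subrK.
Qed.

End completeness.

(** * Rate functions, the primitive Hphi and its Euler scheme *)

Section rate_functions.
Context (R : realType) (phi : R -> R).
Hypothesis hphi : rate_function phi.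

Let pos (x : R) : 0 <= x -> x \in `[0, +oo[.
Proof. by rewrite in_itv/= andbT. Qed.

Lemma rate_mono x y : 0 <= x -> x <= y -> phi x <= phi y.
Proof.
move=> x0 xy; apply: (rate_increasing hphi) => //; apply: pos => //.
exact: le_trans xy.
Qed.

Lemma rate_conc t x y : 0 <= t <= 1 -> 0 <= x -> 0 <= y ->
  t * phi x + (1 - t) * phi y <= phi (t * x + (1 - t) * y).
Proof.
move=> /andP[t0 t1] x0 y0.
have := @rate_concave _ _ hphi (Itv01 t0 t1) x y.
rewrite !inE/= => /(_ (pos x0) (pos y0)).
rewrite convRE /= -[conv _ _ _]/(t * x + (1 - t) * y) /unstable.onem; lra.
Qed.

Lemma rate_scale l x : 1 <= l -> 0 <= x -> phi (l * x) <= l * phi x.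
Proof.
move=> l1 x0; have l0 : 0 < l by lra.
have := @rate_conc l^-1 (l * x) 0; rewrite (rate0 hphi) !mulr0 !addr0 mulKf ?gt_eqF//.
have li : 0 <= l^-1 <= 1 by rewrite invr_ge0 (ltW l0) invf_le1.
have lx : 0 <= l * x by rewrite mulr_ge0// ltW.
by move=> /(_ li lx (lexx _)); rewrite ler_pdivrMl.
Qed.

Lemma rate_unbounded (M : R) : exists2 x, 1 <= x & M <= phi x.
Proof.
have /cvgryPge/(_ M) := rate_cvgy hphi.
move=> [A [_ HA]]; exists (Num.max 1 (A + 1)); first by rewrite le_max lexx.
by apply: HA; rewrite lt_max ltrDl ltr01 orbT.
Qed.

(** By concavity and phi 0 = 0 a zero at x > 0 would make phi vanish on
  [x, +oo[, where it is unbounded. *)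
Lemma rate_gt0 x : 0 < x -> 0 < phi x.
Proof.
move=> x0; rewrite lt_neqAle (rate_ge0 hphi) ?ltW// andbT eq_sym.
apply/eqP => px; have [y y1] := rate_unbounded 1.
have l1 : 1 <= 1 + y / x by rewrite lerDl divr_ge0// ?ltW//; lra.
have := rate_scale l1 (ltW x0); rewrite px mulr0.
have yx : y <= (1 + y / x) * x by rewrite mulrDl mul1r divfK ?gt_eqF//; lra.
have := @rate_mono y _ _ yx; lra.
Qed.

(** The slope phi x / x of the chord from the origin decreases. *)
Lemma rate_ratio x y : 0 < x -> x <= y -> phi y * x <= phi x * y.
Proof.
move=> x0 xy; have := @rate_scale (y / x) x; rewrite divfK ?gt_eqF//.
rewrite ler_pdivlMr// mul1r => /(_ xy (ltW x0)) h.
have : phi y * x <= y / x * phi x * x by rewrite ler_pM2r.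
by rewrite -mulrA (mulrC (phi x)) mulrA divfK ?gt_eqF// mulrC (mulrC y).
Qed.

Lemma rate_subadd x y : 0 <= x -> 0 <= y -> phi (x + y) <= phi x + phi y.
Proof.
move=> x0 y0; have [xz|xz] := eqVneq x 0; first by rewrite xz (rate0 hphi) !add0r.
have [yz|yz] := eqVneq y 0; first by rewrite yz (rate0 hphi) !addr0.
have xp : 0 < x by rewrite lt_neqAle eq_sym xz.
have yp : 0 < y by rewrite lt_neqAle eq_sym yz.
have h1 := @rate_ratio x (x + y) xp; have h2 := @rate_ratio y (x + y) yp.
have : phi (x + y) * (x + y) <= (phi x + phi y) * (x + y).
  by have := h1 _; have := h2 _; rewrite lerDl lerDr x0 y0 => /(_ isT) + /(_ isT); lra.
by rewrite ler_pM2r// addr_gt0.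
Qed.

Lemma rate_linear x : 0 <= x -> phi x <= phi 1 * (1 + x).
Proof.
move=> x0; have p1 := rate_gt0 ltr01; have [x1|/ltW x1] := leP x 1.
  by have := rate_mono x0 x1; nra.
by have := rate_ratio ltr01 x1; rewrite mulr1; nra.
Qed.

Lemma rate_cont0 e : 0 < e -> exists2 dl, 0 < dl & forall x, 0 <= x -> x <= dl -> phi x <= e.
Proof.
move=> e0; have [_] := rate_derivable hphi; rewrite (rate0 hphi).
move=> /cvgrPdist_le/(_ _ e0)[dl /= dl0 H]; exists (dl / 2); first by lra.
move=> x; rewrite le_eqVlt => /predU1P[<- _|x0 xd]; first by rewrite (rate0 hphi) ltW.
have h : `|0 - x| < dl by rewrite sub0r normrN gtr0_norm//; lra.
by have := H x h x0; rewrite sub0r normrN ger0_norm// (rate_ge0 hphi)// ltW.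
Qed.

(** Slopes of chords to the left of s dominate slopes of chords to its right;
    any number between them is a supergradient. *)
Lemma rate_supergradient s : 0 < s ->
  exists2 q, 0 <= q & forall x, 0 <= x -> phi x <= phi s + q * (x - s).
Proof.
move=> s0.
pose A := [set (phi s - phi x) / (s - x) | x in [set x | 0 <= x < s]].
have A0 : has_inf A.
  split; first by exists ((phi s - phi 0) / (s - 0)), 0; rewrite /= ?lexx.
  exists 0 => _ [x /andP[x0 xs] <-]; rewrite divr_ge0// subr_ge0; last exact: ltW.
  by apply: rate_mono => //; exact: ltW.
exists (inf A).
  apply: lb_le_inf; first exact: A0.1.
  move=> _ [x /andP[x0 xs] <-]; rewrite divr_ge0// subr_ge0; last exact: ltW.
  by apply: rate_mono => //; exact: ltW.
move=> x x0; have [->|xs] := eqVneq x s; first by rewrite subrr mulr0 addr0.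
have [xs'|xs'] := ltP x s.
  have : inf A <= (phi s - phi x) / (s - x).
    by apply: ge_inf; [exact: A0.2|exists x; rewrite /= ?x0].
  by rewrite ler_pdivlMr ?subr_gt0//; lra.
have {xs xs'}xs : s < x by rewrite lt_neqAle eq_sym xs.
have : (phi x - phi s) / (x - s) <= inf A.
  apply: lb_le_inf; first exact: A0.1.
  move=> _ [y /andP[y0 ys] <-].
  rewrite ler_pdivrMr ?subr_gt0// mulrAC ler_pdivlMr ?subr_gt0//.
  have xy : 0 < x - y by lra.
  have t01 : 0 <= (s - y) / (x - y) <= 1.
    by apply/andP; split; [apply: divr_ge0; lra|rewrite ler_pdivrMr//; lra].
  have := rate_conc t01 x0 y0.
  have -> : (s - y) / (x - y) * x + (1 - (s - y) / (x - y)) * y = s by field; lra.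
  rewrite -(ler_pM2r xy).
  have -> : ((s - y) / (x - y) * phi x + (1 - (s - y) / (x - y)) * phi y) * (x - y) =
    (s - y) * phi x + (x - s) * phi y by field; lra.
  lra.
by rewrite ler_pdivrMr ?subr_gt0//; lra.
Qed.

Lemma measurable_rate (d : measure_display) (T : measurableType d) (f : T -> R) :
  measurable_fun setT f -> (forall x, 0 <= f x) ->
  measurable_fun setT (fun x => phi (f x)).
Proof.
move=> mf f0; rewrite (_ : (fun x => _) = (fun y => phi (Num.max 0 y)) \o f).
  apply: measurableT_comp => //; apply: nondecreasing_measurable => // x y xy.
  by apply: rate_mono; rewrite ?ge_max !le_max lexx ?xy ?orbT.
by apply/funext => x /=; rewrite max_r.
Qed.

End rate_functions.

Section euler_iterates.
Context (R : realType) (phi : R -> R) (c : R).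
Hypotheses (hphi : rate_function phi) (c_gt0 : 0 < c).

(** One explicit Euler step for the equation s' = c phi(s), along whose
  solutions Hphi grows at the constant speed c. *)
Definition euler (s : R) : R := s + c * phi s.

Lemma euler_ge s : 0 <= s -> s <= euler s.
Proof. by move=> s0; rewrite lerDl mulr_ge0 ?(rate_ge0 hphi)// ltW. Qed.

Lemma iter_euler_ge k s : 0 <= s -> s <= iter k euler s.
Proof.
move=> s0; elim: k => //= k IH; apply: (le_trans IH); apply: euler_ge.
exact: le_trans IH.
Qed.

Lemma iter_euler_ge0 k s : 0 <= s -> 0 <= iter k euler s.
Proof. by move=> s0; apply: (le_trans s0); exact: iter_euler_ge. Qed.

Lemma iter_euler_mono k s t : 0 <= s -> s <= t -> iter k euler s <= iter k euler t.
Proof.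
move=> s0 st; elim: k => //= k IH; apply: lerD => //.
by rewrite ler_pM2l//; apply: rate_mono => //; exact: iter_euler_ge0.
Qed.

Lemma iter_euler_scale k l s : 1 <= l -> 0 <= s ->
  iter k euler (l * s) <= l * iter k euler s.
Proof.
move=> l1 s0; elim: k => //= k IH; have sk := iter_euler_ge0 k s0.
have ls : 0 <= l * s by rewrite mulr_ge0//; lra.
rewrite /euler mulrDr; apply: lerD => //; rewrite mulrCA ler_pM2l//.
apply: le_trans (rate_scale hphi l1 sk).
by apply: rate_mono => //; exact: iter_euler_ge0.
Qed.

(** The iterates are concave, as compositions of concave increasing functions;
  a supergradient is the form of concavity that integrates. *)
Lemma iter_euler_supergradient k s : 0 < s ->
  exists2 q, 0 <= q & forall x, 0 <= x ->
    iter k euler x <= iter k euler s + q * (x - s).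
Proof.
move=> s0; elim: k => [|k [q q0 IH]].
  by exists 1 => // x _ /=; rewrite mul1r addrC subrK.
have sk : 0 < iter k euler s by apply: (lt_le_trans s0); exact/iter_euler_ge/ltW.
have [p p0 H] := rate_supergradient hphi sk.
exists ((1 + c * p) * q) => [|x x0 /=]; first by rewrite mulr_ge0// addr_ge0// mulr_ge0// ltW.
have h1 := H _ (iter_euler_ge0 k x0); have h2 := IH x x0.
rewrite /euler; set a := iter k _ x in h1 h2 *; set b := iter k _ s in h1 h2 *.
move: (phi a) (phi b) h1 => u v h1.
have : c * u <= c * (v + p * (a - b)) by rewrite ler_pM2l.
have : (1 + c * p) * (a - b) <= (1 + c * p) * (q * (x - s)).
  by apply: ler_wpM2l; [rewrite addr_ge0// mulr_ge0// ltW|lra].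
by rewrite -!mulrA; lra.
Qed.

Lemma iter_euler_grow k s : 0 <= s -> s + k%:R * (c * phi s) <= iter k euler s.
Proof.
move=> s0; elim: k => [|k IH] /=; first by rewrite mul0r addr0.
rewrite -natr1 mulrDl mul1r addrA; apply: lerD => //.
by rewrite ler_pM2l//; apply: rate_mono => //; exact: iter_euler_ge.
Qed.

End euler_iterates.

Section primitive.
Context (R : realType) (phi : R -> R).
Hypothesis hphi : rate_function phi.

Lemma lebesgue_itv_fin (x y : R) b : ((@lebesgue_measure R) ([set` Interval (BSide b x) (BRight y)] : set R) < +oo)%E.
Proof.
by rewrite lebesgue_measure_itv/=; case: ifP; rewrite ?ltry.
Qed.

Lemma inv_rate_integrable y :
  (@lebesgue_measure R).-integrable `[1, y] (EFin \o (fun u => (phi u)^-1)).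
Proof.
apply: measurable_bounded_integrable => //.
- exact: lebesgue_itv_fin.
- apply: (eq_measurable_fun (fun u : R => (phi (Num.max 1 u))^-1)).
    by move=> u; rewrite inE/= in_itv/= => /andP[u1 _]; rewrite max_r.
  apply: nonincreasing_measurable => // u v uv.
  have m1 (w : R) : 0 < Num.max 1 w by rewrite lt_max ltr01.
  have pu := rate_gt0 hphi (m1 u); have pv := rate_gt0 hphi (m1 v).
  rewrite lef_pV2 ?posrE//; apply: (rate_mono hphi (ltW (m1 u))).
  by rewrite ge_max !le_max lexx uv orbT.
- exists (phi 1)^-1; split; first exact: num_real.
  move=> M hM u; rewrite /= in_itv/= => /andP[u1 _]; apply: (le_trans _ (ltW hM)).
  have u0 : 0 < phi u by apply: rate_gt0 => //; lra.
  have p1 := rate_gt0 hphi ltr01.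
  rewrite gtr0_norm ?invr_gt0// lef_pV2 ?posrE//.
  exact: (rate_mono hphi ler01).
Qed.

Lemma Hphi_diff x y : 1 <= x -> x <= y ->
  (y - x) / phi y <= Hphi phi y - Hphi phi x <= (y - x) / phi x.
Proof.
move=> x1 xy.
have iy := inv_rate_integrable y.
rewrite /Hphi Rintegral_itvB//; [|by rewrite bnd_simp..].
have sub : `]x, y]%classic `<=` (`[1, y]%classic : set R).
  by move=> u/=; rewrite !in_itv/= => /andP[xu ->]; rewrite andbT; lra.
have ixy : (@lebesgue_measure R).-integrable `]x, y] (EFin \o (fun u => (phi u)^-1)).
  by apply: integrableS iy.
have intc (r : R) : \int[@lebesgue_measure R]_(u in `]x, y]) r = (y - x) * r.
  rewrite Rintegral_cst//= lebesgue_measure_itv/= lte_fin; case: ltP => [|yx] /=.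
    by rewrite mulrC.
  by have -> : y = x by [lra]; rewrite subrr mulr0 mul0r.
have ci (r : R) : (@lebesgue_measure R).-integrable `]x, y] (EFin \o cst r).
  apply: measurable_bounded_integrable => //.
  - exact: lebesgue_itv_fin.
  - by exists `|r|; split; [exact: num_real|move=> M hM u _; exact: ltW].
have p u : 1 <= u -> 0 < phi u by move=> u1; apply: rate_gt0 => //; lra.
rewrite -!intc; apply/andP; split.
  apply: (le_Rintegral _ (ci _) ixy) => // u; rewrite /= in_itv/= => /andP[xu uy].
  rewrite lef_pV2 ?posrE ?p//; [|lra|lra].
  by apply: rate_mono => //; lra.
apply: (le_Rintegral _ ixy (ci _)) => // u; rewrite /= in_itv/= => /andP[xu uy].
rewrite lef_pV2 ?posrE ?p//; [|lra].
by apply: rate_mono => //; lra.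
Qed.

Lemma Hphi1 : Hphi phi 1 = 0.
Proof. by rewrite /Hphi set_itv1 Rintegral_set1. Qed.

Lemma Hphi_mono x y : 1 <= x -> x <= y -> Hphi phi x <= Hphi phi y.
Proof.
move=> x1 xy; have /andP[h _] := Hphi_diff x1 xy.
have py : 0 < phi y by apply: rate_gt0 => //; lra.
by rewrite -subr_ge0; apply: le_trans h; apply: divr_ge0; [lra|exact: ltW].
Qed.

Lemma Hphi_strict x y : 1 <= x -> x < y -> Hphi phi x < Hphi phi y.
Proof.
move=> x1 xy; have /andP[h _] := Hphi_diff x1 (ltW xy).
have py : 0 < phi y by apply: rate_gt0 => //; lra.
by rewrite -subr_gt0; apply: lt_le_trans h; apply: divr_gt0 => //; lra.
Qed.

(** One Euler step of the flow ds/dt = c phi(s) lasts a time bounded below,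
    uniformly in the starting point. *)
Lemma Hphi_euler c s : 0 < c -> 1 <= s ->
  c / (1 + c * phi 1) <= Hphi phi (euler phi c s) - Hphi phi s.
Proof.
move=> c0 s1; have s0 : 0 <= s by lra.
have ss := euler_ge hphi c0 s0.
have /andP[+ _] := Hphi_diff s1 ss; apply: le_trans.
have p1 := rate_gt0 hphi ltr01.
have ps : 0 < phi s by apply: rate_gt0 => //; lra.
have pe : 0 < phi (euler phi c s) by apply: rate_gt0 => //; lra.
have cp : 0 < 1 + c * phi 1 by rewrite addr_gt0// mulr_gt0.
rewrite ler_pdivlMr// mulrAC ler_pdivrMr//.
have -> : euler phi c s - s = c * phi s by rewrite /euler; lra.
rewrite -mulrA ler_pM2l//.
have s0' : 0 < s by lra.
have h1 := rate_ratio hphi s0' ss.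
have h2 := rate_ratio hphi ltr01 s1; rewrite mulr1 in h2.
rewrite -(ler_pM2r s0') (le_trans h1)// -mulrA ler_pM2l// /euler.
have : c * phi s <= c * (phi 1 * s) by rewrite ler_pM2l.
lra.
Qed.

Lemma Hphi_iter_euler c s k : 0 < c -> 1 <= s ->
  Hphi phi s + k%:R * (c / (1 + c * phi 1)) <= Hphi phi (iter k (euler phi c) s).
Proof.
move=> c0 s1; elim: k => [|k IH]; first by rewrite mul0r addr0.
have sk : 1 <= iter k (euler phi c) s.
  by apply: (le_trans s1); apply: iter_euler_ge => //; lra.
by have /= := Hphi_euler c0 sk; rewrite -natr1 mulrDl mul1r; lra.
Qed.

(** Hphi is continuous, and the Euler iterates of 1 show that it is unbounded;
  so it maps [1, +oo[ onto [0, +oo[. *)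
Lemma Hphi_invP y : 0 <= y -> 1 <= Hphi_inv phi y /\ Hphi phi (Hphi_inv phi y) = y.
Proof.
move=> y0.
have [x x1 Hx] : exists2 x, 1 <= x & Hphi phi x = y.
  have p1 := rate_gt0 hphi ltr01.
  pose e : R := 1 / (1 + 1 * phi 1).
  have e0 : 0 < e by rewrite divr_gt0//; lra.
  pose k := (Num.truncn (y / e)).+1.
  pose z := iter k (euler phi 1) 1.
  have z1 : 1 <= z by apply: iter_euler_ge.
  have Hz : y <= Hphi phi z.
    have := Hphi_iter_euler k ltr01 (lexx (1 : R)); rewrite Hphi1 add0r.
    apply: le_trans; rewrite -ler_pdivrMr//; apply: ltW; exact: truncnS_gt.
  pose G u := Hphi phi (Num.max 1 u).
  have Glip u v : u <= v -> 0 <= G v - G u <= (v - u) / phi 1.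
    move=> uv; have m1 : 1 <= Num.max 1 u by rewrite le_max lexx.
    have muv : Num.max 1 u <= Num.max 1 v by rewrite ge_max !le_max lexx uv orbT.
    rewrite subr_ge0 (Hphi_mono m1 muv)/=.
    have /andP[_ /le_trans] := Hphi_diff m1 muv; apply.
    have pm := rate_mono hphi ler01 m1.
    apply: ler_pM.
    - by rewrite subr_ge0.
    - by rewrite invr_ge0 ltW//; apply: lt_le_trans pm.
    - by move: muv; case: (leP 1 u); case: (leP 1 v); lra.
    - by rewrite lef_pV2 ?posrE//; apply: lt_le_trans pm.
  have cG : continuous G.
    move=> t; apply/cvgrPdist_le => d d0; near=> u.
    have tu : `|t - u| <= d * phi 1 by near: u; apply: cvgr_dist_le => //; exact: mulr_gt0.
    have [h|/ltW h] := leP t u; have /andP[h1 h2] := Glip _ _ h;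
      rewrite ler_pdivlMr// in h2.
      rewrite distrC ger0_norm// -(ler_pM2r p1); apply: le_trans h2 _.
      by apply: le_trans tu; rewrite distrC; exact: ler_norm.
    rewrite ger0_norm// -(ler_pM2r p1); apply: le_trans h2 _.
    by apply: le_trans tu; exact: ler_norm.
  have [x + Gx] : exists2 x, x \in `[1, z] & G x = y.
    apply: IVT => //; first exact: continuous_subspaceT.
    have -> : G 1 = 0 by rewrite /G max_r// Hphi1.
    have -> : G z = Hphi phi z by rewrite /G max_r.
    by rewrite min_l ?max_r ?y0//; exact: le_trans Hz.
  rewrite in_itv/= => /andP[x1 _]; exists x => //.
  by rewrite -Gx /G max_r.
have HD : y \in Hphi phi @` `[1, +oo[%classic.
  by rewrite inE; exists x => //; rewrite /= in_itv/= x1.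
split; last by rewrite /Hphi_inv pinvK.
have : (`[1, +oo[%classic : set R) (Hphi_inv phi y).
  have sj : set_surj `[1, +oo[%classic (Hphi phi @` `[1, +oo[%classic) (Hphi phi).
    by [].
  have im := surjpinv_image_sub (dflt := fun=> 1) sj.
  by apply: im; exists y => //; exact: set_mem HD.
by rewrite /= in_itv/= andbT.
Unshelve. all: by end_near. Qed.

Lemma Hphi_inv_le y z : 0 <= y -> 1 <= z -> y <= Hphi phi z -> Hphi_inv phi y <= z.
Proof.
move=> y0 z1 yz; have [i1 Hi] := Hphi_invP y0.
rewrite leNgt; apply/negP => /(Hphi_strict z1); rewrite Hi ltNge => /negP; exact.
Qed.

End primitive.

(** * Kernels acting on laws *)

Section mixtures.
Context d1 d2 (T1 : measurableType d1) (T2 : measurableType d2) (R : realType).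
Variables (k : T1 -> probability T2 R).
Hypothesis mk : forall A, measurable A -> measurable_fun setT (fun x => k x A).

Lemma measurable_kernel_integral (f : T2 -> \bar R) :
  measurable_fun setT f -> (forall y, 0 <= f y)%E ->
  measurable_fun setT (fun x => \int[k x]_y f y)%E.
Proof.
move=> mf f0.
exact: (@measurable_fun_integral_kernel _ _ T1 T2 R (fun x => k x) mk f f0 mf).
Qed.

Lemma measurable_kernel_Rintegral (f : T2 -> R) :
  measurable_fun setT f -> (forall y, 0 <= f y) ->
  measurable_fun setT (fun x => \int[k x]_y f y).
Proof.
move=> mf f0; apply: (measurableT_comp (f := fine)) => //.
by apply: (measurable_kernel_integral (f := EFin \o f)) => //; exact/measurable_EFinP.
Qed.

Lemma mixture (mu : probability T1 R) : exists nu : probability T2 R,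
  (forall A, measurable A -> nu A = \int[mu]_x k x A)%E /\
  (forall f : T2 -> \bar R, measurable_fun setT f -> (forall y, 0 <= f y)%E ->
     \int[nu]_y f y = \int[mu]_x \int[k x]_y f y)%E.
Proof.
have mf : measurable_fun setT (fun x => k x : giry T2 R).
  by apply: measurable_giry_codensity => // B mB; exact: mk.
pose m := giry_bind (mu : giry T1 R) mf.
have mE : forall f : T2 -> \bar R, measurable_fun setT f -> (forall y, 0 <= f y)%E ->
     (\int[m]_y f y = \int[mu]_x \int[k x]_y f y)%E.
  by move=> f f_m f0; exact: giry_int_bind.
have mA A : measurable A -> (m A = \int[mu]_x k x A)%E.
  move=> mA; transitivity (\int[m]_y (\1_A y)%:E)%E; first by rewrite integral_indic// setIT.
  have mi : measurable_fun setT (fun y => (\1_A y : R)%:E) by exact/measurable_EFinP.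
  have i0 y : (0 <= (\1_A y : R)%:E)%E by rewrite lee_fin.
  rewrite (mE _ mi i0).
  by apply: eq_integral => x _; rewrite integral_indic// setIT.
have m1 : m setT = 1%E.
  rewrite mA//; under eq_integral do rewrite measure_prob_setT.
  by rewrite integral_cst// mul1e measure_prob_setT.
have [nu nuE] := measure1_probability m1.
exists nu; split=> [A A_m|f f_m f0]; first by rewrite nuE; exact: mA.
by rewrite -mE//; apply: eq_measure_integral => A A_m _; exact: nuE.
Qed.

End mixtures.

(** * Contraction of a weighted distance *)

Section weighted_contraction.
Context (R : realType) (dE : measure_display) (E : measurableCompleteMetricType dE R).
Hypotheses (hborel : is_borel E) (hsep : separable E).
Hypothesis mdist_le1 : forall x y : E, mdist x y <= 1.
Implicit Types (mu nu : probability E R) (f W : E -> R).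

Lemma wasserstein_adherent mu nu (D D' : R) :
  (wasserstein mu nu <= D%:E)%E -> D < D' ->
  exists2 la : probability (E * E)%type R, couplings mu nu la &
    \int[la]_z mdist z.1 z.2 <= D'.
Proof.
move=> WD DD'; have : (wasserstein mu nu < D'%:E)%E.
  by apply: le_lt_trans WD _; rewrite lte_fin.
move=> /ereal_inf_lt[_ [la cl <-] lD]; exists la => //.
rewrite -lee_fin EFin_Rintegral ?ltW//.
apply: (@integrable_bounded _ _ _ la _ 1); first exact: measurable_mdist.
by move=> z; rewrite ger0_norm ?mdist_ge0.
Qed.

Lemma young_powR al (a b : R) : 0 < al < 1 -> 0 <= a -> 0 <= b ->
  a `^ al * b `^ (1 - al) <= al * a + (1 - al) * b.
Proof.
move=> /andP[al0 al1] a0 b0; have bl0 : 0 < 1 - al by lra.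
have := @conjugate_powR R (a `^ al) (b `^ (1 - al)) al^-1 (1 - al)^-1.
rewrite -!powRrM !mulfV ?gt_eqF// !powRr1// !invrK (mulrC a) (mulrC b).
by apply; rewrite ?powR_ge0 ?invr_gt0// addrC subrK.
Qed.

(** The function d ^ al * G ^ (1 - al) is replaced by an affine upper bound,
  which Young's inequality and the supergradient of G at s provide and which is
  exact at d = D, W u + W v = s - A. Of an affine bound only the expectations of d
  and of W enter. *)
Lemma coupling_cost_le mu nu f W (al D s A L : R) (G : R -> R) :
  0 < al < 1 -> 0 < D -> 0 < L -> L = G s ->
  (exists2 q, 0 <= q & forall x, 0 <= x -> G x <= G s + q * (x - s)) ->
  (forall x, 0 <= x -> 0 <= G x) ->
  lip01 f -> measurable_fun setT W -> (forall x, 0 <= W x) -> 0 <= A ->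
  mu.-integrable setT (EFin \o W) -> nu.-integrable setT (EFin \o W) ->
  (forall u v, f u - f v <= (mdist u v) `^ al * G (A + (W u + W v)) `^ (1 - al)) ->
  A + (\int[mu]_x W x + \int[nu]_x W x) <= s ->
  forall la, couplings mu nu la -> \int[la]_z mdist z.1 z.2 <= D ->
  \int[mu]_x f x - \int[nu]_x f x <= D `^ al * L `^ (1 - al).
Proof.
move=> al01 D0 L0 LG [q q0 Gq] G0 fl mW W0 A0 imW inW fG As la cl laD.
have /andP[al0 al1] := al01.
pose C := D `^ al * L `^ (1 - al).
have C0 : 0 < C by rewrite mulr_gt0// powR_gt0.
have pw u v : f u - f v <= C * (1 - (1 - al) * q * (s - A) / L) - C * al
    + (C * al / D) * mdist u v + (C * (1 - al) * q / L) * (W u + W v).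
  apply: (le_trans (fG u v)).
  have d0 : 0 <= (mdist u v : R) by exact: mdist_ge0.
  set S := A + (W u + W v).
  have S0 : 0 <= S by rewrite !addr_ge0.
  have GS := Gq S S0.
  have -> : (mdist u v : R) `^ al * G S `^ (1 - al) =
     C * ((mdist u v / D) `^ al * (G S / L) `^ (1 - al)).
    have e1 : (mdist u v : R) `^ al = D `^ al * (mdist u v / D) `^ al.
      by rewrite -powRM ?divr_ge0 ?(ltW D0)// mulrC divfK// gt_eqF.
    have e2 : G S `^ (1 - al) = L `^ (1 - al) * (G S / L) `^ (1 - al).
      by rewrite -powRM ?divr_ge0 ?(ltW L0)//; [rewrite mulrC divfK// gt_eqF|exact: G0].
    by rewrite e1 e2 /C; ring.
  apply: (@le_trans _ _ (C * (al * (mdist u v / D) + (1 - al) * (1 + q * (S - s) / L)))).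
    rewrite ler_pM2l// (le_trans (young_powR al01 _ _)) ?divr_ge0 ?(ltW D0) ?(ltW L0)//.
      exact: G0.
    rewrite lerD2l ler_pM2l; last by lra.
    rewrite ler_pdivrMr// mulrDl mul1r divfK ?gt_eqF//.
    by rewrite LG.
  by rewrite le_eqVlt; apply/orP; left; apply/eqP; rewrite /S; field; rewrite !gt_eqF.
have bf g (P : probability (E * E)%type R) (h : E * E -> R) : measurable_fun setT h ->
    (forall z, 0 <= h z <= g) -> P.-integrable setT (EFin \o h).
  move=> mh hg; apply: (@integrable_bounded _ _ _ P h g) => // z.
  by have /andP[h0 h1] := hg z; rewrite ger0_norm.
have fm := lip01_measurable hborel fl.
have [_ f01] := fl.
have i1 : la.-integrable setT (EFin \o (fun z => f z.1)).
  by apply: (bf 1) => [|z]; [exact: (measurableT_comp (f := f))|exact: f01].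
have i2 : la.-integrable setT (EFin \o (fun z => f z.2)).
  by apply: (bf 1) => [|z]; [exact: (measurableT_comp (f := f))|exact: f01].
have i3 : la.-integrable setT (EFin \o (fun z => mdist z.1 z.2)).
  apply: (bf 1) => [|z]; first exact: measurable_mdist.
  by rewrite mdist_ge0 mdist_le1.
have eW : measurable_fun setT (EFin \o W) by exact/measurable_EFinP.
have eW0 x : (0 <= (EFin \o W) x)%E by rewrite lee_fin.
have i4 : la.-integrable setT (EFin \o (fun z => W z.1)).
  apply/integrableP; split.
    by apply/measurable_EFinP; exact: (measurableT_comp (f := W)).
  have /integrableP[_ h] := imW.
  rewrite (eq_integral (fun z => (EFin \o W) z.1)) => [|z _]; last by rewrite gee0_abs ?lee_fin.
  rewrite (coupling_fst cl eW eW0); move: h.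
  by rewrite (eq_integral (EFin \o W)) => // x _; rewrite gee0_abs ?lee_fin.
have i5 : la.-integrable setT (EFin \o (fun z => W z.2)).
  apply/integrableP; split.
    by apply/measurable_EFinP; exact: (measurableT_comp (f := W)).
  have /integrableP[_ h] := inW.
  rewrite (eq_integral (fun z => (EFin \o W) z.2)) => [|z _]; last by rewrite gee0_abs ?lee_fin.
  rewrite (coupling_snd cl eW eW0); move: h.
  by rewrite (eq_integral (EFin \o W)) => // x _; rewrite gee0_abs ?lee_fin.
have f0 x : 0 <= f x by have /andP[] := f01 x.
rewrite -(Rcoupling_fst cl fm f0) -(Rcoupling_snd cl fm f0) -RintegralB//.
set k0 := C * (1 - _) in pw; set k1 := C * al / D in pw; set k2 := C * (1 - al) * q / L in pw.
have ci (r : R) : la.-integrable setT (EFin \o cst r).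
  exact: (@integrable_bounded _ _ _ la (cst r) `|r|).
have ik (r : R) (h : E * E -> R) : la.-integrable setT (EFin \o h) ->
    la.-integrable setT (EFin \o (fun z => r * h z)).
  move=> ih; have -> : EFin \o (fun z => r * h z) = (fun z => r%:E * (h z)%:E)%E by [].
  exact: integrableZl.
have iD (h1 h2 : E * E -> R) : la.-integrable setT (EFin \o h1) ->
    la.-integrable setT (EFin \o h2) ->
    la.-integrable setT (EFin \o (fun z => h1 z + h2 z)).
  by move=> ih1 ih2; exact: (integrableD measurableT ih1 ih2).
have iWW := iD _ _ i4 i5.
have iA := iD _ _ (ci (k0 - C * al)) (ik k1 _ i3).
have iB := iD _ _ iA (ik k2 _ iWW).
have iff : la.-integrable setT (EFin \o (fun z => f z.1 - f z.2)).
  exact: (integrableB measurableT i1 i2).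
apply: (@le_trans _ _ (\int[la]_z ((k0 - C * al) + k1 * mdist z.1 z.2 + k2 * (W z.1 + W z.2)))).
  apply: (le_Rintegral measurableT iff iB) => z _; exact: pw.
rewrite RintegralD//; last exact: ik.
rewrite RintegralD//; last exact: ik.
rewrite Rintegral_cst1 RintegralZl// RintegralZl// RintegralD//.
rewrite (Rcoupling_fst cl mW W0) (Rcoupling_snd cl mW W0).
have k1D : k1 * \int[la]_z mdist z.1 z.2 <= C * al.
  have -> : C * al = k1 * D by rewrite /k1 divfK ?gt_eqF.
  apply: ler_wpM2l => //; apply: divr_ge0; last exact: ltW.
  by apply: mulr_ge0; exact: ltW.
have bl0 : 0 <= 1 - al by lra.
have k20 : 0 <= k2.
  apply: divr_ge0; last exact: ltW.
  by apply: mulr_ge0 => //; apply: mulr_ge0 => //; exact: ltW.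
have h2 : k2 * (\int[mu]_x W x + \int[nu]_x W x) <= k2 * (s - A).
  by apply: ler_wpM2l => //; rewrite lerBrDl.
have h3 : k2 * (s - A) + k0 = C.
  by rewrite /k2 /k0; field; rewrite gt_eqF.
apply: (le_trans (lerD (lerD (lexx _) k1D) h2)).
by rewrite subrK addrC h3.
exact: ci.
Qed.

End weighted_contraction.

(** There are couplings of cost D * (1 + eta) for each eta > 0. *)
Section dual_contraction.
Context (R : realType) (dE : measure_display) (E : measurableCompleteMetricType dE R).
Hypotheses (hborel : is_borel E) (hsep : separable E).
Hypothesis mdist_le1 : forall x y : E, mdist x y <= 1.
Implicit Types (mu nu : probability E R) (f W : E -> R).

Lemma wasserstein_dual_le mu nu f (D : R) : lip01 f ->
  (wasserstein mu nu <= D%:E)%E -> \int[mu]_x f x - \int[nu]_x f x <= D.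
Proof.
move=> fl WD; apply/ler_addgt0Pr => e e0.
have De : D < D + e by rewrite ltrDl.
have [la cl laD] := wasserstein_adherent hborel hsep mdist_le1 WD De.
apply: le_trans laD.
have fm := lip01_measurable hborel fl.
have [fl1 f01] := fl.
have f0 x : 0 <= f x by have /andP[] := f01 x.
have bf (h : E * E -> R) : measurable_fun setT h ->
    (forall z, 0 <= h z <= 1) -> la.-integrable setT (EFin \o h).
  move=> mh hg; apply: (@integrable_bounded _ _ _ la h 1) => // z.
  by have /andP[h0 h1] := hg z; rewrite ger0_norm.
have i1 : la.-integrable setT (EFin \o (fun z => f z.1)).
  by apply: bf => [|z]; [exact: (measurableT_comp (f := f))|exact: f01].
have i2 : la.-integrable setT (EFin \o (fun z => f z.2)).
  by apply: bf => [|z]; [exact: (measurableT_comp (f := f))|exact: f01].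
have i3 : la.-integrable setT (EFin \o (fun z => mdist z.1 z.2)).
  apply: bf => [|z]; first exact: measurable_mdist.
  by rewrite mdist_ge0 mdist_le1.
rewrite -(Rcoupling_fst cl fm f0) -(Rcoupling_snd cl fm f0) -RintegralB//.
apply: (le_Rintegral measurableT _ i3) => [|z _]; last exact: fl1.
exact: (integrableB measurableT i1 i2).
Qed.

Lemma dual_contraction mu nu f W (al D s A L : R) (G : R -> R) :
  0 < al < 1 -> 0 < D -> 0 < L -> L = G s ->
  (exists2 q, 0 <= q & forall x, 0 <= x -> G x <= G s + q * (x - s)) ->
  (forall x, 0 <= x -> 0 <= G x) ->
  lip01 f -> measurable_fun setT W -> (forall x, 0 <= W x) -> 0 <= A ->
  mu.-integrable setT (EFin \o W) -> nu.-integrable setT (EFin \o W) ->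
  (forall u v, f u - f v <= (mdist u v) `^ al * G (A + (W u + W v)) `^ (1 - al)) ->
  A + (\int[mu]_x W x + \int[nu]_x W x) <= s ->
  (wasserstein mu nu <= D%:E)%E ->
  \int[mu]_x f x - \int[nu]_x f x <= D `^ al * L `^ (1 - al).
Proof.
move=> al01 D0 L0 LG Gq G0 fl mW W0 A0 imW inW fG As WD.
have /andP[al0 al1] := al01.
set Y := D `^ al * L `^ (1 - al).
have Y0 : 0 < Y by rewrite mulr_gt0// powR_gt0.
apply/ler_addgt0Pr => e e0.
pose eta := e / Y; have eta0 : 0 < eta by rewrite divr_gt0.
have e1 : 1 <= 1 + eta by lra.
have D'0 : 0 < D * (1 + eta) by rewrite mulr_gt0//; lra.
have DD' : D < D * (1 + eta) by rewrite ltr_pMr// ltrDl.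
have [la cl laD] := wasserstein_adherent hborel hsep mdist_le1 WD DD'.
have := coupling_cost_le hborel hsep mdist_le1 al01 D'0 L0 LG Gq G0 fl mW W0 A0 imW inW fG As cl laD.
move/le_trans; apply; rewrite powRM ?(ltW D0)//; last by lra.
have : (1 + eta) `^ al <= 1 + eta by apply: ler1_powR => //; lra.
move: ((1 + eta) `^ al) => w wl.
have -> : D `^ al * w * L `^ (1 - al) = Y * w by rewrite /Y; ring.
have -> : Y + e = Y * (1 + eta) by rewrite /eta; field; rewrite gt_eqF.
by rewrite ler_pM2l.
Qed.

End dual_contraction.

(** For N iterates in the numerator and in the denominator, the bound at n = 0
  is weaker than the Lipschitz bound of f. Each application of the transition
  uses up one iterate in the numerator; after N applications none is left. *)
Section mixing.
Context (R : realType) (dE : measure_display) (E : measurableCompleteMetricType dE R).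
Hypotheses (hborel : is_borel E) (hsep : separable E).
Hypothesis mdist_le1 : forall x y : E, mdist x y <= 1.
Variables (phi : R -> R) (P : E -> probability E R) (W : E -> R) (a K : R).
Hypotheses (hphi : rate_function phi) (mW : measurable_fun setT W).
Hypotheses (W_ge0 : forall x, 0 <= W x) (a_gt0 : 0 < a) (K_ge0 : 0 <= K).
Hypothesis intW : forall x, (P x).-integrable setT (EFin \o W).
Hypothesis drift : forall x, \int[P x]_y W y <= W x - a * phi (W x) + K.
Hypothesis nonexp : forall x y, (wasserstein (P x) (P y) <= (mdist x y)%:E)%E.
Hypothesis contr : forall r, 0 < r -> exists2 rho : R, 0 < rho &
  forall x y, W x + W y <= r -> (wasserstein (P x) (P y) <= ((1 - rho) * mdist x y)%:E)%E.

Definition transition (f : E -> R) (x : E) : R := \int[P x]_y f y.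

Lemma transition_lip01 f : lip01 f -> lip01 (transition f).
Proof.
move=> fl; split=> [x y|x].
  exact: (wasserstein_dual_le hborel hsep mdist_le1 fl (nonexp x y)).
by apply: Rintegral_bounded; [exact: lip01_measurable|exact: fl.2].
Qed.

Lemma iter_transition_lip01 n f : lip01 f -> lip01 (iter n transition f).
Proof. by move=> fl; elim: n => //= n IH; exact: transition_lip01. Qed.

(** The contraction factor of a single step, bounded away from 0 so that it can
    be raised to a negative power. *)
Lemma contraction_factor r : 0 < r -> exists2 th : R, 0 < th < 1 &
  forall x y, W x + W y <= r -> (wasserstein (P x) (P y) <= (th * mdist x y)%:E)%E.
Proof.
move=> r0; have [rho rho0 H] := contr r0.
exists (1 - Num.min rho (1 / 2)).
  have : 0 < Num.min rho (1 / 2) by rewrite lt_min rho0/=; lra.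
  have : Num.min rho (1 / 2) <= 1 / 2 by rewrite ge_min lexx orbT.
  by move=> h1 h2; apply/andP; split; lra.
move=> x y /H/le_trans; apply; rewrite lee_fin; apply: ler_wpM2r; first exact: mdist_ge0.
by have : Num.min rho (1 / 2) <= rho by [rewrite ge_min lexx]; lra.
Qed.

Lemma sum_drift x y : \int[P x]_z W z + \int[P y]_z W z <=
  (W x + W y) - a * phi (W x + W y) + 2 * K.
Proof.
have h1 := drift x; have h2 := drift y.
have : a * phi (W x + W y) <= a * (phi (W x) + phi (W y)).
  by rewrite ler_pM2l//; exact: rate_subadd.
lra.
Qed.

Variables (al : R).
Hypothesis al01 : 0 < al < 1.

(** The parameters: beyond the level r the drift of W x + W y is negative; the
    shift A makes the error 2 K at low levels relatively so small that the
    contraction of the distance pays for it; the speed c of the clock is then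
    slow enough for the drift beyond r to pay for it. *)
Lemma mixing_step : exists c A : R, [/\ 0 < c, 1 <= A, euler phi c 1 <= A &
  forall (k : nat) (z : R) f, 0 < z -> lip01 f ->
    (forall u v, f u - f v <= (mdist u v) `^ al *
       (iter k.+1 (euler phi c) (A + (W u + W v)) / z) `^ (1 - al)) ->
    forall x y, transition f x - transition f y <= (mdist x y) `^ al *
       (iter k (euler phi c) (A + (W x + W y)) / z) `^ (1 - al)].
Proof.
have /andP[al0 al1] := al01.
have p1 : 0 < phi 1 by exact: rate_gt0.
have [r r1 rK] := rate_unbounded hphi (4 * K / a).
have r0 : 0 < r by lra.
have [th th01 Hth] := contraction_factor r0.
have /andP[th0 th1] := th01.
pose eta := th `^ (- al) - 1.
have eta0 : 0 < eta.
  rewrite subr_gt0 powRN invf_gt1 ?powR_gt0//.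
  have := @gt0_ltr_powR R al al0 th 1; rewrite !nnegrE powR1 ltW// ler01 => /(_ isT isT); exact.
pose A1 := a * phi 1 + 2 * K.
have A10 : 0 < A1 by rewrite ltr_pwDl// ?mulr_gt0// mulr_ge0.
pose A := 1 + A1 + 3 * A1 / eta.
have eA : 0 < 3 * A1 / eta by rewrite divr_gt0// mulr_gt0.
have A_ge1 : 1 <= A by rewrite /A; lra.
pose c := a / (2 * (1 + A)).
have A2 : 0 < 2 * (1 + A) by lra.
have c0 : 0 < c by rewrite divr_gt0.
have cp : c * phi 1 <= A1 / A.
  rewrite /c ler_pdivlMr; last by lra.
  have -> : a / (2 * (1 + A)) * phi 1 * A = (a * phi 1) * (A / (2 * (1 + A))) by field; lra.
  have : A / (2 * (1 + A)) <= 1 by rewrite ler_pdivrMr//; lra.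
  have ap : 0 < a * phi 1 by rewrite mulr_gt0.
  move=> h; apply: (@le_trans _ _ (a * phi 1)); last by rewrite /A1 lerDl mulr_ge0.
  by rewrite ler_piMr// ltW.
have A1A : A1 / A <= 1 by rewrite ler_pdivrMr; rewrite /A; lra.
have A1A0 : 0 < A1 / A by rewrite divr_gt0//; lra.
(* Adding 2 K and one Euler step to a number S >= A multiplies it by at most
   be = (1 + c * phi 1) * (1 + 2 * K / A). *)
have beta_le : (1 + c * phi 1) * (1 + 2 * K / A) <= th `^ (- al).
  have KA : 2 * K / A <= A1 / A.
    rewrite ler_pM2r ?invr_gt0; last by lra.
    by rewrite /A1 lerDr ltW// mulr_gt0.
  have KA0 : 0 <= 2 * K / A by rewrite divr_ge0 ?mulr_ge0//; lra.
  have cp0 : 0 < c * phi 1 by rewrite mulr_gt0.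
  have : 3 * (A1 / A) <= eta.
    rewrite mulrA ler_pdivrMr; last by lra.
    by rewrite [leRHS]mulrC -ler_pdivrMr// /A; lra.
  by rewrite /eta; nra.
exists c, A; split=> //.
  have : A1 / A <= A1 by rewrite ler_pdivrMr ?ler_peMr ?(ltW A10)//; lra.
  by rewrite /euler; move: (A1 / A) cp => t cp tA; rewrite /A; lra.
move=> k z f z0 fl fG x y.
have [xy|xy] := eqVneq x y.
  rewrite xy subrr mulr_ge0// powR_ge0//.
have d0 : 0 < (mdist x y : R) by rewrite mdist_gt0.
set S0 := W x + W y; set S := A + S0.
have S00 : 0 <= S0 by rewrite addr_ge0.
pose G s := iter k.+1 (euler phi c) s / z.
have zi : 0 < z^-1 by rewrite invr_gt0.
have G0 s : 0 <= s -> 0 <= G s.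
  by move=> s0; rewrite mulr_ge0 ?(ltW zi)//; exact: iter_euler_ge0.
have Ggt0 s : 0 < s -> 0 < G s.
  move=> s0; rewrite mulr_gt0//; apply: (lt_le_trans s0).
  by apply: iter_euler_ge => //; exact: ltW.
have Gq s : 0 < s -> exists2 q, 0 <= q & forall t, 0 <= t -> G t <= G s + q * (t - s).
  move=> s0; have [q q0 H] := iter_euler_supergradient hphi c0 k.+1 s0.
  exists (q / z); first by rewrite mulr_ge0// ltW.
  move=> t t0; rewrite /G mulrAC -mulrDl ler_pM2r//; exact: H.
have A0 : 0 <= A by lra.
have PS := sum_drift x y; rewrite -/S0 in PS.
have K0 := K_ge0.
have PW0 : 0 <= \int[P x]_z W z + \int[P y]_z W z by rewrite addr_ge0// Rintegral_ge0.
have main D s : 0 < D -> A + (\int[P x]_z W z + \int[P y]_z W z) <= s ->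
   (wasserstein (P x) (P y) <= D%:E)%E ->
   transition f x - transition f y <= D `^ al * G s `^ (1 - al).
  move=> D0 Ps WD; have s0 : 0 < s by lra.
  exact: (dual_contraction hborel hsep mdist_le1 al01 D0 (Ggt0 _ s0) erefl (Gq _ s0) G0 fl
    mW W_ge0 A0 (intW x) (intW y) fG Ps WD).
have Sge : A <= S by rewrite /S; lra.
have itk0 : 0 <= iter k (euler phi c) S by apply: iter_euler_ge0 => //; lra.
have bl0 : 0 <= 1 - al by lra.
(* At low levels d contracts by the factor th, which absorbs the factor be
   that is lost in G. *)
have [Sr|rS] := leP S0 r.
  pose s := S + 2 * K.
  have Ps : A + (\int[P x]_z W z + \int[P y]_z W z) <= s.
    have : 0 <= a * phi S0 by rewrite mulr_ge0 ?(rate_ge0 hphi)// ltW.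
    by rewrite /s /S; lra.
  have Dth : 0 < th * mdist x y by rewrite mulr_gt0.
  apply: (le_trans (main _ _ Dth Ps (Hth _ _ Sr))).
  pose be := (1 + c * phi 1) * (1 + 2 * K / A).
  have KA0 : 0 <= 2 * K / A by rewrite divr_ge0 ?mulr_ge0.
  have cp0 : 0 < c * phi 1 by rewrite mulr_gt0.
  have be1 : 1 <= be by rewrite /be mulr_ege1 ?lerDl // ltW.
  have s1 : 1 <= s by rewrite /s; have := K_ge0; move: Sge; lra.
  have eus : euler phi c s <= be * S.
    have h1 : euler phi c s <= (1 + c * phi 1) * s.
      rewrite /euler mulrDl mul1r lerD2l -mulrA ler_pM2l//.
      by have := rate_ratio hphi ltr01 s1; rewrite mulr1.
    apply: (le_trans h1); rewrite /be -mulrA; apply: ler_wpM2l; first by lra.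
    rewrite /s [leRHS]mulrDl mul1r lerD2l mulrAC ler_pdivlMr; last by lra.
    by apply: ler_wpM2l => //; apply: mulr_ge0.
  have Gs : G s <= be * (iter k (euler phi c) S / z).
    rewrite /G iterSr mulrA ler_pM2r//.
    apply: le_trans (iter_euler_scale hphi c0 k be1 _); last by lra.
    apply: iter_euler_mono => //.
    by apply: (iter_euler_ge0 hphi c0 1); lra.
  apply: (@le_trans _ _ ((th * mdist x y) `^ al * (be * (iter k (euler phi c) S / z)) `^ (1 - al))).
    apply: ler_wpM2l; first exact: powR_ge0.
    apply: ge0_ler_powR; rewrite ?nnegrE//; first by apply: G0; lra.
    by apply: mulr_ge0; [lra|rewrite mulr_ge0// ltW].
  rewrite powRM ?(ltW th0) ?(ltW d0)// powRM//; [|lra|by rewrite mulr_ge0// ltW].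
  set u := (mdist x y : R) `^ al; set v := (_ / z) `^ _.
  have uv0 : 0 <= u * v by rewrite mulr_ge0// powR_ge0.
  have -> : th `^ al * u * (be `^ (1 - al) * v) = (th `^ al * be `^ (1 - al)) * (u * v) by ring.
  rewrite ler_piMl//.
  have : be `^ (1 - al) <= th `^ (- al).
    by apply: le_trans beta_le; apply: ler1_powR => //; lra.
  rewrite powRN => h; have ta : 0 < th `^ al by rewrite powR_gt0.
  by rewrite mulrC -ler_pdivlMr// mul1r.
(* At high levels d need not contract, but the drift takes back one Euler
   step. *)
pose s := S - c * phi S.
have pS : 0 <= phi S by apply: (rate_ge0 hphi); lra.
have drop : c * phi S <= a * phi S0 - 2 * K.
  have h1 : 4 * K <= a * phi S0.
    rewrite [leRHS]mulrC -ler_pdivrMr//.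
    by apply: le_trans rK _; apply: rate_mono => //; lra.
  have S0p : 0 < S0 by lra.
  have h2 := rate_ratio hphi S0p (_ : S0 <= S).
  have {}h2 : phi S * S0 <= phi S0 * S by apply: h2; rewrite /S; lra.
  have pS0 : 0 < phi S0 by apply: rate_gt0.
  have h3 : phi S <= phi S0 * (1 + A).
    rewrite -(ler_pM2r S0p); apply: (le_trans h2); rewrite -mulrA ler_pM2l//.
    by rewrite /S; nra.
  have h4 : c * phi S <= a / 2 * phi S0.
    have : c * phi S <= c * (phi S0 * (1 + A)) by rewrite ler_pM2l.
    by have -> : c * (phi S0 * (1 + A)) = a / 2 * phi S0 by rewrite /c; field; lra.
  lra.
have Ps : A + (\int[P x]_z W z + \int[P y]_z W z) <= s by rewrite /s /S; lra.
apply: (le_trans (main _ _ d0 Ps (nonexp x y))).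
apply: ler_wpM2l; first exact: powR_ge0.
have s0 : 0 < s by lra.
apply: ge0_ler_powR; rewrite ?nnegrE//; first by apply: G0; lra.
  by rewrite mulr_ge0// ltW.
rewrite /G iterSr ler_pM2r//; apply: iter_euler_mono => //.
  by apply: (le_trans (ltW s0)); apply: euler_ge => //; exact: ltW.
have : c * phi s <= c * phi S.
  rewrite ler_pM2l//; apply: rate_mono => //; first exact: ltW.
  by rewrite /s lerBlDr lerDl mulr_ge0// ltW.
by rewrite /euler {2}/s; lra.
Qed.

Theorem mixing : exists c A : R, [/\ 0 < c, 1 <= A, euler phi c 1 <= A &
  forall N f x y, lip01 f ->
    iter N transition f x - iter N transition f y <=
    ((A + (W x + W y)) / iter N (euler phi c) A) `^ (1 - al)].
Proof.
have /andP[al0 al1] := al01.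
have [c [A [c0 A1 eA H]]] := mixing_step.
exists c, A; split=> // N f x y fl.
have A0 : 0 <= A by lra.
have z0 : 0 < iter N (euler phi c) A.
  by apply: (@lt_le_trans _ _ A); [lra|exact: iter_euler_ge].
suff Hn n : (n <= N)%N -> forall u v, iter n transition f u - iter n transition f v <=
    (mdist u v) `^ al * (iter (N - n) (euler phi c) (A + (W u + W v)) / iter N (euler phi c) A) `^ (1 - al).
  apply: (le_trans (Hn N (leqnn N) x y)); rewrite subnn/=.
  rewrite ler_piMl ?powR_ge0//.
  have -> : 1 = 1 `^ al :> R by rewrite powR1.
  by apply: ge0_ler_powR; rewrite ?nnegrE ?mdist_ge0 ?mdist_le1// ltW.
elim: n => [_ u v|n IH nN u v].
  rewrite subn0 /=.
  have d0 : 0 <= (mdist u v : R) by exact: mdist_ge0.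
  apply: (@le_trans _ _ ((mdist u v) `^ al * 1)).
    rewrite mulr1; apply: (le_trans (fl.1 u v)).
    have [->|dn0] := eqVneq (mdist u v : R) 0; first exact: powR_ge0.
    apply: ger1_powR; last exact: ltW.
    by rewrite mdist_le1 andbT lt_neqAle eq_sym dn0.
  apply: ler_wpM2l; first exact: powR_ge0.
  have one : 1 `^ (1 - al) = 1 :> R by rewrite powR1.
  rewrite -[leLHS]one.
  have W2 : 0 <= W u + W v by rewrite addr_ge0.
  apply: ge0_ler_powR; rewrite ?nnegrE//; first by lra.
    by rewrite divr_ge0 ?(ltW z0)//; apply: iter_euler_ge0 => //; lra.
  rewrite ler_pdivlMr// mul1r; apply: iter_euler_mono => //; lra.
apply: H => //; first exact: iter_transition_lip01.
by have := IH (ltnW nN); rewrite -[(N - n)%N]prednK ?subn_gt0// -subnS.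
Qed.

End mixing.

(** * Moments along a semigroup with drift *)

Section moments.
Context d (T : measurableType d) (R : realType) (mu : probability T R).
Implicit Types g : T -> R.

Lemma ge0_integrable g m : measurable_fun setT g -> (forall x, 0 <= g x) ->
  (\int[mu]_x (g x)%:E <= m%:E)%E -> mu.-integrable setT (EFin \o g).
Proof.
move=> mg g0 gm; apply/integrableP; split; first exact/measurable_EFinP.
rewrite (eq_integral (fun x => (g x)%:E)) => [|x _]; last by rewrite gee0_abs ?lee_fin.
by apply: (le_lt_trans gm); rewrite ltry.
Qed.

Lemma le_integrable_ge0 g1 g2 : measurable_fun setT g1 ->
  (forall x, 0 <= g1 x <= g2 x) -> mu.-integrable setT (EFin \o g2) ->
  mu.-integrable setT (EFin \o g1).
Proof.
move=> mg1 g12 ig2; apply: (le_integrable measurableT _ _ ig2).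
  exact/measurable_EFinP.
move=> x _; have /andP[g0 gg] := g12 x.
by rewrite /= lee_fin !ger0_norm// (le_trans g0).
Qed.

Lemma integrable_affine g (p q : R) : mu.-integrable setT (EFin \o g) ->
  mu.-integrable setT (EFin \o (fun x => p + q * g x)).
Proof.
move=> ig.
have i1 : mu.-integrable setT (EFin \o cst p).
  exact: (@integrable_bounded _ _ _ mu (cst p) `|p|).
have i2 : mu.-integrable setT (EFin \o (fun x => q * g x)).
  have -> : EFin \o (fun x => q * g x) = (fun x => q%:E * (g x)%:E)%E by [].
  exact: integrableZl.
exact: (integrableD measurableT i1 i2).
Qed.

Lemma Rintegral_affine g (p q : R) : mu.-integrable setT (EFin \o g) ->
  \int[mu]_x (p + q * g x) = p + q * \int[mu]_x g x.
Proof.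
move=> ig.
have i1 : mu.-integrable setT (EFin \o cst p).
  exact: (@integrable_bounded _ _ _ mu (cst p) `|p|).
have i2 : mu.-integrable setT (EFin \o (fun x => q * g x)).
  have -> : EFin \o (fun x => q * g x) = (fun x => q%:E * (g x)%:E)%E by [].
  exact: integrableZl.
by rewrite (RintegralD measurableT i1 i2) Rintegral_cst1 RintegralZl.
Qed.

Variables (phi : R -> R) (g : T -> R).
Hypotheses (hphi : rate_function phi) (mg : measurable_fun setT g).
Hypotheses (g_ge0 : forall x, 0 <= g x) (ig : mu.-integrable setT (EFin \o g)).

Lemma integrable_rate : mu.-integrable setT (EFin \o (fun x => phi (g x))).
Proof.
apply: (le_integrable_ge0 _ _ (integrable_affine (phi 1) (phi 1) ig)).
  exact: measurable_rate.
move=> x; rewrite (rate_ge0 hphi)//=; have := rate_linear hphi (g_ge0 x).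
by rewrite mulrDr mulr1.
Qed.

(** The supergradient is taken at m, as the mean may vanish. *)
Lemma jensen_rate m : 0 < m -> \int[mu]_x g x <= m ->
  \int[mu]_x phi (g x) <= phi m.
Proof.
move=> m0 gm; have [q q0 H] := rate_supergradient hphi m0.
apply: (@le_trans _ _ (\int[mu]_x ((phi m - q * m) + q * g x))).
  apply: (le_Rintegral measurableT integrable_rate (integrable_affine _ _ ig)).
  by move=> x _; have := H _ (g_ge0 x); lra.
rewrite Rintegral_affine//; have : q * \int[mu]_x g x <= q * m by apply: ler_wpM2l.
lra.
Qed.

End moments.

Section drift_semigroup.
Context (R : realType) (dE : measure_display) (E : measurableType dE).
Variables (Q : R -> E -> probability E R) (V : E -> R) (phi : R -> R) (K : R).
Hypotheses (mQ : forall t A, measurable A -> measurable_fun setT (fun x => Q t x A)).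
Hypothesis Q_semigroup : forall s t x A, 0 <= s -> 0 <= t -> measurable A ->
  (Q (t + s) x A = \int[Q t x]_y Q s y A)%E.
Hypothesis Q_zero : forall x A, measurable A -> Q 0 x A = (\1_A x)%:E.
Hypotheses (mV : measurable_fun setT V) (V_ge0 : forall x, 0 <= V x).
Hypotheses (hphi : rate_function phi) (K_ge0 : 0 <= K).
(* The Lyapunov condition without its integral over time; it is derived from
   the original form in the theorem lyapunov_drift. *)
Hypothesis drift : forall K1 dl x, K < K1 -> 0 <= dl ->
  (\int[Q dl x]_y (V y)%:E + dl%:E * \int[Q dl x]_y (phi (V y))%:E <=
   (V x + dl * (K1 + phi (K1 * dl)))%:E)%E.

Let phiV_ge0 x : 0 <= phi (V x). Proof. exact: (rate_ge0 hphi). Qed.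
Let mphiV : measurable_fun setT (fun x => phi (V x)).
Proof. exact: measurable_rate. Qed.

Lemma semigroup_integral s t x (g : E -> \bar R) : 0 <= s -> 0 <= t ->
  measurable_fun setT g -> (forall y, 0 <= g y)%E ->
  (\int[Q (t + s) x]_y g y = \int[Q t x]_z \int[Q s z]_y g y)%E.
Proof.
move=> s0 t0 mg g0; have [nu [nuA nuf]] := mixture (mQ s) (Q t x).
rewrite -nuf//; apply: eq_measure_integral => A mA _.
by rewrite -[LHS]/(Q (t + s) x A) Q_semigroup//; apply/esym; exact: nuA.
Qed.

Lemma semigroup_Rintegral s t x (f : E -> R) : 0 <= s -> 0 <= t ->
  measurable_fun setT f -> (forall y, 0 <= f y <= 1) ->
  \int[Q (t + s) x]_y f y = \int[Q t x]_z \int[Q s z]_y f y.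
Proof.
move=> s0 t0 mf f01; congr fine; rewrite semigroup_integral//.
- apply: eq_integral => z _; rewrite EFin_Rintegral//.
  apply: (@integrable_bounded _ _ _ (Q s z) f 1) => // y.
  by have /andP[? ?] := f01 y; rewrite ger0_norm.
- exact/measurable_EFinP.
- by move=> y; rewrite lee_fin; have /andP[] := f01 y.
Qed.

Lemma zero_integral x (g : E -> \bar R) : measurable_fun setT g ->
  (\int[Q 0 x]_y g y = g x)%E.
Proof.
move=> mg; have -> : (\int[Q 0 x]_y g y = \int[dirac x]_y g y)%E.
  by apply: eq_measure_integral => A mA _; rewrite -[LHS]/(Q 0 x A) Q_zero// diracE.
by rewrite integral_dirac// diracT mul1e.
Qed.

(** What the drift condition with K1 = K + 1 adds to V x. *)
Definition excess_drift (dl : R) : R := dl * (K + 1 + phi ((K + 1) * dl)).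

Lemma excess_drift_ge0 dl : 0 <= dl -> 0 <= excess_drift dl.
Proof.
move=> dl0; have K0 := K_ge0; rewrite mulr_ge0// addr_ge0//; first by lra.
by apply: (rate_ge0 hphi); rewrite mulr_ge0//; lra.
Qed.

Lemma excess_drift_mono s t : 0 <= s -> s <= t -> excess_drift s <= excess_drift t.
Proof.
move=> s0 st; have K0 := K_ge0.
have K1 : 0 <= K + 1 by lra.
have p0 : 0 <= phi ((K + 1) * s) by apply: (rate_ge0 hphi); rewrite mulr_ge0.
apply: ler_pM => //; first by lra.
rewrite lerD2l; apply: rate_mono => //; first by rewrite mulr_ge0.
exact: ler_wpM2l.
Qed.

Lemma integrable_V t x : 0 <= t -> (Q t x).-integrable setT (EFin \o V).
Proof.
move=> t0; have K1 : K < K + 1 by rewrite ltrDl.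
apply: ge0_integrable => //; apply: le_trans (drift x K1 t0).
by rewrite leeDl// mule_ge0 ?lee_fin//; apply: integral_ge0 => y _; rewrite lee_fin.
Qed.

Lemma integrable_phiV t x : 0 <= t -> (Q t x).-integrable setT (EFin \o (fun y => phi (V y))).
Proof. by move=> t0; apply: integrable_rate => //; exact: integrable_V. Qed.

Lemma Rdrift K1 t x : K < K1 -> 0 <= t ->
  \int[Q t x]_y V y + t * \int[Q t x]_y phi (V y) <= V x + t * (K1 + phi (K1 * t)).
Proof.
move=> KK1 t0; rewrite -lee_fin EFinD EFinM.
rewrite !EFin_Rintegral; [exact: drift|exact: integrable_phiV|exact: integrable_V].
Qed.

(** The bound involves phi(V x) and not V x: this keeps it integrable against
  laws under which V is not. *)
Lemma moment_growth t x : 0 <= t ->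
  \int[Q t x]_y phi (V y) <= phi (V x) + phi (excess_drift t).
Proof.
move=> t0; have K0 := K_ge0.
have [->|tn0] := eqVneq t 0.
  have -> : \int[Q 0 x]_y phi (V y) = phi (V x).
    by rewrite /Rintegral zero_integral//; exact/measurable_EFinP.
  by rewrite lerDl (rate_ge0 hphi)// excess_drift_ge0.
have tp : 0 < t by rewrite lt_neqAle eq_sym tn0.
have ep : 0 < excess_drift t.
  rewrite mulr_gt0// ltr_wpDr//; last by lra.
  by apply: (rate_ge0 hphi); rewrite mulr_ge0//; lra.
apply: (@le_trans _ _ (phi (V x + excess_drift t))).
  apply: jensen_rate => //; [exact: integrable_V|exact: ltr_wpDl|].
  have K1 : K < K + 1 by rewrite ltrDl.
  have := Rdrift x K1 t0; rewrite -/(excess_drift t).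
  have : 0 <= t * \int[Q t x]_y phi (V y) by rewrite mulr_ge0// Rintegral_ge0.
  lra.
by apply: rate_subadd => //; exact: excess_drift_ge0.
Qed.

End drift_semigroup.

(** * Invariant laws and convergence *)

Section ergodicity.
Context (R : realType) (dE : measure_display) (E : measurableCompleteMetricType dE R).
Hypotheses (hborel : is_borel E) (hsep : separable E).
Hypothesis mdist_le1 : forall x y : E, mdist x y <= 1.
Variables (Q : R -> E -> probability E R) (V : E -> R) (phi : R -> R) (K : R).
Hypotheses (mQ : forall t A, measurable A -> measurable_fun setT (fun x => Q t x A)).
Hypothesis Q_semigroup : forall s t x A, 0 <= s -> 0 <= t -> measurable A ->
  (Q (t + s) x A = \int[Q t x]_y Q s y A)%E.
Hypothesis Q_zero : forall x A, measurable A -> Q 0 x A = (\1_A x)%:E.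
Hypotheses (mV : measurable_fun setT V) (V_ge0 : forall x, 0 <= V x).
Hypotheses (hphi : rate_function phi) (K_ge0 : 0 <= K).
Hypothesis drift : forall K1 dl x, K < K1 -> 0 <= dl ->
  (\int[Q dl x]_y (V y)%:E + dl%:E * \int[Q dl x]_y (phi (V y))%:E <=
   (V x + dl * (K1 + phi (K1 * dl)))%:E)%E.
Variable t0 : R.
Hypothesis t0_ge0 : 0 <= t0.
Hypothesis nonexp : forall t x y, t0 <= t ->
  (wasserstein (Q t x) (Q t y) <= (mdist x y)%:E)%E.
Hypothesis contr : forall r t, 0 < r -> t0 <= t -> exists2 rho : R, 0 < rho &
  forall x y, V x + V y <= r ->
    (wasserstein (Q t x) (Q t y) <= ((1 - rho) * mdist x y)%:E)%E.

Let phiV_ge0 x : 0 <= phi (V x). Proof. exact: (rate_ge0 hphi). Qed.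
Let mphiV : measurable_fun setT (fun x => phi (V x)).
Proof. exact: measurable_rate. Qed.

(* The sampling period: late enough for the contraction, and positive. *)
Let h : R := t0 + 1.
Let h_gt0 : 0 < h. Proof. by have H := t0_ge0; rewrite /h; lra. Qed.
Let h_ge0 : 0 <= h. Proof. exact: ltW. Qed.
Let P := Q h.
(* The drift condition measures the decrease at the end of the period; adding
   h * phi (V) to V moves it to the beginning. *)
Let W x := V x + h * phi (V x).

Let mW : measurable_fun setT W.
Proof. by apply: measurable_funD => //; exact: measurable_funM. Qed.

Let W_ge0 x : 0 <= W x.
Proof. by rewrite addr_ge0// mulr_ge0. Qed.

Let intV t x : 0 <= t -> (Q t x).-integrable setT (EFin \o V).
Proof. by move=> t_ge0; exact: (integrable_V mV V_ge0 hphi drift). Qed.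

Let intphiV t x : 0 <= t -> (Q t x).-integrable setT (EFin \o (fun y => phi (V y))).
Proof. by move=> t_ge0; exact: (integrable_phiV mV V_ge0 hphi drift). Qed.

Let inthphiV t x : 0 <= t -> (Q t x).-integrable setT (EFin \o (fun y => h * phi (V y))).
Proof.
move=> t_ge0; have -> : EFin \o (fun y => h * phi (V y)) = (fun y => h%:E * (phi (V y))%:E)%E by [].
by apply: integrableZl => //; exact: intphiV.
Qed.

Let intW x : (P x).-integrable setT (EFin \o W).
Proof. exact: (integrableD measurableT (intV x h_ge0) (inthphiV x h_ge0)). Qed.

Let p1 : 0 < phi 1. Proof. exact: rate_gt0. Qed.

(** So a decrease by a multiple of phi(V) is one by a multiple of phi(W). *)
Lemma rate_W x : phi (W x) <= phi 1 + (1 + h * phi 1) * phi (V x).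
Proof.
have hV : 0 <= h * phi (V x) by rewrite mulr_ge0.
have := rate_subadd hphi (V_ge0 x) hV; rewrite -/(W x).
have := rate_linear hphi hV; lra.
Qed.

Let a := h / (1 + h * phi 1).
Let hp1 : 0 < 1 + h * phi 1. Proof. by rewrite addr_gt0// mulr_gt0. Qed.
Let a_gt0 : 0 < a. Proof. exact: divr_gt0. Qed.
Let KW := excess_drift phi K h + a * phi 1.

Let KW_ge0 : 0 <= KW.
Proof.
apply: addr_ge0; first exact: excess_drift_ge0.
by apply: mulr_ge0; exact: ltW.
Qed.

Lemma skeleton_drift x : \int[P x]_y W y <= W x - a * phi (W x) + KW.
Proof.
rewrite (RintegralD measurableT (intV x h_ge0) (inthphiV x h_ge0)).
rewrite RintegralZl//; last exact: intphiV.
have K1 : K < K + 1 by rewrite ltrDl.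
have := Rdrift mV V_ge0 hphi drift x K1 h_ge0; rewrite -/(excess_drift phi K h).
have : a * phi (W x) <= a * phi 1 + h * phi (V x).
  have -> : a * phi 1 + h * phi (V x) = a * (phi 1 + (1 + h * phi 1) * phi (V x)).
    by rewrite /a; field; rewrite gt_eqF.
  by rewrite ler_pM2l//; exact: rate_W.
move: (phi (W x)) => w; rewrite /P /KW /W.
set I1 := \int[_]_y V y; set I2 := \int[_]_y phi (V y); lra.
Qed.

Let nonexpP x y : (wasserstein (P x) (P y) <= (mdist x y)%:E)%E.
Proof. by apply: nonexp; rewrite /h lerDl. Qed.

Let contrP r : 0 < r -> exists2 rho : R, 0 < rho &
  forall x y, W x + W y <= r -> (wasserstein (P x) (P y) <= ((1 - rho) * mdist x y)%:E)%E.
Proof.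
move=> r0; have th : t0 <= h by rewrite /h lerDl.
have [rho rho0 H] := contr r0 th; exists rho => // x y xy; apply: H.
apply: le_trans xy; apply: lerD; by rewrite /W lerDl mulr_ge0.
Qed.

Lemma iter_transition_semigroup N (f : E -> R) x : lip01 f ->
  iter N (transition P) f x = \int[Q (N%:R * h) x]_y f y.
Proof.
move=> fl; have fm := lip01_measurable hborel fl; elim: N x => [|N IH] x.
  rewrite mul0r /Rintegral (zero_integral Q_zero)//; exact/measurable_EFinP.
rewrite -natr1 mulrDl mul1r addrC /= /transition.
have Nh : 0 <= N%:R * h by rewrite mulr_ge0.
rewrite (semigroup_Rintegral mQ Q_semigroup x Nh h_ge0 fm fl.2).
by apply: eq_Rintegral => y _; exact: IH.
Qed.

(** The bound (S / z) ^ (1 - al) of the lemma mixing, S = A + W x + W y, need not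
  be integrable against a law with finite phi(V)-moment. If S <= z then
  S / z <= phi S / phi z by concavity, and if S > z then phi S / phi z >= 1,
  while the difference of the test functions is at most 1. *)
Theorem rate_mixing al : 0 < al < 1 -> exists B c A : R,
  [/\ 0 < B, 0 < c, 1 <= A, euler phi c 1 <= A &
  forall N f x y, lip01 f ->
    iter N (transition P) f x - iter N (transition P) f y <=
    B * (1 + phi (V x) + phi (V y)) / phi (iter N (euler phi c) A) `^ (1 - al)].
Proof.
move=> al01; have /andP[al0 al1] := al01.
have [c [A [c0 A1 eA H]]] := mixing hborel hsep mdist_le1 hphi mW W_ge0 a_gt0 KW_ge0
  intW skeleton_drift nonexpP contrP al01.
pose B := 1 + phi A + 2 * phi 1 + (1 + h * phi 1).
have pA : 0 < phi A by apply: rate_gt0 => //; lra.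
have p1' := p1; have hp1' := hp1.
have B0 : 0 < B by rewrite /B; lra.
exists B, c, A; split=> // N f x y fl.
set z := iter N (euler phi c) A.
have zA : A <= z by apply: iter_euler_ge => //; lra.
have z0 : 0 < z by lra.
have pz : 0 < phi z by apply: rate_gt0.
set S := A + (W x + W y).
have SA : A <= S by rewrite lerDl addr_ge0.
have S0 : 0 < S by lra.
have pS : 0 < phi S by apply: rate_gt0.
have bl0 : 0 <= 1 - al by lra.
have step1 : iter N (transition P) f x - iter N (transition P) f y <=
    (phi S / phi z) `^ (1 - al).
  have [Sz|zS] := leP S z.
    apply: (le_trans (H N f x y fl)); apply: ge0_ler_powR => //.
    - by rewrite nnegrE divr_ge0// ltW.
    - by rewrite nnegrE divr_ge0// ltW.
    rewrite ler_pdivrMr// mulrAC ler_pdivlMr// mulrC; exact: rate_ratio.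
  apply: (@le_trans _ _ 1).
    have [_ F01] := iter_transition_lip01 hborel hsep mdist_le1 nonexpP N fl.
    by have /andP[? ?] := F01 x; have /andP[? ?] := F01 y; lra.
  have one : 1 `^ (1 - al) = 1 :> R by rewrite powR1.
  rewrite -[leLHS]one; apply: ge0_ler_powR; rewrite ?nnegrE//.
    by rewrite divr_ge0// ltW.
  by rewrite ler_pdivlMr// mul1r; apply: rate_mono => //; exact: ltW.
apply: (le_trans step1).
rewrite powRM ?invr_ge0 ?(ltW pS) ?(ltW pz)//.
have -> : (phi z)^-1 `^ (1 - al) = (phi z `^ (1 - al))^-1.
  by rewrite -powR_inv1 ?(ltW pz)// powRAC powR_inv1// powR_ge0.
rewrite ler_pM2r ?invr_gt0 ?powR_gt0//.
apply: (@le_trans _ _ (1 + phi S)).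
  have [le1|/ltW ge1] := leP (phi S) 1.
    apply: (@le_trans _ _ 1); last by lra.
    have one : 1 `^ (1 - al) = 1 :> R by rewrite powR1.
    by rewrite -[leRHS]one; apply: ge0_ler_powR; rewrite ?nnegrE// ltW.
  apply: (@le_trans _ _ (phi S)); last by lra.
  by apply: ler1_powR => //; lra.
have A0 : 0 <= A by lra.
have h1 := rate_subadd hphi A0 (addr_ge0 (W_ge0 x) (W_ge0 y)).
have h2 := rate_subadd hphi (W_ge0 x) (W_ge0 y).
have h3 := rate_W x; have h4 := rate_W y.
have vx := phiV_ge0 x; have vy := phiV_ge0 y.
rewrite -/S in h1; rewrite /B.
move: (phi (V x)) (phi (V y)) vx vy h3 h4 => b1 b2 vx vy h3 h4.
have e1 : 0 <= (1 + phi A + 2 * phi 1) * (b1 + b2).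
  by rewrite mulr_ge0// addr_ge0//; lra.
lra.
Qed.

(** The law at time t of the process started from mu. *)
Lemma act_exists t (mu : probability E R) : exists nu : probability E R,
  (forall A, measurable A -> nu A = \int[mu]_x Q t x A)%E /\
  (forall g : E -> \bar R, measurable_fun setT g -> (forall y, 0 <= g y)%E ->
     \int[nu]_y g y = \int[mu]_x \int[Q t x]_y g y)%E.
Proof. exact: (mixture (mQ t) mu). Qed.

(** The pointwise bound is integrated in x and then in y. *)
Lemma mixing_measures B N (f : E -> R) (mu nu : probability E R) (r : R) :
  0 < r ->
  (forall x y, iter N (transition P) f x - iter N (transition P) f y <=
    B * (1 + phi (V x) + phi (V y)) / r) ->
  lip01 f ->
  mu.-integrable setT (EFin \o (fun y => phi (V y))) ->
  nu.-integrable setT (EFin \o (fun y => phi (V y))) ->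
  \int[mu]_x iter N (transition P) f x - \int[nu]_x iter N (transition P) f x <=
  B * (1 + \int[mu]_x phi (V x) + \int[nu]_x phi (V x)) / r.
Proof.
move=> r0 H fl imu inu; set F := iter N (transition P) f in H *.
have Fl : lip01 F by apply: iter_transition_lip01.
have iF (m : probability E R) : m.-integrable setT (EFin \o F) by exact: lip01_integrable.
have step y : \int[mu]_x F x - F y <= B / r * (1 + \int[mu]_x phi (V x) + phi (V y)).
  rewrite lerBlDr.
  apply: (@le_trans _ _ (\int[mu]_x ((B / r * (1 + phi (V y)) + F y) + B / r * phi (V x)))).
    apply: (le_Rintegral measurableT (iF mu) (integrable_affine _ _ imu)) => x _.
    have := H x y; rewrite lerBlDr => /le_trans; apply.
    by rewrite le_eqVlt; apply/orP; left; apply/eqP; ring.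
  rewrite Rintegral_affine//.
  by rewrite le_eqVlt; apply/orP; left; apply/eqP; ring.
have iN : nu.-integrable setT (EFin \o (fun y => \int[mu]_x F x + (-1) * F y)).
  exact: integrable_affine.
have := le_Rintegral measurableT iN (integrable_affine (B / r * (1 + \int[mu]_x phi (V x))) (B / r) inu).
rewrite !Rintegral_affine// mulN1r => HH.
apply: (le_trans (HH _)) => [y _|]; last by rewrite le_eqVlt; apply/orP; left; apply/eqP; ring.
by rewrite mulN1r; apply: (le_trans (step y)); rewrite le_eqVlt; apply/orP; left; apply/eqP; ring.
Qed.

Definition invariant_law (pi : probability E R) : Prop :=
  forall t, 0 <= t -> forall A, measurable A -> (\int[pi]_x Q t x A = pi A)%E.

Lemma invariant_integral pi t (g : E -> \bar R) : invariant_law pi -> 0 <= t ->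
  measurable_fun setT g -> (forall y, 0 <= g y)%E ->
  (\int[pi]_x \int[Q t x]_y g y = \int[pi]_y g y)%E.
Proof.
move=> ipi t_ge0 mg g0; have [nu [nuA nuf]] := act_exists t pi.
rewrite -nuf//; apply: eq_measure_integral => A mA _.
by rewrite -[RHS]/(pi A) -(ipi t t_ge0 A mA); exact: nuA.
Qed.

Lemma invariant_Rintegral pi t (f : E -> R) (M : R) : invariant_law pi -> 0 <= t ->
  measurable_fun setT f -> (forall y, 0 <= f y <= M) ->
  \int[pi]_x \int[Q t x]_y f y = \int[pi]_y f y.
Proof.
move=> ipi t_ge0 mf f0; congr fine; rewrite -[RHS](invariant_integral ipi t_ge0).
- apply: eq_integral => x _; rewrite EFin_Rintegral//.
  apply: (@integrable_bounded _ _ _ (Q t x) f M) => // y.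
  by have /andP[? ?] := f0 y; rewrite ger0_norm.
- exact/measurable_EFinP.
- by move=> y; rewrite lee_fin; have /andP[] := f0 y.
Qed.

(** V need not be integrable against pi, so the drift inequality cannot be
  integrated as it stands. Let P = Q dl. Since P(min(V, n)) <= min(P V, n),
  invariance bounds the integral of min(V, n) - min(P V, n) by 0 from above. On
  {V < n} this function dominates dl * P(phi V) - ka, and elsewhere it is
  non-negative; then n tends to infinity. *)
Lemma invariant_moment_step pi K1 dl : invariant_law pi -> K < K1 -> 0 < dl ->
  (\int[pi]_x (phi (V x))%:E <= (K1 + phi (K1 * dl))%:E)%E.
Proof.
move=> ipi KK1 dl0; have K0 := K_ge0.
have dl_ge0 : 0 <= dl by exact: ltW.
pose ka := dl * (K1 + phi (K1 * dl)).
have ka0 : 0 <= ka.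
  rewrite mulr_ge0// addr_ge0//; first by lra.
  by apply: (rate_ge0 hphi); rewrite mulr_ge0//; lra.
pose g x := \int[Q dl x]_y phi (V y).
pose v x := \int[Q dl x]_y V y.
have vg x : v x + dl * g x <= V x + ka by exact: (Rdrift mV V_ge0 hphi drift).
have g0 x : 0 <= g x by exact: Rintegral_ge0.
have v0 x : 0 <= v x by exact: Rintegral_ge0.
have mg : measurable_fun setT g by exact: (measurable_kernel_Rintegral (mQ dl)).
have mv : measurable_fun setT v by exact: (measurable_kernel_Rintegral (mQ dl)).
rewrite -(invariant_integral ipi dl_ge0); last 2 first.
- exact/measurable_EFinP.
- by move=> y; rewrite lee_fin.
have -> : (\int[pi]_x \int[Q dl x]_y (phi (V y))%:E = \int[pi]_x (g x)%:E)%E.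
  by apply: eq_integral => x _; rewrite EFin_Rintegral//; exact: intphiV.
pose gn (n : nat) x := if V x < n%:R then g x else 0.
have mgn n : measurable_fun setT (gn n).
  by apply: measurable_fun_ifT => //; exact: measurable_fun_ltr.
have gn0 n x : 0 <= gn n x by rewrite /gn; case: ifP.
have gnb n x : gn n x <= (n%:R + ka) / dl.
  rewrite /gn; case: ifPn => [Vn|_]; last by rewrite divr_ge0// addr_ge0.
  rewrite ler_pdivlMr// mulrC; have := vg x; have := v0 x; lra.
have igb (f : E -> R) (M : R) : measurable_fun setT f -> (forall x, 0 <= f x <= M) ->
    pi.-integrable setT (EFin \o f).
  move=> mf fM; apply: (@integrable_bounded _ _ _ pi f M) => // x.
  by have /andP[? ?] := fM x; rewrite ger0_norm.
have gn_le n : \int[pi]_x gn n x <= ka / dl.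
  pose b (s : R) := Num.min s n%:R.
  have bV x : 0 <= b (V x) <= n%:R by rewrite /b le_min V_ge0 ler0n ge_min lexx orbT.
  have bv x : 0 <= b (v x) <= n%:R by rewrite /b le_min v0 ler0n ge_min lexx orbT.
  have mbV : measurable_fun setT (fun x => b (V x)) by exact: measurable_minr.
  have mbv : measurable_fun setT (fun x => b (v x)) by exact: measurable_minr.
  have ign : pi.-integrable setT (EFin \o gn n).
    by apply: (igb _ ((n%:R + ka) / dl)) => // x; rewrite gn0 gnb.
  have le1 : \int[pi]_x b (V x) <= \int[pi]_x b (v x).
    rewrite -(invariant_Rintegral ipi dl_ge0 mbV bV).
    apply: le_Rintegral => //; last 1 first.
    - move=> x _; rewrite /b le_min; apply/andP; split.
        apply: le_Rintegral => //.
        + apply: (@integrable_bounded _ _ _ (Q dl x) _ n%:R) => // y.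
          by have /andP[? ?] := bV y; rewrite ger0_norm.
        + exact: intV.
        + by move=> y _; rewrite ge_min lexx.
      by have /andP[] := Rintegral_bounded (Q dl x) mbV bV.
    - apply: (igb _ n%:R); first by apply: (measurable_kernel_Rintegral (mQ dl)) => // y; have /andP[] := bV y.
      by move=> x; exact: Rintegral_bounded.
    - exact: (igb _ n%:R).
  have : \int[pi]_x (- ka + dl * gn n x) <= \int[pi]_x (b (V x) - b (v x)).
    apply: le_Rintegral => //; first exact: integrable_affine.
      exact: (integrableB measurableT (igb _ _ mbV bV) (igb _ _ mbv bv)).
    move=> x _; have := vg x; have := g0 x; have := v0 x; have := V_ge0 x; rewrite /gn /b.
    have ka1 := ka0.
    by case: (ltP (V x) n%:R) => Vn; case: (leP (v x) n%:R) => vn; rewrite ?mulr0; lra.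
  rewrite Rintegral_affine// RintegralB//; [|exact: (igb _ n%:R)..].
  rewrite ler_pdivlMr// mulrC; lra.
have kadl : ka / dl = K1 + phi (K1 * dl) by rewrite /ka mulrAC divff ?mul1r// gt_eqF.
rewrite -kadl.
have lim_g x : (gn n x)%:E @[n --> \oo] --> (g x)%:E.
  apply: cvg_near_cst; have [N hN] : exists N : nat, V x < N%:R.
    by exists (Num.truncn (V x)).+1; exact: truncnS_gt.
  exists N => // n /= Nn; rewrite /gn ifT//; apply: (lt_le_trans hN).
  by rewrite ler_nat.
have cvm : ((fun n => \int[pi]_x (gn n x)%:E) @ \oo --> \int[pi]_x (g x)%:E)%E.
  rewrite (_ : (fun x => (g x)%:E) = (fun x => limn (fun n => (gn n x)%:E))); last first.
    by apply/funext => x; apply/esym/cvg_lim.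
  apply: cvg_monotone_convergence => //.
  - by move=> n; exact/measurable_EFinP.
  - by move=> n x _; rewrite lee_fin.
  - move=> x _ m n mn; rewrite lee_fin /gn; case: ifPn => Vm; last by case: ifP.
    by rewrite ifT//; apply: (lt_le_trans Vm); rewrite ler_nat.
rewrite -(cvg_lim _ cvm)//; apply: lime_le.
  by apply/cvg_ex; exists (\int[pi]_x (g x)%:E)%E.
apply: nearW => n; rewrite -EFin_Rintegral ?lee_fin//.
by apply: (igb _ ((n%:R + ka) / dl)) => // x; rewrite gn0 gnb.
Qed.

(** By continuity of phi at 0, the error phi (K1 * dl) vanishes with dl. *)
Lemma invariant_moment pi : invariant_law pi -> (\int[pi]_x (phi (V x))%:E <= K%:E)%E.
Proof.
move=> ipi; apply/lee_addgt0Pr => e e0; rewrite -EFinD.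
pose K1 := K + e / 2.
have KK1 : K < K1 by rewrite ltrDl divr_gt0.
have e20 : 0 < e / 2 by rewrite divr_gt0.
have [dl dl0 H] := rate_cont0 hphi e20.
have K0 := K_ge0; have K10 : 0 < K1 by rewrite /K1; lra.
have dK : 0 < dl / K1 by rewrite divr_gt0.
apply: (le_trans (invariant_moment_step ipi KK1 dK)); rewrite lee_fin.
have := H (K1 * (dl / K1)); rewrite mulrC divfK ?gt_eqF// => /(_ (ltW dl0) (lexx _)).
rewrite /K1; lra.
Qed.

Lemma decay (C c A b e : R) : 0 < c -> 1 <= A -> 0 < C -> 0 < b -> 0 < e ->
  exists N0, forall N, (N0 <= N)%N -> C / phi (iter N (euler phi c) A) `^ b <= e.
Proof.
move=> c0 A1 C0 b0 e0.
have [y y1 My] := rate_unbounded hphi ((C / e) `^ b^-1).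
have A0 : 0 < A by lra.
have A_ge0 : 0 <= A by exact: ltW.
have cA : 0 < c * phi A by rewrite mulr_gt0// rate_gt0.
exists (Num.truncn (y / (c * phi A))).+1 => N N0N.
set z := iter N _ A.
have yz : y <= z.
  have := iter_euler_grow hphi c0 N A_ge0; rewrite -/z; apply: le_trans.
  have : y <= N%:R * (c * phi A).
    by rewrite -ler_pdivrMr//; apply: (le_trans (ltW (truncnS_gt _))); rewrite ler_nat.
  by move=> H; apply: (le_trans H); rewrite lerDr.
have y0 : 0 <= y by lra.
have pz : (C / e) `^ b^-1 <= phi z by apply: (le_trans My); exact: rate_mono.
have Ce : 0 < C / e by rewrite divr_gt0.
have pz0 : 0 < phi z by apply: lt_le_trans pz; rewrite powR_gt0.
rewrite ler_pdivrMr ?powR_gt0// -ler_pdivrMl// mulrC.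
have := @ge0_ler_powR R b (ltW b0) _ _ _ _ pz.
rewrite !nnegrE powR_ge0 (ltW pz0) => /(_ isT isT).
by rewrite -powRrM mulVf ?gt_eqF// powRr1// ltW.
Qed.

Let integrable_invariant pi : invariant_law pi ->
  pi.-integrable setT (EFin \o (fun y => phi (V y))) /\ \int[pi]_y phi (V y) <= K.
Proof.
move=> ipi; have H := invariant_moment ipi.
have ig : pi.-integrable setT (EFin \o (fun y => phi (V y))).
  exact: (ge0_integrable mphiV _ H).
by split=> //; rewrite -lee_fin EFin_Rintegral.
Qed.

Let invariant_iter pi N (f : E -> R) : invariant_law pi -> lip01 f ->
  \int[pi]_x iter N (transition P) f x = \int[pi]_x f x.
Proof.
move=> ipi fl.
rewrite -(@invariant_Rintegral pi (N%:R * h) f 1 ipi)//.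
- by apply: eq_Rintegral => x _; exact: iter_transition_semigroup.
- by rewrite mulr_ge0.
- exact: (lip01_measurable hborel).
- exact: fl.2.
Qed.

(** Integrals of test functions against an invariant law do not change under
  the dual semigroup, whereas mixing makes any two of them approach each other. *)
Lemma invariant_unique pi1 pi2 : invariant_law pi1 -> invariant_law pi2 ->
  forall A, measurable A -> pi1 A = pi2 A.
Proof.
move=> i1 i2; have [g1 m1] := integrable_invariant i1.
have [g2 m2] := integrable_invariant i2.
have half : 0 < (2^-1 : R) < 1 by apply/andP; split; lra.
have [B [c [A [B0 c0 A1 _ H]]]] := rate_mixing half.
have K0 := K_ge0.
have BK0 : 0 < B * (1 + K + K) by rewrite mulr_gt0//; lra.
have half' : 0 < 1 - 2^-1 :> R by lra.
apply: (lip01_separate hborel) => f fl.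
have small (mu nu : probability E R) : invariant_law mu -> invariant_law nu ->
    \int[mu]_x f x <= \int[nu]_x f x.
  move=> imu inu; apply/ler_addgt0Pr => e e0.
  have [gmu mmu] := integrable_invariant imu.
  have [gnu mnu] := integrable_invariant inu.
  have [N /(_ N (leqnn N)) HN] := decay c0 A1 BK0 half' e0.
  have A0 : 0 <= A by lra.
  set r := phi _ `^ _ in HN.
  have r0 : 0 < r.
    rewrite powR_gt0// rate_gt0//; apply: lt_le_trans (iter_euler_ge hphi c0 N A0); lra.
  have := mixing_measures r0 (fun x y => H N f x y fl) fl gmu gnu.
  rewrite !invariant_iter// => HH; rewrite addrC -lerBlDr; apply: (le_trans HH).
  apply: le_trans HN; rewrite ler_pM2r ?invr_gt0// ler_pM2l//; lra.
by apply: le_anti; rewrite !small.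
Qed.

Let x0 : E := point.

Let orbit k := Q (k%:R * h) x0.

Let kh_ge0 (k : nat) : 0 <= k%:R * h. Proof. by rewrite mulr_ge0. Qed.

(** The drift inequality for the law at time k * h as the initial law. *)
Lemma orbit_drift k : \int[orbit k.+1]_y V y + h * \int[orbit k.+1]_y phi (V y) <=
  \int[orbit k]_y V y + excess_drift phi K h.
Proof.
have ka0 : 0 <= excess_drift phi K h by exact: excess_drift_ge0.
have K1 : K < K + 1 by rewrite ltrDl.
have e : k.+1%:R * h = k%:R * h + h by rewrite -natr1 mulrDl mul1r.
have mEV : measurable_fun setT (fun y => (V y)%:E) by exact/measurable_EFinP.
have mEp : measurable_fun setT (fun y => (phi (V y))%:E) by exact/measurable_EFinP.
have Ep y : (0 <= (phi (V y))%:E)%E by rewrite lee_fin.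
have EV y : (0 <= (V y)%:E)%E by rewrite lee_fin.
rewrite -lee_fin EFinD EFinM !EFin_Rintegral; [|exact: intphiV|exact: intV].
rewrite /orbit e !(semigroup_integral mQ Q_semigroup x0 h_ge0 (kh_ge0 k)) //.
have mkV := measurable_kernel_integral (mQ h) mEV EV.
have mkp := measurable_kernel_integral (mQ h) mEp Ep.
have kV y : (0 <= \int[Q h y]_z (V z)%:E)%E by apply: integral_ge0.
have kp y : (0 <= \int[Q h y]_z (phi (V z))%:E)%E by apply: integral_ge0.
have hkp y : (0 <= h%:E * \int[Q h y]_z (phi (V z))%:E)%E by rewrite mule_ge0.
have mhkp : measurable_fun setT (fun y => h%:E * \int[Q h y]_z (phi (V z))%:E)%E.
  exact: measurable_funeM.
rewrite -ge0_integralZl// -ge0_integralD//.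
rewrite [leRHS](_ : _ = \int[Q (k%:R * h) x0]_y (excess_drift phi K h + 1 * V y)%:E)%E; last first.
  rewrite -EFin_Rintegral; last by apply: integrable_affine; exact: intV.
  by rewrite Rintegral_affine ?mul1r 1?addrC//; exact: intV.
apply: ge0_le_integral => //.
- by move=> y _; rewrite adde_ge0.
- exact: emeasurable_funD.
- by apply/measurable_EFinP; apply: measurable_funD => //; exact: measurable_funM.
- by move=> y _; apply: (le_trans (drift y K1 h_ge0)); rewrite lee_fin mul1r addrC.
Qed.

(* A common bound for the phi(V)-moments of the averages below. *)
Let budget := phi (V x0) + V x0 / h + 2 * excess_drift phi K h / h.

Let orbit_moment n : h * \sum_(k < n) \int[orbit k.+1]_y phi (V y) <=
  V x0 + n%:R * excess_drift phi K h.
Proof.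
have H : \int[orbit n]_y V y + h * (\sum_(k < n) \int[orbit k.+1]_y phi (V y)) <=
    V x0 + n%:R * excess_drift phi K h.
  elim: n => [|n IH].
    rewrite big_ord0 mulr0 mul0r !addr0 /orbit mul0r /Rintegral (zero_integral Q_zero)//.
    exact/measurable_EFinP.
  rewrite big_ord_recr /= (mulrDr h) -natr1 (mulrDl n%:R) mul1r.
  have := orbit_drift n; lra.
apply: le_trans H; rewrite lerDr; exact: Rintegral_ge0.
Qed.

(** Averages of the laws at the times j * h, ..., (j + N) * h. *)
Lemma cesaro_exists N j : exists nu : probability E R,
  forall g : E -> \bar R, measurable_fun setT g -> (forall y, 0 <= g y)%E ->
  (\int[nu]_y g y = \sum_(i < N.+1) (N.+1%:R^-1)%:E * \int[orbit (j + i)]_y g y)%E.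
Proof.
have w0 (i : 'I_N.+1) : 0 <= N.+1%:R^-1 :> R by rewrite invr_ge0.
have w1 : \sum_(i < N.+1) N.+1%:R^-1 = 1 :> R by rewrite sumr_const card_ord -[LHS]mulr_natl divff.
have [nu [_ nuf]] := finite_mixture (fun i : 'I_N.+1 => orbit (j + i)) w0 w1.
by exists nu.
Qed.

Let cesaro N j : probability E R := projT1 (cid (cesaro_exists N j)).

Let cesaroE N j (g : E -> \bar R) : measurable_fun setT g -> (forall y, 0 <= g y)%E ->
  (\int[cesaro N j]_y g y = \sum_(i < N.+1) (N.+1%:R^-1)%:E * \int[orbit (j + i)]_y g y)%E.
Proof. exact: (projT2 (cid (cesaro_exists N j))). Qed.

Let cesaro_Rintegral N j (g : E -> R) : measurable_fun setT g -> (forall y, 0 <= g y) ->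
  (forall k, (orbit k).-integrable setT (EFin \o g)) ->
  \int[cesaro N j]_y g y = N.+1%:R^-1 * \sum_(i < N.+1) \int[orbit (j + i)]_y g y.
Proof.
move=> mg g0 ig; rewrite /Rintegral cesaroE//; last exact/measurable_EFinP.
under eq_bigr do rewrite -EFin_Rintegral// -EFinM.
by rewrite sumEFin /= mulr_sumr.
Qed.

(* The drift inequality telescopes along the orbit; for j <= N the average has
   at least half as many terms as the telescoping sum. *)
Let cesaro_moment N j : (j <= N)%N ->
  (cesaro N j).-integrable setT (EFin \o (fun y => phi (V y))) /\
  \int[cesaro N j]_y phi (V y) <= budget.
Proof.
move=> jN; have ka0 : 0 <= excess_drift phi K h by exact: excess_drift_ge0.
have ip k : (orbit k).-integrable setT (EFin \o (fun y => phi (V y))) by exact: intphiV.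
have ig : (cesaro N j).-integrable setT (EFin \o (fun y => phi (V y))).
  apply: (ge0_integrable (m := \sum_(i < N.+1) N.+1%:R^-1 * \int[orbit (j + i)]_y phi (V y))) => //.
  rewrite cesaroE//; last exact/measurable_EFinP.
  by rewrite -sumEFin; apply: lee_sum => i _; rewrite EFinM EFin_Rintegral.
split=> //; rewrite cesaro_Rintegral//.
rewrite ler_pdivrMl//.
pose p k := \int[orbit k]_y phi (V y).
have p0 k : 0 <= p k by exact: Rintegral_ge0.
apply: (@le_trans _ _ (\sum_(k < (j + N).+1) p k)).
  rewrite -addnS big_split_ord /= lerDr; exact: sumr_ge0.
rewrite big_ord_recl /= {1}/p /orbit mul0r [\int[Q 0 x0]_y _]/Rintegral (zero_integral Q_zero) /=; last exact/measurable_EFinP.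
have := orbit_moment (j + N); rewrite -ler_pdivlMl// => H.
apply: (le_trans (lerD (lexx _) H)).
have h0 := h_gt0; have V0 := V_ge0 x0; have q0 := phiV_ge0 x0.
rewrite /budget; move: (excess_drift phi K h) ka0 => D D0.
have Vh : 0 <= V x0 / h by rewrite divr_ge0.
have kah : 0 <= D / h by rewrite divr_ge0.
rewrite mulrC mulrDl -!mulrA.
move: (D / h) (V x0 / h) (phi (V x0)) kah Vh q0 => ka v q kah Vh q0.
have jN2 : (j + N)%:R <= 2 * N.+1%:R :> R.
  by rewrite -natrM ler_nat mul2n -addnn; apply: leq_add => //; exact: (leq_trans jN).
have N1 : 1 <= N.+1%:R :> R by rewrite ler1n.
have := ler_wpM2r kah jN2.
have := ler_wpM2r q0 N1; have := ler_wpM2r Vh N1; lra.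
Qed.

Let cesaro_shift N m n f : lip01 f ->
  \int[cesaro N n]_y iter m (transition P) f y = \int[cesaro N (m + n)]_y f y.
Proof.
move=> fl; have Fl : lip01 (iter m (transition P) f) by apply: iter_transition_lip01.
rewrite !cesaro_Rintegral//.
- congr (_ * _); apply: eq_bigr => i _; rewrite /orbit -addnA (natrD _ m) mulrDl [RHS](_ : _ = \int[Q ((n + i)%:R * h + m%:R * h) x0]_y f y); last by rewrite addrC.
  rewrite (semigroup_Rintegral mQ Q_semigroup x0 (kh_ge0 m) (kh_ge0 (n + i)) (lip01_measurable hborel fl) fl.2).
  by apply: eq_Rintegral => y _; exact: iter_transition_semigroup.
- exact: (lip01_measurable hborel).
- by move=> y; have /andP[] := fl.2 y.
- by move=> k; exact: lip01_integrable.
- exact: (lip01_measurable hborel).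
- by move=> y; have /andP[] := Fl.2 y.
- by move=> k; exact: lip01_integrable.
Qed.

Lemma act_Rintegral t (mu nu : probability E R) f : 0 <= t -> lip01 f ->
  (forall g : E -> \bar R, measurable_fun setT g -> (forall y, 0 <= g y)%E ->
     \int[nu]_y g y = \int[mu]_x \int[Q t x]_y g y)%E ->
  \int[nu]_y f y = \int[mu]_x \int[Q t x]_y f y.
Proof.
move=> t_ge0 fl nuf; have mf := lip01_measurable hborel fl.
congr fine; rewrite nuf.
- by apply: eq_integral => x _; rewrite EFin_Rintegral//; exact: lip01_integrable.
- exact/measurable_EFinP.
- by move=> y; rewrite lee_fin; have /andP[] := fl.2 y.
Qed.

Lemma transition_comm N t f x : 0 <= t -> lip01 f -> lip01 (transition (Q t) f) ->
  iter N (transition P) (transition (Q t) f) x =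
  \int[Q t x]_y iter N (transition P) f y.
Proof.
move=> t_ge0 fl gl; have mf := lip01_measurable hborel fl.
rewrite iter_transition_semigroup// /transition.
rewrite -(semigroup_Rintegral mQ Q_semigroup x t_ge0 (kh_ge0 N) mf fl.2) addrC.
rewrite (semigroup_Rintegral mQ Q_semigroup x (kh_ge0 N) t_ge0 mf fl.2).
by apply: eq_Rintegral => y _; rewrite -iter_transition_semigroup.
Qed.

Let budget_ge0 : 0 <= budget.
Proof.
have ka0 : 0 <= excess_drift phi K h by exact: excess_drift_ge0.
rewrite /budget; apply: addr_ge0; first apply: addr_ge0 => //.
  by apply: divr_ge0.
by apply: divr_ge0 => //; apply: mulr_ge0.
Qed.

(** Before t0 the semigroup need not preserve Lipschitz functions; there
  pi Q_t = (pi Q_t0) Q_t = pi Q_(t0 + t) = pi. *)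
Lemma invariant_of_late (pi : probability E R) :
  (forall t f, t0 <= t -> lip01 f -> \int[pi]_x \int[Q t x]_y f y = \int[pi]_x f x) ->
  invariant_law pi.
Proof.
move=> H.
have late t A : t0 <= t -> measurable A -> (\int[pi]_x Q t x A = pi A)%E.
  move=> t0t mA; have t_ge0 : 0 <= t by exact: le_trans t0t.
  have [nu [nuA nuf]] := act_exists t pi.
  rewrite -nuA//; apply: (lip01_separate hborel) mA => f fl.
  by rewrite (act_Rintegral t_ge0 fl nuf) H.
move=> t t_ge0 A mA.
have [nu [nuA nuf]] := act_exists t0 pi.
rewrite -[RHS](late (t0 + t) A _ mA); last by rewrite lerDl.
under [RHS]eq_integral do rewrite (Q_semigroup _ t_ge0 t0_ge0 mA).
rewrite -nuf; [|exact: mQ|by move=> y; exact: measure_ge0].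
apply: eq_measure_integral => B mB _; rewrite -[LHS]/(pi B) -(late t0 B (lexx _) mB).
by apply/esym; exact: nuA.
Qed.

(** The average over the times N * h, ..., 2 N * h is the average over
  0, ..., N * h run for N more periods. Mixing over these N periods makes such
  averages a Cauchy sequence, and for late t it brings the average and its image
  under Q t together. *)
Lemma invariant_exists : exists pi, invariant_law pi.
Proof.
have half : 0 < (2^-1 : R) < 1 by apply/andP; split; lra.
have half' : 0 < 1 - 2^-1 :> R by lra.
have [B [c [A [B0 c0 A1 _ H]]]] := rate_mixing half.
have bud := budget_ge0; have A0 : 0 <= A by lra.
pose r N := phi (iter N (euler phi c) A) `^ (1 - 2^-1).
have r0 N : 0 < r N.
  rewrite powR_gt0// rate_gt0//; apply: lt_le_trans (iter_euler_ge hphi c0 N A0); lra.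
pose D := B * (1 + budget + budget).
have D0 : 0 < D by rewrite mulr_gt0//; lra.
pose mu N := cesaro N N.
have cauchy N N' f : (N <= N')%N -> lip01 f ->
    `|\int[mu N]_x f x - \int[mu N']_x f x| <= D / r N.
  move=> NN fl.
  have -> : \int[mu N]_x f x = \int[cesaro N 0]_x iter N (transition P) f x.
    by rewrite cesaro_shift// addn0.
  have -> : \int[mu N']_x f x = \int[cesaro N' (N' - N)]_x iter N (transition P) f x.
    by rewrite cesaro_shift// subnKC.
  have [i1 m1] := cesaro_moment (leq0n N).
  have [i2 m2] := cesaro_moment (leq_subr N N').
  have le_D a1 a2 : a1 <= budget -> a2 <= budget -> B * (1 + a1 + a2) / r N <= D / r N.
    by move=> ? ?; rewrite ler_pM2r ?invr_gt0// ler_pM2l//; lra.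
  rewrite ler_norml lerNl opprB; apply/andP; split.
    exact: (le_trans (mixing_measures (r0 N) (fun x y => H N f x y fl) fl i2 i1) (le_D _ _ m2 m1)).
  exact: (le_trans (mixing_measures (r0 N) (fun x y => H N f x y fl) fl i1 i2) (le_D _ _ m1 m2)).
have step k : exists n, D / r n <= 2^-1 ^+ k.
  have e0 : 0 < 2^-1 ^+ k :> R by rewrite exprn_gt0.
  by have [N /(_ N (leqnn N))] := decay c0 A1 D0 half' e0; exists N.
pose s k := projT1 (cid (step k)).
have sP k : D / r (s k) <= 2^-1 ^+ k := projT2 (cid (step k)).
have [pi piP] : exists pi : probability E R, forall f : E -> R, lip01 f ->
    (fun k => \int[mu (s k)]_x f x) @ \oo --> \int[pi]_x f x.
  apply: (laws_complete hborel hsep mdist_le1) => k f fl.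
  have [kk|/ltnW kk] := leqP (s k) (s k.+1).
    exact: (le_trans (cauchy _ _ _ kk fl)).
  rewrite distrC; apply: (le_trans (cauchy _ _ _ kk fl)); apply: (le_trans (sP _)).
  by rewrite exprS ler_piMl ?exprn_ge0//; lra.
exists pi; apply: invariant_of_late => t f t0t fl.
have t_ge0 : 0 <= t by exact: le_trans t0t.
have gl : lip01 (transition (Q t) f).
  by apply: (transition_lip01 hborel hsep mdist_le1) => // x y; exact: nonexp.
set ed := phi (excess_drift phi K t).
have ed0 : 0 <= ed.
  by apply: (rate_ge0 hphi); exact: excess_drift_ge0.
pose C := (1 + budget + budget + ed) / (1 + budget + budget).
have bud1 : 0 < 1 + budget + budget by lra.
have C0 : 0 <= C by rewrite divr_ge0//; lra.
pose u k := \int[mu (s k)]_x transition (Q t) f x - \int[mu (s k)]_x f x.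
have ule k : `|u k| <= C * 2^-1 ^+ k.
  apply: (@le_trans _ _ (C * (D / r (s k)))); last exact: ler_wpM2l.
  have -> : C * (D / r (s k)) = B * (1 + budget + budget + ed) / r (s k).
    by rewrite /C /D; field; rewrite !gt_eqF.
  rewrite /u; move: (s k) => N.
  have e1 : \int[mu N]_x f x = \int[cesaro N 0]_x iter N (transition P) f x.
    by rewrite cesaro_shift// addn0.
  have [nu [_ nuf]] := act_exists t (cesaro N 0).
  have Fl : lip01 (iter N (transition P) f) by apply: iter_transition_lip01.
  have e2 : \int[mu N]_x transition (Q t) f x = \int[nu]_x iter N (transition P) f x.
    rewrite (act_Rintegral t_ge0 Fl nuf).
    transitivity (\int[cesaro N 0]_x iter N (transition P) (transition (Q t) f) x).
      by rewrite cesaro_shift// addn0.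
    by apply: eq_Rintegral => x _; exact: transition_comm.
  have [i1 m1] := cesaro_moment (leq0n N).
  have b2 : (\int[nu]_x (phi (V x))%:E <= (budget + ed)%:E)%E.
    rewrite nuf; [|exact/measurable_EFinP|by move=> y; rewrite lee_fin].
    apply: (@le_trans _ _ (\int[cesaro N 0]_x (ed + 1 * phi (V x))%:E)%E).
      apply: ge0_le_integral => //.
      - by move=> x _; apply: integral_ge0 => y _; rewrite lee_fin.
      - apply: (measurable_kernel_integral (mQ t)); first exact/measurable_EFinP.
        by move=> y; rewrite lee_fin.
      - by apply/measurable_EFinP; apply: measurable_funD => //; exact: measurable_funM.
      - move=> x _; rewrite -EFin_Rintegral; last exact: intphiV.
        rewrite lee_fin mul1r addrC; exact: (moment_growth Q_zero mV V_ge0 hphi K_ge0 drift).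
    rewrite -EFin_Rintegral; last exact: integrable_affine.
    by rewrite Rintegral_affine// mul1r lee_fin; lra.
  have i2 := ge0_integrable mphiV phiV_ge0 b2.
  have m2 : \int[nu]_x phi (V x) <= budget + ed by rewrite -lee_fin EFin_Rintegral.
  have le_D a1 a2 : a1 + a2 <= budget + budget + ed ->
      B * (1 + a1 + a2) / r N <= B * (1 + budget + budget + ed) / r N.
    by move=> ?; rewrite ler_pM2r ?invr_gt0// ler_pM2l//; lra.
  rewrite e1 e2 ler_norml lerNl opprB; apply/andP; split.
    by apply: (le_trans (mixing_measures (r0 N) (fun x y => H N f x y fl) fl i1 i2) (le_D _ _ _)); lra.
  by apply: (le_trans (mixing_measures (r0 N) (fun x y => H N f x y fl) fl i2 i1) (le_D _ _ _)); lra.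
have u_lim : u @ \oo --> \int[pi]_x transition (Q t) f x - \int[pi]_x f x.
  by apply: cvgB; exact: piP.
have u0 : u @ \oo --> (0 : R).
  have g0 : (fun k => C * 2^-1 ^+ k) @ \oo --> (0 : R).
    by apply: (@cvg_geometric R C 2^-1); rewrite ger0_norm//; lra.
  apply: (@squeeze_cvgr _ _ _ _ (fun k => - (C * 2^-1 ^+ k)) (fun k => C * 2^-1 ^+ k)) => //.
    by apply: nearW => k; rewrite -ler_norml; exact: ule.
  by rewrite -oppr0; exact: cvgN.
by apply/eqP; rewrite -subr_eq0; apply/eqP; exact: (cvg_unique (@Rhausdorff R) u_lim u0).
Qed.

Let rate_le_linear x : 1 + phi (V x) <= (1 + phi 1) * (1 + V x).
Proof.
have := rate_linear hphi (V_ge0 x); have := V_ge0 x; have p1' := p1 => v0 H.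
by lra.
Qed.

(** Write t = N * h + s with 0 <= s <= h, and let mixing act for N periods on the
  law at time s and on pi. Since A lies beyond one Euler step from 1, its N-th
  iterate lies beyond the (N + 1)-st iterate of 1, where Hphi is at least
  (N + 1) * c' >= C2 * t. *)
Lemma convergence_rate_small pi al : invariant_law pi -> 0 < al < 1 ->
  exists C1 C2 : R, [/\ 0 < C1, 0 < C2 & forall x t, 0 <= t ->
    (wasserstein (Q t x) pi <=
     (C1 * (1 + V x) / phi (Hphi_inv phi (C2 * t)) `^ (1 - al))%:E)%E].
Proof.
move=> ipi al01; have /andP[al0 al1] := al01.
have [B [c [A [B0 c0 A1 eA H]]]] := rate_mixing al01.
have [ipiV piV] := integrable_invariant ipi.
have p1' := p1; have K0 := K_ge0; have A0 : 0 <= A by lra.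
set ed := phi (excess_drift phi K h).
have ed0 : 0 <= ed by apply: (rate_ge0 hphi); exact: excess_drift_ge0.
pose c' := c / (1 + c * phi 1).
have c'0 : 0 < c' by rewrite divr_gt0// addr_gt0// mulr_gt0.
exists (B * (1 + phi 1 + ed + K)), (c' / h); split.
- by rewrite mulr_gt0//; lra.
- exact: divr_gt0.
move=> x t t_ge0; apply: (wasserstein_le_dual hborel hsep mdist_le1) => f fl.
have mf := lip01_measurable hborel fl.
pose N := Num.truncn (t / h); pose s := t - N%:R * h.
have th0 : 0 <= t / h by rewrite divr_ge0.
have /andP[Nt tN] := truncn_itv th0; rewrite -/N in Nt tN.
have s0 : 0 <= s by rewrite subr_ge0 -ler_pdivlMr.
have sh : s <= h.
  have : t <= N.+1%:R * h by rewrite -ler_pdivrMr// ltW.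
  by rewrite -natr1 mulrDl mul1r /s lerBlDr addrC.
have ts : t = s + N%:R * h by rewrite /s subrK.
set z := iter N (euler phi c) A.
have z1 : 1 <= z by apply: (le_trans A1); exact: iter_euler_ge.
have pz : 0 < phi z by apply: rate_gt0 => //; lra.
have -> : \int[Q t x]_y f y = \int[Q s x]_y iter N (transition P) f y.
  rewrite {1}ts (semigroup_Rintegral mQ Q_semigroup x (kh_ge0 N) s0 mf fl.2).
  by apply: eq_Rintegral => y _; rewrite -iter_transition_semigroup.
rewrite -[X in _ - X](invariant_iter N ipi fl).
have r0 : 0 < phi z `^ (1 - al) by rewrite powR_gt0.
have := mixing_measures r0 (fun y y' => H N f y y' fl) fl (intphiV x s0) ipiV.
move=> /le_trans; apply.
have Hz : phi (Hphi_inv phi (c' / h * t)) <= phi z.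
  have ct : 0 <= c' / h * t by rewrite mulr_ge0// divr_ge0// ltW.
  have [i1 _] := Hphi_invP hphi ct.
  apply: rate_mono => //; first by lra.
  apply: Hphi_inv_le => //.
  have e1 : iter N.+1 (euler phi c) 1 <= z.
    rewrite iterSr; apply: iter_euler_mono => //.
    by apply: (le_trans _ (euler_ge hphi c0 _)); lra.
  have i1' : 1 <= iter N.+1 (euler phi c) 1 by apply: iter_euler_ge => //; lra.
  apply: le_trans (Hphi_mono hphi i1' e1).
  have := Hphi_iter_euler hphi N.+1 c0 (lexx 1); rewrite Hphi1 add0r; apply: le_trans.
  rewrite -/c' mulrAC -mulrA mulrC ler_pM2r//; exact: ltW.
have pi0 : 0 < phi (Hphi_inv phi (c' / h * t)).
  have ct : 0 <= c' / h * t by rewrite mulr_ge0// divr_ge0// ltW.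
  by have [i1 _] := Hphi_invP hphi ct; apply: rate_gt0 => //; lra.
have al' : 0 <= 1 - al by lra.
have rr : phi (Hphi_inv phi (c' / h * t)) `^ (1 - al) <= phi z `^ (1 - al).
  by apply: ge0_ler_powR => //; rewrite nnegrE ltW.
have sgrow := moment_growth Q_zero mV V_ge0 hphi K_ge0 drift x s0.
have eds : phi (excess_drift phi K s) <= ed.
  by apply: rate_mono => //; [exact: excess_drift_ge0|exact: excess_drift_mono].
have num : B * (1 + \int[Q s x]_y phi (V y) + \int[pi]_y phi (V y)) <=
    B * (1 + phi 1 + ed + K) * (1 + V x).
  rewrite -mulrA ler_pM2l//; have V0 := V_ge0 x.
  have e1 : 0 <= (ed + K) * V x by rewrite mulr_ge0// addr_ge0.
  have := rate_le_linear x; lra.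
have V0 := V_ge0 x.
apply: ler_pM => //.
- apply: mulr_ge0; first exact: ltW.
  by rewrite !addr_ge0//; exact: Rintegral_ge0.
- by rewrite invr_ge0 ltW.
- by rewrite lef_pV2 // posrE powR_gt0.
Qed.

(** When the exponent is not positive the denominator stays bounded, so the
  trivial bound by the diameter suffices. *)
Theorem convergence_rate pi eps : invariant_law pi -> 0 < eps ->
  exists C1 C2 : R, [/\ 0 < C1, 0 < C2 & forall x t, 0 <= t ->
    (wasserstein (Q t x) pi <=
     (C1 * (1 + V x) / phi (Hphi_inv phi (C2 * t)) `^ (1 - eps))%:E)%E].
Proof.
move=> ipi e0; have [e1|e1] := ltP eps 1.
  by apply: convergence_rate_small => //; rewrite e0.
exists (phi 1 `^ (1 - eps)), 1; split=> [||x t t_ge0]; rewrite ?powR_gt0//.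
apply: (wasserstein_le_dual hborel hsep mdist_le1) => f fl.
have f1 (m : probability E R) : 0 <= \int[m]_y f y <= 1.
  by apply: Rintegral_bounded; [exact: (lip01_measurable hborel)|exact: fl.2].
apply: (@le_trans _ _ 1).
  by have /andP[? ?] := f1 (Q t x); have /andP[? ?] := f1 pi; lra.
rewrite mul1r; have [i1 _] := Hphi_invP hphi t_ge0.
set y := Hphi_inv phi t in i1 *.
have py : phi 1 <= phi y by apply: rate_mono.
have p1' := p1; have py0 : 0 < phi y by lra.
rewrite ler_pdivlMr ?powR_gt0// mul1r.
have V0 := V_ge0 x.
apply: (@le_trans _ _ (phi 1 `^ (1 - eps))); last by rewrite ler_peMr ?powR_ge0//; lra.
have neg (w : R) : 0 < w -> w `^ (1 - eps) = (w `^ (eps - 1))^-1.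
  by move=> w0; rewrite -powRN opprB.
rewrite !neg// lef_pV2 ?posrE ?powR_gt0//.
by apply: ge0_ler_powR; rewrite ?nnegrE ?subr_ge0// ltW.
Qed.

End ergodicity.

(** * The drift inequality over a time step *)

Section lyapunov_drift.
Context (R : realType) d (E : measurableType d).
Variables (Q : R -> E -> probability E R) (V : E -> R) (phi : R -> R) (K : R).
Hypotheses (mQ : forall t A, measurable A -> measurable_fun setT (fun x => Q t x A)).
Hypothesis Q_semigroup : forall s t x A, 0 <= s -> 0 <= t -> measurable A ->
  (Q (t + s) x A = \int[Q t x]_y Q s y A)%E.
Hypotheses (mV : measurable_fun setT V) (V_ge0 : forall x, 0 <= V x).
Hypotheses (hphi : rate_function phi) (K_ge0 : 0 <= K).
Hypothesis measurable_moment : forall (t : R) (x : E), 0 <= t ->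
  measurable_fun (`[0, t]%classic : set (measurableTypeR R)) (fun u => \int[Q u x]_y (phi (V y))%:E)%E.
Hypothesis lyapunov : forall (t : R) x, 0 <= t ->
  (\int[Q t x]_y (V y)%:E <= (V x)%:E -
   \int[@lebesgue_measure R]_(u in `[0%R, t]) \int[Q u x]_y (phi (V y))%:E +
   (K * t)%:E)%E.

Let phiV_ge0 y : (0 <= (phi (V y))%:E)%E.
Proof. by rewrite lee_fin; exact: (rate_ge0 hphi). Qed.

Let mphiV : measurable_fun setT (fun y => phi (V y)).
Proof. exact: measurable_rate. Qed.

Let mEphiV : measurable_fun setT (fun y => (phi (V y))%:E).
Proof. exact/measurable_EFinP. Qed.

Let occupation (t : R) x :=
  (\int[@lebesgue_measure R]_(u in `[0%R, t]) \int[Q u x]_y (phi (V y))%:E)%E.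

Let occupation_ge0 t x : (0 <= occupation t x)%E.
Proof. by apply: integral_ge0 => u _; exact: integral_ge0. Qed.

Lemma lyapunov_mean t x : 0 <= t -> (\int[Q t x]_y (V y)%:E <= (V x + K * t)%:E)%E.
Proof.
move=> t_ge0; apply: (le_trans (lyapunov x t_ge0)).
by rewrite EFinD leeD2r// geeDl// oppe_le0; exact: occupation_ge0.
Qed.

Let lyapunov_integrable t x : 0 <= t -> (Q t x).-integrable setT (EFin \o V).
Proof. by move=> t_ge0; exact: ge0_integrable mV V_ge0 (lyapunov_mean x t_ge0). Qed.

Let lyapunov_integrable_rate t x : 0 <= t ->
  (Q t x).-integrable setT (EFin \o (fun y => phi (V y))).
Proof. by move=> t_ge0; apply: integrable_rate => //; exact: lyapunov_integrable. Qed.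

(** Only V is controlled along the semigroup; concavity carries this over to
  phi(V). *)
Lemma lyapunov_jensen K1 t x : K < K1 -> 0 < t ->
  \int[Q t x]_y phi (V y) <= phi (V x) + phi (K1 * t).
Proof.
move=> KK1 t_gt0; have K0 := K_ge0; have t_ge0 := ltW t_gt0.
have Kt : 0 < K1 * t by rewrite mulr_gt0//; lra.
apply: le_trans (rate_subadd hphi (V_ge0 x) (ltW Kt)).
apply: jensen_rate => //; [exact: lyapunov_integrable|exact: ltr_wpDl|].
have := lyapunov_mean x t_ge0; rewrite -EFin_Rintegral ?lee_fin; last exact: lyapunov_integrable.
by move=> /le_trans; apply; rewrite lerD2l ler_pM2r// ltW.
Qed.

(** Along the path the mean of phi(V) may drop, but it grows by at most
  phi(K1 dl) within a time dl; its time average over [0, dl] is therefore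
  controlled from below by its value at the end. *)
Lemma moment_end_le K1 u dl x : K < K1 -> 0 <= u <= dl ->
  \int[Q dl x]_y phi (V y) <= \int[Q u x]_y phi (V y) + phi (K1 * dl).
Proof.
move=> KK1 /andP[u0 udl]; have K0 := K_ge0.
have K1dl : 0 <= K1 * dl by apply: mulr_ge0; lra.
have pK : 0 <= phi (K1 * dl) by exact: (rate_ge0 hphi).
move: udl; rewrite le_eqVlt => /predU1P[->|udl]; first by rewrite lerDl.
have dl0 : 0 <= dl by lra.
have s0 : 0 < dl - u by lra.
rewrite -lee_fin EFin_Rintegral; last exact: lyapunov_integrable_rate.
have e : dl = u + (dl - u) by rewrite addrC subrK.
rewrite [X in Q X]e (semigroup_integral mQ Q_semigroup x (ltW s0) u0 mEphiV)//.
rewrite -[leRHS](_ : \int[Q u x]_y (phi (K1 * dl) + 1 * phi (V y))%:E = _)%E; last first.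
  rewrite -EFin_Rintegral; last by apply: integrable_affine; exact: lyapunov_integrable_rate.
  by rewrite Rintegral_affine ?mul1r 1?addrC//; exact: lyapunov_integrable_rate.
apply: ge0_le_integral => //.
- by move=> y _; exact: integral_ge0.
- exact: (measurable_kernel_integral (mQ (dl - u))).
- by apply/measurable_EFinP; apply: measurable_funD => //; exact: measurable_funM.
move=> y _; rewrite -EFin_Rintegral ?lee_fin; last by apply: lyapunov_integrable_rate; exact: ltW.
apply: (le_trans (lyapunov_jensen y KK1 s0)); rewrite mul1r addrC lerD2r.
apply: rate_mono => //; first by apply: mulr_ge0; lra.
by apply: ler_wpM2l; lra.
Qed.

Theorem lyapunov_drift K1 (dl : R) x : K < K1 -> 0 <= dl ->
  (\int[Q dl x]_y (V y)%:E + dl%:E * \int[Q dl x]_y (phi (V y))%:E <=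
   (V x + dl * (K1 + phi (K1 * dl)))%:E)%E.
Proof.
move=> KK1 dl0; have K0 := K_ge0.
have H := lyapunov x dl0; rewrite -/(occupation dl x) in H.
(* An infinite time integral would make the right-hand side of the Lyapunov
   condition equal to -oo. *)
have fo : occupation dl x \is a fin_num.
  rewrite fin_numElt (lt_le_trans _ (occupation_ge0 dl x)) ?ltNy0//=.
  rewrite ltey; apply/eqP => oy; move: H; rewrite oy /= => H.
  have : (0 <= \int[Q dl x]_y (V y)%:E)%E by apply: integral_ge0 => y _; rewrite lee_fin.
  by move=> /le_trans/(_ H).
set p := \int[Q dl x]_y phi (V y).
have p0 : 0 <= p by apply: Rintegral_ge0 => y _; exact: (rate_ge0 hphi).
have K1dl : 0 <= K1 * dl by apply: mulr_ge0; lra.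
have pK : 0 <= phi (K1 * dl) by exact: (rate_ge0 hphi).
have le_occ : ((dl * p)%:E <= occupation dl x + (dl * phi (K1 * dl))%:E)%E.
  have cstI (q : R) : 0 <= q ->
      (\int[@lebesgue_measure R]_(u in `[0%R, dl]) q%:E = (dl * q)%:E)%E.
    move=> q0; rewrite integral_cst//= lebesgue_measure_itv/= lte_fin.
    case: ltP => d0; first by rewrite oppr0 adde0 -EFinM mulrC.
    have -> : dl = 0 by apply: le_anti; rewrite d0 dl0.
    by rewrite mule0 mul0r.
  rewrite -!cstI// /occupation -ge0_integralD//; last 2 first.
  - by move=> u _; exact: integral_ge0.
  - exact: measurable_moment.
  apply: ge0_le_integral => //.
  - by apply: emeasurable_funD => //; exact: measurable_moment.
  move=> u /=; rewrite in_itv /= => u01; have /andP[u0 _] := u01.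
  rewrite -EFin_Rintegral ?lee_fin; last exact: lyapunov_integrable_rate.
  exact: moment_end_le.
rewrite -EFin_Rintegral; last exact: lyapunov_integrable.
rewrite -EFin_Rintegral; last exact: lyapunov_integrable_rate.
rewrite -/p -EFinM -EFinD lee_fin.
move: H; rewrite -EFin_Rintegral; last exact: lyapunov_integrable.
move: le_occ; rewrite -(fineK fo) -!EFinD !lee_fin.
move: (fine _) => o le_occ H.
have : K * dl <= K1 * dl by apply: ler_wpM2r => //; exact: ltW.
lra.
Qed.

End lyapunov_drift.

(** * The semigroup of the process *)

Section process.
Context (R : realType) (dE : measure_display) (E : measurableCompleteMetricType dE R).
Context (dO : measure_display) (Omega : measurableType dO).
Variables (F : R -> set (set Omega)) (P_ : E -> probability Omega R).
Variables (X : R -> Omega -> E) (Pt : R -> R.-pker E ~> E).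
Hypothesis hborel : is_borel E.
Hypothesis hX : strong_markov_process F P_ X Pt.

(** Progressive measurability refers to the sigma-algebra at the end of the
  time interval; forgetting it leaves joint measurability. *)
Lemma joint_measurable (t : R) : 0 <= t ->
  measurable_fun (setT `*` `[0, t]%classic : set (Omega * measurableTypeR R))
    (fun z => X z.2 z.1).
Proof.
move=> t0; have [_ Fm _] := smp_filtration hX.
pose swap (z : Omega * measurableTypeR R) :
  measurableTypeR R * g_sigma_algebraType (F t) := (z.2, z.1).
have mswap : measurable_fun setT swap.
  apply/measurable_fun_pairP; split; first exact: measurable_snd.
  have fst1 : measurable_fun setT (fst : Omega * measurableTypeR R -> Omega) by exact: measurable_fst.
  move=> _ B mB; apply: fst1 => //.
  by move: mB; apply: smallest_sub; [exact: sigma_algebra_measurable|exact: Fm].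
have -> : (fun z : Omega * measurableTypeR R => X z.2 z.1) = (fun z => X z.1 z.2) \o swap by [].
apply: (measurable_comp _ _ (smp_progressive hX t0)) => //.
- apply: measurableX; first exact: measurable_itv.
  exact: measurableT.
- by move=> _ [w [? ?] <-].
- exact: (measurable_funS measurableT).
Qed.

Lemma measurable_coordinate (t : R) : 0 <= t -> measurable_fun setT (X t).
Proof.
move=> t0.
have mpair : measurable_fun setT (fun w : Omega => (w, t) : Omega * measurableTypeR R).
  by apply: measurable_fun_pair => //; exact: measurable_id.
have -> : X t = (fun z : Omega * measurableTypeR R => X z.2 z.1) \o (fun w => (w, t)) by [].
apply: (measurable_comp _ _ (joint_measurable t0)) => //.
- by apply: measurableX => //; exact: measurable_itv.
- by move=> _ [w _ <-]; split=> //=; rewrite in_itv /= t0 lexx.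
Qed.

Lemma kernel_law (k : R.-pker E ~> E) x : exists q : probability E R,
  forall A, q A = k x A.
Proof. by apply: measure1_probability; exact: prob_kernel. Qed.

(** The kernels again, as a family of bundled probabilities. *)
Definition law t x : probability E R := projT1 (cid (kernel_law (Pt t) x)).

Lemma lawE t x A : law t x A = Pt t x A.
Proof. exact: (projT2 (cid (kernel_law (Pt t) x))). Qed.

Lemma measurable_law t A : measurable A -> measurable_fun setT (fun x => law t x A).
Proof.
move=> mA; rewrite (_ : (fun x => law t x A) = (fun x => Pt t x A)).
  exact: measurable_kernel.
by apply/funext => x; exact: lawE.
Qed.

Lemma integral_law t x (g : E -> \bar R) : 0 <= t -> measurable_fun setT g ->
  (forall y, 0 <= g y)%E -> (\int[law t x]_y g y = \int[P_ x]_w g (X t w))%E.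
Proof.
move=> t0 mg g0; have mX := measurable_coordinate t0.
transitivity (\int[pushforward (P_ x) (X t)]_y g y)%E; last first.
  by rewrite ge0_integral_pushforward// => y _; exact: g0.
apply: eq_measure_integral => A mA _; rewrite -[LHS]/(law t x A) lawE.
exact: (smp_law hX).
Qed.

(** The strong Markov property at a constant time. *)
Lemma law_semigroup s t x A : 0 <= s -> 0 <= t -> measurable A ->
  (law (t + s) x A = \int[law t x]_y law s y A)%E.
Proof.
move=> s0 t0 mA; have [sF Fm _] := smp_filtration hX.
pose tau (_ : Omega) := t%:E.
have FT u : 0 <= u -> F u setT.
  by move=> u0; have [G0 GC _] := sF u u0; have := GC _ G0; rewrite setD0.
have tauE u : 0 <= u -> F u [set w | (tau w <= u%:E)%E].
  move=> u0; rewrite /tau; have [tu|tu] := leP t u.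
    by rewrite (_ : [set _ | _] = setT); [exact: FT|apply/seteqP; split].
  rewrite (_ : [set _ | _] = set0); first by have [] := sF u u0.
  by apply/seteqP; split=> // w /=; rewrite lee_fin leNgt tu.
have st : stopping_time F tau by split=> // w; rewrite lee_fin.
have sT : stopped F tau setT.
  by split=> // u u0; rewrite setTI; exact: tauE.
have := smp_strong_markov hX st x s0 mA sT; rewrite !setTI.
rewrite (_ : [set w | _ /\ _] = X (t + s) @^-1` A); last first.
  by apply/seteqP; split=> w /=; [case|split; rewrite ?ltry].
rewrite (_ : [set w | (tau w < +oo)%E] = setT); last first.
  by apply/seteqP; split=> // w _ /=; rewrite ltry.
rewrite lawE (smp_law hX) ?addr_ge0// => ->.
rewrite integral_law//; last exact: measurable_law.
by apply: eq_integral => w _; rewrite lawE.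
Qed.

Lemma law_zero x A : measurable A -> law 0 x A = (\1_A x)%:E.
Proof.
move=> mA; rewrite lawE (smp_law hX)//.
have mX := measurable_coordinate (lexx (0 : R)).
have m1 : measurable [set x].
  rewrite -(setCK [set x]); apply: measurableC; apply: (measurable_open hborel).
  rewrite openC; exact/accessible_closed_set1/hausdorff_accessible/metric_hausdorff.
have start : P_ x (X 0 @^-1` [set x]) = 1%E := smp_start hX x.
have mS : measurable (X 0 @^-1` [set x]) by rewrite -[X in measurable X]setTI; exact: mX.
have mB : measurable (X 0 @^-1` A) by rewrite -[X in measurable X]setTI; exact: mX.
rewrite indicE; have [xA|xA] := boolP (x \in A).
  apply: le_anti; rewrite probability_le1//= -start.
  apply: le_measure; rewrite ?inE//.
  by move=> w /= ->; exact/set_mem.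
apply: le_anti; rewrite measure_ge0 andbT.
have <- : P_ x (~` (X 0 @^-1` [set x])) = 0%:E.
  by rewrite probability_setC// start subee.
apply: le_measure; rewrite ?inE//; first exact: measurableC.
by move=> w /= Aw wx; move: xA; rewrite -wx (mem_set Aw).
Qed.

Variables (g : E -> R) (mg : measurable_fun setT g) (g_ge0 : forall y, 0 <= g y).

(* Tonelli's theorem concerns functions on the whole product: hence the
   extension by 0 outside [0, t]. *)
Let truncated (t : R) (z : Omega * measurableTypeR R) : \bar R :=
  ((fun z => (g (X z.2 z.1))%:E) \_ (setT `*` (`[0%R, t]%classic : set R))) z.

Let mtruncated t : 0 <= t -> measurable_fun setT (truncated t).
Proof.
move=> t0; apply: (measurable_restrictT _ _).1.
  by apply: measurableX => //; exact: measurable_itv.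
apply/measurable_EFinP; exact: (measurableT_comp mg (joint_measurable t0)).
Qed.

Let truncated_ge0 t z : (0 <= truncated t z)%E.
Proof. by rewrite /truncated patchE; case: ifP => // _; rewrite lee_fin. Qed.

Let truncatedE t w : (fun u : R => truncated t (w, u)) =
  (fun u : R => (g (X u w))%:E) \_ (`[0, t]%classic : set R).
Proof.
apply/funext => u; rewrite /truncated !patchE; congr (if _ then _ else _).
by apply/idP/idP; rewrite !inE /=; [case|split].
Qed.

Lemma measurable_law_integral t x : 0 <= t ->
  measurable_fun (`[0, t]%classic : set (measurableTypeR R))
    (fun u => \int[law u x]_y (g y)%:E)%E.
Proof.
move=> t0.
have mI : measurable (`[0, t]%classic : set (measurableTypeR R)) by exact: measurable_itv.
have H := measurable_fun_fubini_tonelli_G (m1 := P_ x) (truncated t) (mtruncated t0) (truncated_ge0 t).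
apply: (eq_measurable_fun (fubini_G (P_ x) (truncated t))); last first.
  exact: (measurable_funS measurableT).
move=> u; rewrite inE /= in_itv /= => /andP[u0 ut].
rewrite integral_law//; last exact/measurable_EFinP.
  rewrite /fubini_G; apply: eq_integral => w _.
  by rewrite /truncated patchE ifT// inE /=; split=> //; rewrite in_itv /= u0.
Qed.

Lemma path_integral_law t x : 0 <= t ->
  (\int[P_ x]_w \int[@lebesgue_measure R]_(u in `[0%R, t]) (g (X u w))%:E =
   \int[@lebesgue_measure R]_(u in `[0%R, t]) \int[law u x]_y (g y)%:E)%E.
Proof.
move=> t0; have mgE : measurable_fun setT (fun y => (g y)%:E) by exact/measurable_EFinP.
transitivity (\int[P_ x]_w \int[@lebesgue_measure R]_u truncated t (w, u))%E.
  by apply: eq_integral => w _; rewrite integral_mkcond -truncatedE.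
rewrite (fubini_tonelli (truncated t) (mtruncated t0) (truncated_ge0 t)) [RHS]integral_mkcond.
apply: eq_integral => u _; rewrite patchE; case: ifPn => [|/negP uI].
  rewrite inE /= in_itv /= => /andP[u0 ut].
  rewrite integral_law//.
  apply: eq_integral => w _.
  by rewrite /truncated patchE ifT// inE /=; split=> //; rewrite in_itv /= u0.
apply: integral0_eq => w _; rewrite /truncated patchE ifF//.
by apply/negP; rewrite inE => -[_ /= H]; apply: uI; rewrite inE.
Qed.

End process.

(** * Unique ergodicity and the rate of convergence *)

Lemma wasserstein_congr (R : realType) (dE : measure_display)
    (E : measurableCompleteMetricType dE R) (mu nu mu' nu' : {measure set E -> \bar R}) :
  (forall A, mu A = mu' A) -> (forall A, nu A = nu' A) ->
  wasserstein mu nu = wasserstein mu' nu'.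
Proof.
move=> emu enu; rewrite /wasserstein.
rewrite (_ : couplings mu nu = couplings mu' nu')//.
apply/seteqP; split=> la H A mA; have [-> ->] := H A mA; split;
  by rewrite (emu, enu) || rewrite -(emu, enu).
Qed.

Theorem theorem2p4 (R : realType)
    (dE : measure_display) (E : measurableCompleteMetricType dE R)
    (hborel : is_borel E) (hsep : separable E)
    (dO : measure_display) (Omega : measurableType dO)
    (F : R -> set (set Omega)) (P_ : E -> probability Omega R)
    (X : R -> Omega -> E) (Pt : R -> R.-pker E ~> E)
    (hX : strong_markov_process F P_ X Pt)
    (V : E -> R) (mV : measurable_fun setT V) (V_ge0 : forall x, 0 <= V x)
    (phi : R -> R) (hphi : rate_function phi) (K : R) (K_ge0 : 0 <= K)
    (hlyap : forall (t : R) (x : E), 0 <= t ->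
       (\int[P_ x]_w (V (X t w))%:E <=
        (V x)%:E
        - \int[P_ x]_w \int[@lebesgue_measure R]_(u in `[0%R, t])
             (phi (V (X u w)))%:E
        + (K * t)%:E)%E)
    (t0 : R) (t0_ge0 : 0 <= t0)
    (hnonexp : forall (t : R) (x y : E), t0 <= t ->
       (wasserstein (Pt t x) (Pt t y) <= (mdist x y)%:E <= 1)%E)
    (hcontr : forall r t : R, 0 < r -> t0 <= t ->
       exists2 rho : R, 0 < rho &
         forall x y : E, V x + V y <= r ->
           (wasserstein (Pt t x) (Pt t y) <= ((1 - rho) * mdist x y)%:E)%E) :
  exists mu : probability E R,
    [/\ stationary Pt mu,
        forall nu : probability E R, stationary Pt nu ->
          forall A, measurable A -> nu A = mu A,
        (\int[mu]_u (phi (V u))%:E <= K%:E)%E &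
        forall eps : R, 0 < eps ->
          exists C1 C2 : R, [/\ 0 < C1, 0 < C2 &
            forall (x : E) (t : R), 0 <= t ->
              (wasserstein (Pt t x) mu <=
               (C1 * (1 + V x)
                / (phi (Hphi_inv phi (C2 * t)) `^ (1 - eps)))%:E)%E]].
Proof.
pose Q := law Pt.
have mdist_le1 (x y : E) : mdist x y <= 1.
  by have /andP[_] := hnonexp t0 x y (lexx t0); rewrite lee_fin.
have mQ : forall t A, measurable A -> measurable_fun setT (fun x => Q t x A).
  exact: measurable_law.
have Q_semigroup := law_semigroup hX.
have Q_zero := law_zero hborel hX.
have mphiV : measurable_fun setT (fun y => phi (V y)) by exact: measurable_rate.
have phiV_ge0 y : 0 <= phi (V y) by exact: (rate_ge0 hphi).
have lyapunov (t : R) x : 0 <= t ->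
  (\int[Q t x]_y (V y)%:E <= (V x)%:E -
   \int[@lebesgue_measure R]_(u in `[0%R, t]) \int[Q u x]_y (phi (V y))%:E +
   (K * t)%:E)%E.
  move=> t_ge0; rewrite -(path_integral_law hX mphiV phiV_ge0 x t_ge0).
  rewrite (integral_law hX)//; last exact/measurable_EFinP.
  exact: hlyap.
have drift := lyapunov_drift mQ Q_semigroup mV V_ge0 hphi K_ge0
  (measurable_law_integral hX mphiV phiV_ge0) lyapunov.
have nonexp t x y : t0 <= t -> (wasserstein (Q t x) (Q t y) <= (mdist x y)%:E)%E.
  move=> t0t; rewrite (wasserstein_congr (lawE Pt t x) (lawE Pt t y)).
  by have /andP[] := hnonexp t x y t0t.
have contr r t : 0 < r -> t0 <= t -> exists2 rho : R, 0 < rho & forall x y,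
    V x + V y <= r -> (wasserstein (Q t x) (Q t y) <= ((1 - rho) * mdist x y)%:E)%E.
  move=> r0 t0t; have [rho rho0 H] := hcontr r t r0 t0t; exists rho => // x y xy.
  by rewrite (wasserstein_congr (lawE Pt t x) (lawE Pt t y)); exact: H.
have stationaryP nu : stationary Pt nu <-> invariant_law Q nu.
  by split=> H t t_ge0 A mA; rewrite -(H t t_ge0 A mA); apply: eq_integral => x _; rewrite lawE.
have [mu imu] := invariant_exists hborel hsep mdist_le1 mQ Q_semigroup Q_zero mV V_ge0
  hphi K_ge0 drift t0_ge0 nonexp contr.
exists mu; split.
- exact/stationaryP.
- move=> nu /stationaryP inu A mA.
  exact: (invariant_unique hborel hsep mdist_le1 mQ Q_semigroup Q_zero mV V_ge0 hphi K_ge0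
    drift t0_ge0 nonexp contr).
- exact: (invariant_moment mQ mV V_ge0 hphi K_ge0 drift).
move=> eps eps0.
have [C1 [C2 [C10 C20 H]]] := convergence_rate hborel hsep mdist_le1 mQ Q_semigroup Q_zero
  mV V_ge0 hphi K_ge0 drift t0_ge0 nonexp contr imu eps0.
exists C1, C2; split=> // x t t_ge0.
by rewrite -(wasserstein_congr (lawE Pt t x) (fun A => erefl (mu A))); exact: H.
Qed.
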